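(* Let $G=\mathcal P\times\mathbb Z$ act on the space $\mathcal J$ of bounded Jacobi matrices by $(p,n)\cdot J=p\cdot(S^nJ)$. Then the matrices $T(g;J)$, defined for $g=(p,n)\in G$ and $J\in\mathcal J$ by $T(g;J)=T(p;n\cdot J)\,T(n;J)$, form an $\mathcal{SL}$-cocycle for the action of $G$; that is, $T(g;J)\in\mathcal{SL}$ and $$T(g+h;J)=T(g;h\cdot J)\,T(h;J)\qquad\text{for all }g,h\in G,\ J\in\mathcal J$$ (the group operation of the abelian group $G$ being written additively).
   Context: A (bounded) Jacobi matrix is an operator on $\ell^2(\mathbb Z)$ of the form $(Ju)_n=a_nu_{n+1}+a_{n-1}u_{n-1}+b_nu_n$ with bounded sequences $a_n>0$, $b_n\in\mathbb R$; $\mathcal J$ is the set of all of them. The shift $S$ sends $J$ to the Jacobi matrix $SJ$ with coefficients $(a_{n+1},b_{n+1})$, and $n\cdot J=S^nJ$ for $n\in\mathbb Z$. Toda flows: $\mathcal P=\mathbb R[x]$ is regarded as an abelian group under addition. For a bounded self-adjoint $X$ with matrix elements $X_{jk}=\langle\delta_j,X\delta_k\rangle$, put $(X_a)_{jk}=X_{jk}$ for $j<k$, $=-X_{jk}$ for $j>k$, and $(X_a)_{jj}=0$. For $p\in\mathcal P$, the equation $\dot J=[p(J)_a,J]$ defines a global flow on $\mathcal J$, and $p\cdot J$ is the time-one map of this flow (so $tp\cdot J$, $t\in\mathbb R$, is the flow itself). It is known that these flows commute with each other and with $S$, so that $\mathcal P\times\mathbb Z$ acts on $\mathcal J$ by $(p,n)\cdot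 J=p\cdot(S^nJ)=S^n(p\cdot J)$. $\mathcal{SL}$ is the group (under pointwise multiplication) of all entire functions $T:\mathbb C\to SL(2,\mathbb C)$ with $T(x)\in SL(2,\mathbb R)$ for $x\in\mathbb R$. An $\mathcal{SL}$-cocycle for an action of a group $G$ on a space $X$ is a map $T:G\times X\to\mathcal{SL}$ with $T(gh,x)=T(g,h\cdot x)T(h,x)$. Shift cocycle: $T(1;J)=A(J)=\begin{pmatrix}\frac{z-b_1}{a_1}&\frac1{a_1}\\-a_1&0\end{pmatrix}$, $T(n;J)=A((n-1)\cdot J)\cdots A(1\cdot J)A(J)$ and $T(-n;J)=T(n;(-n)\cdot J)^{-1}$ for $n\ge1$, and $T(0;J)=1$. Toda cocycle: for $p\in\mathcal P$, $T(p;J)$ is the value at $t=1$ of the solution of $\dot T=B_p(z,tp\cdot J)\,T$, $T(0)=1$, where $$B_p(z,J)=\begin{pmatrix}2(z-b_1)G_1-H_1&2G_1\\-2a_0^2G_0&-2(z-b_1)G_1+H_1\end{pmatrix}.$$ Here $G=G_p$, $H=H_p$ are functions of $z$, $J$ and $n\in\mathbb Z$, and the index denotes the value of $n$. They depend linearly on $p$: if $p(x)=\sum c_kx^k$, then $G_p=\sum c_kG^{(k)}$, $H_p=\sum c_kH^{(k)}$, with $$G^{(k)}_n=\sum_{j=0}^{k-1}z^{k-1-j}\langle\delta_n,J^j\delta_n\rangle,\qquad H^{(k)}_n=z^k-\langle\delta_n,J^k\delta_n\rangle+2a_n\sum_{j=1}^{k-1}z^{k-1-j}\langle\delta_n,SJ^j\delta_n\rangle,$$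 where in the last sum $S$ is the shift operator $(Sx)_n=x_{n+1}$ on $\ell^2(\mathbb Z)$, so $\langle\delta_n,SJ^j\delta_n\rangle=\langle\delta_{n+1},J^j\delta_n\rangle$. *)

(* Defs.v *)
From HB Require Import structures.
From mathcomp Require Import all_boot all_order all_algebra.
From mathcomp Require Import all_classical all_reals all_analysis.
From mathcomp Require Import complex.

Set Implicit Arguments.
Unset Strict Implicit.
Unset Printing Implicit Defensive.

Import Order.TTheory GRing.Theory Num.Theory.
Import numFieldNormedType.Exports.

Local Open Scope classical_set_scope.
Local Open Scope complex_scope.
Local Open Scope ring_scope.

(* A bounded Jacobi matrix is given by its coefficient sequences. *)
Record jacobi (R : realType) := Jacobi {
  ja : int -> R;
  jb : int -> R;
  ja_gt0 : forall n, 0 < ja n;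
  jac_bounded : exists M : R, forall n, `|ja n| <= M /\ `|jb n| <= M
}.

Section JacobiShift.
Variable R : realType.

Fact jshift_gt0 (n : int) (J : jacobi R) (m : int) : 0 < ja J (m + n).
Proof. exact: ja_gt0. Qed.

Fact jshift_bounded (n : int) (J : jacobi R) :
  exists M : R, forall m, `|ja J (m + n)| <= M /\ `|jb J (m + n)| <= M.
Proof. by have [M hM] := jac_bounded J; exists M => m; exact: hM. Qed.

(* jshift n J = S^n J = n . J *)
Definition jshift (n : int) (J : jacobi R) : jacobi R :=
  Jacobi (jshift_gt0 n J) (jshift_bounded n J).

End JacobiShift.

Section TodaFlow.
Variable R : realType.
Implicit Types (J : jacobi R) (p : {poly R}).

Definition delta (n : int) : int -> R := fun m => (m == n)%:R.

Definition jacobi_op J (u : int -> R) : int -> R :=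
  fun n => ja J n * u (n + 1) + ja J (n - 1) * u (n - 1) + jb J n * u n.

(* jpow J k m n = <delta_m, J^k delta_n>; since delta_n has finite support,
   iterating the difference expression on all sequences is the same as taking
   powers of the operator on l^2(Z). *)
Definition jpow J (k : nat) (m n : int) : R := iter k (jacobi_op J) (delta n) m.

Definition jmx J : int -> int -> R := jpow J 1.

Definition poly_mx p J (m n : int) : R := \sum_(k < size p) p`_k * jpow J k m n.

Definition antisym (X : int -> int -> R) (j k : int) : R :=
  if j < k then X j k else if k < j then - X j k else 0.

(* Sum over the (finite) support of the summand; only used for banded X, Y. *)
Definition mulZ (X Y : int -> int -> R) (j k : int) : R :=
  \sum_(l \in [set: int]) (X j l * Y l k).

Definition commZ (X Y : int -> int -> R) (j k : int) : R :=
  mulZ X Y j k - mulZ Y X j k.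

(* Norm derivative at t of a curve X of tridiagonal matrices: for matrices of
   fixed band width, uniform convergence of the matrix elements is convergence
   in the operator norm of l^2(Z). *)
Definition is_norm_derive (X : R -> int -> int -> R) (t : R)
    (D : int -> int -> R) : Prop :=
  forall e : R, 0 < e -> \forall h \near (0 : R)^',
    forall j k : int, `|h^-1 * (X (t + h) j k - X t j k) - D j k| <= e.

Definition is_toda_flow p J (F : R -> jacobi R) : Prop :=
  F 0 = J /\
  forall t : R, is_norm_derive (fun s => jmx (F s)) t
                  (commZ (antisym (poly_mx p (F t))) (jmx (F t))).

(* The default value (the constant curve) is irrelevant: the equation has a
   unique global solution. *)
Definition toda_flow p J : R -> jacobi R :=
  if pselect (exists F, is_toda_flow p J F) is left ex then projT1 (cid ex)
  else fun=> J.

Definition toda p J : jacobi R := toda_flow p J 1.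

(* (p, n) . J = p . (S^n J) *)
Definition todashift (g : {poly R} * int) J : jacobi R :=
  toda g.1 (jshift g.2 J).

End TodaFlow.

Section SLCocycle.
Variable R : realType.
Local Notation C := R[i].

Definition mx2 (a b c d : C) : 'M[C]_2 :=
  \matrix_(i < 2, j < 2)
    if i == 0 then (if j == 0 then a else b) else (if j == 0 then c else d).

Definition entire (f : C -> C) : Prop :=
  forall z : C, derivable (f : C^o -> C^o) z 1.

Definition SL (T : C -> 'M[C]_2) : Prop :=
  [/\ forall i j, entire (fun z => T z i j),
      forall z, \det (T z) = 1 &
      forall x : R, exists2 M : 'M[R]_2,
        \det M = 1 & T x%:C = map_mx (real_complex R) M].

Definition SL_cocycle (G : zmodType) (X : Type) (act : G -> X -> X)
    (T : G -> X -> C -> 'M[C]_2) : Prop :=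
  (forall g x, SL (T g x)) /\
  (forall g h x z, T (g + h) x z = T g (act h x) z *m T h x z).

Implicit Types (J : jacobi R) (p : {poly R}) (z : C).

Definition shift_mx J z : 'M[C]_2 :=
  mx2 ((z - (jb J 1)%:C) / (ja J 1)%:C) (ja J 1)%:C^-1
      (- (ja J 1)%:C)                   0.

Fixpoint T_shift_nat (n : nat) J z : 'M[C]_2 :=
  if n is m.+1 then shift_mx (jshift m J) z *m T_shift_nat m J z else 1%:M.

Definition T_shift (n : int) J z : 'M[C]_2 :=
  match n with
  | Posz m => T_shift_nat m J z
  | Negz m => invmx (T_shift_nat m.+1 (jshift (- m.+1%:Z) J) z)
  end.

(* In the next two definitions the exponent k - 1 - j is a truncated natural
   subtraction, but j <= k - 1 throughout. *)
Definition G_mon (k : nat) z J (n : int) : C :=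
  \sum_(0 <= j < k) z ^+ (k - 1 - j) * (jpow J j n n)%:C.

Definition H_mon (k : nat) z J (n : int) : C :=
  z ^+ k - (jpow J k n n)%:C
  + 2 * (ja J n)%:C * \sum_(1 <= j < k) z ^+ (k - 1 - j) * (jpow J j (n + 1) n)%:C.

Definition G_toda p z J (n : int) : C :=
  \sum_(k < size p) (p`_k)%:C * G_mon k z J n.

Definition H_toda p z J (n : int) : C :=
  \sum_(k < size p) (p`_k)%:C * H_mon k z J n.

Definition B_toda p z J : 'M[C]_2 :=
  let G := G_toda p z J in let H := H_toda p z J in
  let d := 2 * (z - (jb J 1)%:C) * G 1 - H 1 in
  mx2 d                                (2 * G 1)
      (- (2 * (ja J 0)%:C ^+ 2 * G 0)) (- d).

(* Derivative in the real variable t of a curve of complex matrices. *)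
Definition is_mx_derive (T : R -> 'M[C]_2) (t : R) (D : 'M[C]_2) : Prop :=
  forall i j,
    is_derive t 1 (fun s : R => complex.Re (T s i j)) (complex.Re (D i j)) /\
    is_derive t 1 (fun s : R => complex.Im (T s i j)) (complex.Im (D i j)).

Definition is_toda_cocycle_sol p J z (T : R -> 'M[C]_2) : Prop :=
  T 0 = 1%:M /\
  forall t : R, is_mx_derive T t (B_toda p z (toda (t *: p) J) *m T t).

(* As for toda_flow, the default value is irrelevant. *)
Definition toda_cocycle_sol p J z : R -> 'M[C]_2 :=
  if pselect (exists T, is_toda_cocycle_sol p J z T) is left ex
  then projT1 (cid ex) else fun=> 1%:M.

Definition T_toda p J z : 'M[C]_2 := toda_cocycle_sol p J z 1.

Definition T_todashift (g : {poly R} * int) J z : 'M[C]_2 :=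
  T_toda g.1 (jshift g.2 J) z *m T_shift g.2 J z.

End SLCocycle.

(* Main.v *)
Require Import Defs.
From mathcomp Require Import all_boot all_order all_algebra.
From mathcomp Require Import all_classical all_reals all_analysis.
From mathcomp Require Import complex.
From mathcomp Require Import zify ring lra.

(** The idea is that both cocycles describe the motion of formal eigensolutions of
    J u = z u. In the coordinates (u_1, -a_0 u_0) the shift matrix A(J) takes the
    data of u to the data of the shifted solution, and B_p is the action of the
    operator p(J)_a on eigensolutions: this is [field_true], [field_false] and,
    for the motion along a flow, [eigen_evolution], where the Lax equation shows
    that the eigensolution moves by u' = q(J)_a u as soon as its data move by B_q.

    The Toda flow itself is an ordinary differential equation for the pair (a, b)
    of bounded sequences. Its right-hand side is polynomial with finitely many
    terms in each component, hence Lipschitz on sup-norm balls, and it is solved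
    by Picard iteration after multiplication with a cut-off factor. The cut-off
    is never active, because the Lax form bounds the solution: the diagonal
    entries of J^(2k) grow at most by a factor exp(C|t|) with C independent of k,
    and 2k-th roots give a bound for all times ([toda_solution]). Uniqueness gives
    the compatibility of the flow with the shift and with rescaling of p. For a
    fixed J the Toda cocycle solves a linear equation whose matrix is traceless,
    real for real z and polynomial in z; this yields the three properties that
    define SL ([Tm_det], [Tm_real], [Tm_entire]).

    There remain three cocycle identities. For two shifts it is the definition
    ([T_shiftD]). For a shift and a Toda flow it says that shifted data of a moving
    eigensolution are data of a moving eigensolution ([T_shift_toda]). For two
    Toda flows it says that the flows of p and q on pairs (J, v) commute
    ([T_todaD]). Infinitesimally this is the zero curvature equation between
    p(J)_a and q(J)_a, a consequence of p(J) and q(J) commuting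
    ([zero_curvature]); applied to eigensolutions it becomes the zero curvature
    equation between B_p and B_q without any computation with the entries
    ([second_sym]). The passage from the infinitesimal statement to the flows is
    a Gronwall argument in sup norm ([commuting_diagonal]). *)

Set Implicit Arguments.
Unset Strict Implicit.
Unset Printing Implicit Defensive.

Import Order.TTheory GRing.Theory Num.Theory.
Import numFieldNormedType.Exports.

Local Open Scope classical_set_scope.
Local Open Scope complex_scope.
Local Open Scope ring_scope.

(** * Banded matrices indexed by the integers *)

Section Banded.
Variable K : comNzRingType.
Implicit Types (X Y Z : int -> int -> K) (N M : nat).

Definition banded N X := forall j k, (N < `|j - k|)%N -> X j k = 0.

Definition bmul X Y j k : K := \sum_(l \in [set: int]) (X j l * Y l k).

Definition comm X Y j k : K := bmul X Y j k - bmul Y X j k.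

Definition win N (j : int) : seq int :=
  [seq j - N%:Z + i%:Z | i <- iota 0 (2 * N).+1].

Lemma mem_win N j k : (k \in win N j) = (`|j - k| <= N)%N.
Proof.
apply/mapP/idP => [ [m] |jk]; first by rewrite mem_iota => ? ->; lia.
exists (absz (k - j + N%:Z)); last by lia.
by rewrite mem_iota; lia.
Qed.

Lemma win_uniq N j : uniq (win N j).
Proof. by rewrite map_inj_uniq ?iota_uniq// => x y; lia. Qed.

Lemma sum_win N j (F : int -> K) :
  \sum_(l <- win N j) F l = \sum_(i < (2 * N).+1) F (j - N%:Z + i%:Z).
Proof. by rewrite big_map -(big_mkord xpredT (fun i => F (j - N%:Z + i%:Z))) /index_iota subn0. Qed.

Lemma fsum_seq (s : seq int) (F : int -> K) : uniq s ->
  (forall l, l \notin s -> F l = 0) ->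
  \sum_(l \in [set: int]) F l = \sum_(l <- s) F l.
Proof.
move=> us Fs; rewrite (fsbigE s)//; last by move=> l _; exact: Fs.
by apply: eq_bigl => l; rewrite in_setT.
Qed.

Lemma bmul_seq X Y j k (s : seq int) : uniq s ->
  (forall l, l \notin s -> X j l * Y l k = 0) ->
  bmul X Y j k = \sum_(l <- s) X j l * Y l k.
Proof. exact: fsum_seq. Qed.

Lemma bmul_win N X Y j k : banded N X ->
  bmul X Y j k = \sum_(l <- win N j) X j l * Y l k.
Proof.
move=> bX; apply: bmul_seq (win_uniq _ _) _ => l.
by rewrite mem_win -ltnNge => /bX ->; rewrite mul0r.
Qed.

Lemma bmul_winr N X Y j k : banded N Y ->
  bmul X Y j k = \sum_(l <- win N k) X j l * Y l k.
Proof.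
move=> bY; apply: bmul_seq (win_uniq _ _) _ => l.
by rewrite mem_win -ltnNge distnC => /bY ->; rewrite mulr0.
Qed.

Lemma banded_le N M X : (N <= M)%N -> banded N X -> banded M X.
Proof. by move=> NM bX j k jk; apply: bX; exact: leq_ltn_trans jk. Qed.

Lemma banded_mul N M X Y : banded N X -> banded M Y -> banded (N + M) (bmul X Y).
Proof.
move=> bX bY j k jk; rewrite (bmul_win _ _ _ bX) big1_seq// => l /andP[_].
by rewrite mem_win => jl; rewrite bY ?mulr0//; lia.
Qed.

Lemma eq_bmul X X' Y Y' : X =2 X' -> Y =2 Y' -> bmul X Y =2 bmul X' Y'.
Proof. by move=> e1 e2 j k; apply: eq_fsbigr => l _; rewrite e1 e2. Qed.

(** The right factor is arbitrary: it is allowed to be a sequence, seen as a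
    matrix with constant rows, so that this also covers the action of matrices
    on sequences. *)
Lemma bmulA N M X Y Z : banded N X -> banded M Y ->
  bmul X (bmul Y Z) =2 bmul (bmul X Y) Z.
Proof.
move=> bX bY j k; rewrite (bmul_win _ _ _ bX).
rewrite (bmul_win _ _ _ (banded_mul bX bY)).
under [RHS]eq_bigr do rewrite (bmul_win _ _ _ bX) mulr_suml.
rewrite exchange_big/=; apply: eq_big_seq => l.
rewrite mem_win => jl; rewrite (@bmul_seq _ _ _ _ (win (N + M) j) (win_uniq _ _)).
  by rewrite mulr_sumr; apply: eq_bigr => i _; rewrite mulrA.
move=> i; rewrite mem_win => ji; rewrite bY ?mul0r//; lia.
Qed.

Lemma bmulDl N M X Y Z : banded N X -> banded M Y ->
  bmul (fun j k => X j k + Y j k) Z =2 (fun j k => bmul X Z j k + bmul Y Z j k).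
Proof.
move=> /(banded_le (leq_maxl N M)) bX /(banded_le (leq_maxr N M)) bY j k.
rewrite (bmul_win _ _ _ bX) (bmul_win _ _ _ bY).
rewrite (@bmul_win (maxn N M)); last by move=> ? ? ?; rewrite bX ?bY ?addr0.
by rewrite -big_split; apply: eq_bigr => i _; rewrite mulrDl.
Qed.

Lemma bmulDr N X Y Z : banded N X ->
  bmul X (fun j k => Y j k + Z j k) =2 (fun j k => bmul X Y j k + bmul X Z j k).
Proof.
move=> bX j k; rewrite !(bmul_win _ _ _ bX).
by rewrite -big_split; apply: eq_bigr => i _; rewrite mulrDr.
Qed.

Lemma bmulZl N c X Y : banded N X ->
  bmul (fun j k => c * X j k) Y =2 (fun j k => c * bmul X Y j k).
Proof.
move=> bX j k; rewrite (bmul_win _ _ _ bX) (@bmul_win N).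
  by rewrite mulr_sumr; apply: eq_bigr => i _; rewrite mulrA.
by move=> ? ? ?; rewrite bX ?mulr0.
Qed.

Lemma bmulZr N c X Y : banded N X ->
  bmul X (fun j k => c * Y j k) =2 (fun j k => c * bmul X Y j k).
Proof.
move=> bX j k; rewrite !(bmul_win _ _ _ bX) mulr_sumr.
by apply: eq_bigr => i _; rewrite mulrCA.
Qed.

Lemma bandedZ N c X : banded N X -> banded N (fun j k => c * X j k).
Proof. by move=> bX j k jk; rewrite bX// mulr0. Qed.

Definition sym X := forall j k, X j k = X k j.

Lemma bmul_tr X Y j k :
  bmul (fun j k => X k j) (fun j k => Y k j) j k = bmul Y X k j.
Proof. by apply: eq_fsbigr => l _ /=; rewrite mulrC. Qed.

(** The matrix X_a, over an arbitrary ring. *)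
Definition anti X j k : K :=
  if j < k then X j k else if k < j then - X j k else 0.

Lemma banded_anti N X : banded N X -> banded N (anti X).
Proof. by move=> bX j k /bX e; rewrite /anti e oppr0 !if_same. Qed.

Lemma anti_tr X : sym X -> forall j k, anti X k j = - anti X j k.
Proof.
move=> sX j k; rewrite /anti; case: (ltgtP j k) => jk; rewrite ?oppr0//.
  by rewrite sX.
by rewrite opprK sX.
Qed.

Lemma banded_comm N M X Y : banded N X -> banded M Y ->
  banded (N + M) (comm X Y).
Proof.
move=> bX bY j k jk; rewrite /comm (banded_mul bX bY)// (banded_mul bY bX)//.
  by rewrite subrr.
by rewrite addnC.
Qed.

End Banded.

(** * The algebra of the Lax equation *)

Section Lax.
Variable K : comNzRingType.
Implicit Types (X Y Z : int -> int -> K) (a b u : int -> K).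

(** Used with X' = X_a and Y' = Y_a, for which X - X' and Y - Y' are lower
    triangular. *)
Lemma bmul_polar N X Y X' Y' : banded N X -> banded N X' ->
  forall j k, bmul X' Y j k + bmul X Y' j k - bmul X' Y' j k =
    bmul X Y j k -
    bmul (fun j k => X j k - X' j k) (fun j k => Y j k - Y' j k) j k.
Proof.
move=> bX bX' j k; rewrite !(bmul_win _ _ _ bX') !(bmul_win _ _ _ bX).
rewrite (@bmul_win _ N (fun _ _ => _)); last first.
  by move=> ? ? ?; rewrite bX// bX'// subr0.
rewrite -!big_split -!sumrN -!big_split/=.
by apply: eq_bigr => l _; ring.
Qed.

Lemma anti_lower X j k : j < k -> X j k - anti X j k = 0.
Proof. by move=> jk; rewrite /anti jk subrr. Qed.

Lemma bmul_lower X Y j k :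
  (forall j k, j < k -> X j k = 0) -> (forall j k, j < k -> Y j k = 0) ->
  j < k -> bmul X Y j k = 0.
Proof.
move=> X0 Y0 jk; apply: fsbig1 => l _.
have [jl|lj] := ltP j l; first by rewrite X0 ?mul0r.
by rewrite Y0 ?mulr0//; apply: le_lt_trans jk.
Qed.

Lemma comm_antisym_sym N X Y j k : banded N Y ->
  (forall j k, X k j = - X j k) -> sym Y -> comm X Y k j = comm X Y j k.
Proof.
move=> bY aX sY; rewrite /comm.
have e i l : bmul X Y i l = - bmul Y X l i.
  rewrite (bmul_winr _ _ _ bY) (bmul_win _ _ _ bY) -sumrN.
  by apply: eq_bigr => m _; rewrite aX sY mulNr mulrC.
rewrite !e; ring.
Qed.

Lemma bmul_antisym X Y j k :
  (forall j k, X k j = - X j k) -> (forall j k, Y k j = - Y j k) ->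
  bmul X Y k j = bmul Y X j k.
Proof.
move=> aX aY; rewrite -bmul_tr; apply: eq_fsbigr => l _ /=.
by rewrite aX aY mulrNN.
Qed.

(** Above the diagonal X_a differs from X by a lower triangular matrix; since X
    and Y commute, the polarization identity leaves only a product of two lower
    triangular matrices, which vanishes there. Both sides are antisymmetric. This
    is the modified Yang-Baxter equation for the map taking X to X_a. *)
Lemma zero_curvature N X Y : banded N X -> banded N Y -> sym X -> sym Y ->
  (forall j k, bmul X Y j k = bmul Y X j k) -> forall j k,
  anti (comm (anti X) Y) j k - anti (comm (anti Y) X) j k =
  comm (anti X) (anti Y) j k.
Proof.
move=> bX bY sX sY XY.
have aX := anti_tr sX; have aY := anti_tr sY.
have up j k : j < k -> comm (anti X) Y j k - comm (anti Y) X j k =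
  comm (anti X) (anti Y) j k.
  move=> jk; rewrite /comm.
  have := bmul_polar Y (anti Y) bX (banded_anti bX) j k.
  have := bmul_polar X (anti X) bY (banded_anti bY) j k.
  rewrite (bmul_lower (@anti_lower X) (@anti_lower Y) jk).
  rewrite (bmul_lower (@anti_lower Y) (@anti_lower X) jk).
  rewrite -XY !subr0 => e2 e1.
  have := etrans e1 (esym e2) => /eqP; rewrite -subr_eq0 => /eqP e3.
  by apply/eqP; rewrite -subr_eq0 -e3; apply/eqP; ring.
move=> j k; rewrite [anti (comm (anti X) Y) j k]/anti [anti (comm (anti Y) X) j k]/anti.
 case: (ltgtP j k) => jk.
- exact: up.
- have := up _ _ jk.
  rewrite (comm_antisym_sym j k bY aX sY) (comm_antisym_sym j k bX aY sX).
  rewrite /comm (bmul_antisym j k aX aY) (bmul_antisym j k aY aX).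
  move=> h; rewrite opprK -[RHS]opprB -h; ring.
- by rewrite jk /comm (bmul_antisym _ _ aY aX) !subrr.
Qed.

Definition jop a b u n : K := a n * u (n + 1) + a (n - 1) * u (n - 1) + b n * u n.
Definition dlt (n m : int) : K := (m == n)%:R.
Definition tri a b j k : K := jop a b (dlt k) j.
Definition jacp a b (k : nat) m n : K := iter k (jop a b) (dlt n) m.

Lemma tri_diag a b n : tri a b n n = b n.
Proof.
rewrite /tri /jop /dlt eqxx.
have -> : (n + 1 == n) = false by lia.
have -> : (n - 1 == n) = false by lia.
by rewrite !mulr0 !add0r mulr1.
Qed.

Lemma tri_up a b n : tri a b n (n + 1) = a n.
Proof.
rewrite /tri /jop /dlt eqxx.
have -> : (n == n + 1) = false by lia.
have -> : (n - 1 == n + 1) = false by lia.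
by rewrite !mulr0 !addr0 mulr1.
Qed.

Lemma tri_dn a b n : tri a b n (n - 1) = a (n - 1).
Proof.
rewrite /tri /jop /dlt eqxx.
have -> : (n == n - 1) = false by lia.
have -> : (n + 1 == n - 1) = false by lia.
by rewrite !mulr0 !addr0 add0r mulr1.
Qed.

Lemma banded_tri a b : banded 1 (tri a b).
Proof.
move=> j k jk; rewrite /tri /jop /dlt.
have -> : (j == k) = false by lia.
have -> : (j + 1 == k) = false by lia.
have -> : (j - 1 == k) = false by lia.
by rewrite !mulr0 !addr0.
Qed.

Lemma dist_le1 (j k : int) : (`|j - k| <= 1)%N -> [\/ k = j - 1, k = j | k = j + 1].
Proof.
move=> jk; have [e|e] := eqVneq k j; first by constructor 2.
by have [|] := ltP k j => ?; [constructor 1|constructor 3]; lia.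
Qed.

Lemma tri_sym a b : sym (tri a b).
Proof.
move=> j k; have [jk|jk] := ltnP 1 `|j - k|.
  by rewrite !banded_tri// distnC.
have [->|->//|->] := dist_le1 jk.
  by rewrite tri_dn -{3}(subrK 1 j) tri_up.
by rewrite tri_up -{3}(addrK 1 j) tri_dn addrK.
Qed.

Lemma bmul_tril a b X j k : bmul (tri a b) X j k = jop a b (X^~ k) j.
Proof.
rewrite (@bmul_seq _ _ _ _ _ [:: j + 1; j - 1; j]).
- rewrite !big_cons big_nil tri_up tri_dn tri_diag /jop; ring.
- by rewrite /= !inE; lia.
- move=> l; rewrite !inE => jl; rewrite banded_tri ?mul0r//; lia.
Qed.

Lemma bmul_trir a b X j k : bmul X (tri a b) j k = jop a b (X j) k.
Proof.
rewrite -bmul_tr (eq_bmul (X' := tri a b) (Y' := fun m n => X n m))//.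
  exact: bmul_tril.
by move=> m n; rewrite tri_sym.
Qed.

(** The Lax equation preserves tridiagonal form: as X commutes with J, the
    commutator of X_a with J is above the diagonal that of a lower triangular
    matrix, hence it vanishes from the second superdiagonal on. *)
Lemma comm_anti_tri N X a b : banded N X -> sym X ->
    bmul X (tri a b) =2 bmul (tri a b) X ->
  comm (anti X) (tri a b) =2
  tri (fun n => a n * (X (n + 1) (n + 1) - X n n))
      (fun n => 2 * (a n * X (n + 1) n - a (n - 1) * X n (n - 1))).
Proof.
move=> bX sX XJ j k; have aX := anti_tr sX.
wlog jk : j k / j <= k => [hw|].
  have [|/ltW kj] := leP j k; first exact: hw.
  rewrite (comm_antisym_sym k j (@banded_tri a b) aX (tri_sym a b)) tri_sym; exact: hw.
have := XJ j k; rewrite /comm !bmul_tril !bmul_trir /jop => {}XJ.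
have [e|jk1] := eqVneq k j.
  rewrite e tri_diag /anti !ltxx.
  have -> : (j < j + 1) = true by lia.
  have -> : (j - 1 < j) = true by lia.
  have -> : (j < j - 1) = false by lia.
  have -> : (j + 1 < j) = false by lia.
  rewrite (sX j (j + 1)) (sX (j - 1) j); ring.
have {jk jk1} jk : j < k by lia.
have [e|jk1] := eqVneq k (j + 1).
  move: XJ; rewrite e tri_up !addrK /anti !ltxx.
  have -> : (j < j + 1) = true by lia.
  have -> : (j - 1 < j + 1) = true by lia.
  have -> : (j < j + 1 + 1) = true by lia.
  move=> /eqP; rewrite -subr_eq0 => /eqP XJ.
  by apply/eqP; rewrite -subr_eq0 -XJ; apply/eqP; ring.
rewrite (@banded_tri _ _ j k); last by lia.
rewrite /anti.
have -> : (j < k) = true by lia.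
have -> : (j < k - 1) = true by lia.
have -> : (j < k + 1) = true by lia.
have -> : (j + 1 < k) = true by lia.
have -> : (j - 1 < k) = true by lia.
by move: XJ => /eqP; rewrite -subr_eq0 => /eqP.
Qed.

Lemma jacpS a b k : jacp a b k.+1 =2 bmul (tri a b) (jacp a b k).
Proof. by move=> m n; rewrite bmul_tril. Qed.

Lemma bmul1r X N : banded N X -> bmul X (fun m n => dlt n m) =2 X.
Proof.
move=> bX m n; rewrite (@bmul_seq _ _ _ _ _ [:: n])//.
  by rewrite big_seq1 /dlt eqxx mulr1.
by move=> l; rewrite inE /dlt => /negbTE ->; rewrite mulr0.
Qed.

Lemma bmul1l X N : banded N X -> bmul (fun m n => dlt n m) X =2 X.
Proof.
move=> bX m n; rewrite (@bmul_seq _ _ _ _ _ [:: m])//.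
  by rewrite big_seq1 /dlt eqxx mul1r.
by move=> l; rewrite inE /dlt eq_sym => /negbTE ->; rewrite mul0r.
Qed.

Lemma banded_jacp a b k : banded k (jacp a b k).
Proof.
elim: k => [|k IH].
  by move=> m n mn; rewrite /jacp/= /dlt; case: eqP => // e; lia.
move=> m n mn; rewrite jacpS; exact: (banded_mul (@banded_tri a b) IH).
Qed.

Lemma jacp_comm a b k :
  bmul (jacp a b k) (tri a b) =2 bmul (tri a b) (jacp a b k).
Proof.
elim: k => [|k IH] m n.
  by rewrite (bmul1r (@banded_tri a b)) (bmul1l (@banded_tri a b)).
rewrite (eq_bmul (@jacpS a b k) (fun _ _ => erefl)).
rewrite -(bmulA _ (@banded_tri a b) (@banded_jacp a b k)).
rewrite (eq_bmul (fun _ _ => erefl) IH).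
by apply: eq_bmul => // i j; rewrite jacpS.
Qed.

Lemma jacp_sym a b k : sym (jacp a b k).
Proof.
elim: k => [|k IH] m n; first by rewrite /jacp/= /dlt eq_sym.
rewrite !jacpS -jacp_comm -bmul_tr; apply: eq_bmul => i j; last by rewrite IH.
by rewrite tri_sym.
Qed.

Lemma jacpD a b k l : bmul (jacp a b k) (jacp a b l) =2 jacp a b (k + l).
Proof.
elim: k => [|k IH] m n; first by rewrite (bmul1l (@banded_jacp a b l)).
rewrite (eq_bmul (@jacpS a b k) (fun _ _ => erefl)).
rewrite -(bmulA _ (@banded_tri a b) (@banded_jacp a b k)).
by rewrite (eq_bmul (fun _ _ => erefl) IH) -jacpS.
Qed.

Definition pmx (d : nat) (c : nat -> K) a b m n : K :=
  \sum_(k < d) c k * jacp a b k m n.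

Lemma pmxS d c a b :
  pmx d.+1 c a b =2 fun m n => pmx d c a b m n + c d * jacp a b d m n.
Proof. by move=> m n; rewrite /pmx big_ord_recr. Qed.

Lemma banded_pmx d c a b : banded d (pmx d c a b).
Proof.
move=> m n mn; apply: big1 => k _; rewrite banded_jacp ?mulr0//.
exact: ltn_trans (ltn_ord k) mn.
Qed.

Lemma pmx_sym d c a b : sym (pmx d c a b).
Proof. by move=> m n; apply: eq_bigr => k _; rewrite jacp_sym. Qed.

Lemma pmx_comm_gen N d c a b Y : banded N Y ->
  (forall k, bmul (jacp a b k) Y =2 bmul Y (jacp a b k)) ->
  bmul (pmx d c a b) Y =2 bmul Y (pmx d c a b).
Proof.
move=> bY JY; elim: d => [|d IH] m n.
  rewrite (@bmul_win _ 0) ?big1//; last first.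
  - by move=> *; rewrite /pmx big_ord0.
  - by move=> *; rewrite /pmx big_ord0 mul0r.
  by rewrite (bmul_win _ _ _ bY) big1// => *; rewrite /pmx big_ord0 mulr0.
rewrite (eq_bmul (@pmxS d c a b) (fun _ _ => erefl)).
rewrite (eq_bmul (fun _ _ => erefl) (@pmxS d c a b)).
have bd := @banded_jacp a b d.
rewrite (bmulDl _ (@banded_pmx d c a b) (bandedZ (c d) bd)) (bmulDr _ _ bY).
by rewrite IH (bmulZl _ _ bd) (bmulZr _ _ bY) JY.
Qed.

Lemma pmx_tri d c a b : bmul (pmx d c a b) (tri a b) =2 bmul (tri a b) (pmx d c a b).
Proof. exact: (pmx_comm_gen _ _ (@banded_tri a b) (@jacp_comm a b)). Qed.

Lemma pmx_comm d c d' c' a b :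
  bmul (pmx d c a b) (pmx d' c' a b) =2 bmul (pmx d' c' a b) (pmx d c a b).
Proof.
apply: (pmx_comm_gen _ _ (@banded_pmx d' c' a b)) => k m n; apply/esym.
apply: (pmx_comm_gen _ _ (@banded_jacp a b k)) => l i j.
by rewrite !jacpD addnC.
Qed.

Definition bvec X u j : K := bmul X (fun l _ => u l) j 0.

Lemma bvecA N M X Y u : banded N X -> banded M Y ->
  bvec X (bvec Y u) =1 bvec (bmul X Y) u.
Proof. by move=> bX bY j; exact: (bmulA (fun l _ => u l) bX bY j 0). Qed.

Lemma bvec_tri a b u : bvec (tri a b) u =1 jop a b u.
Proof. by move=> j; rewrite /bvec bmul_tril. Qed.

(** The G and H of the monomial x^k, over the ring generated by the data, so that
    the same identities serve real and complex coefficients. *)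
Definition gsum k (z : K) a b n : K :=
  \sum_(0 <= j < k) z ^+ (k - 1 - j) * jacp a b j n n.

Definition hsum k (z : K) a b n : K :=
  z ^+ k - jacp a b k n n
  + 2 * a n * \sum_(1 <= j < k) z ^+ (k - 1 - j) * jacp a b j (n + 1) n.

Lemma gsumS k z a b n : gsum k.+1 z a b n = z * gsum k z a b n + jacp a b k n n.
Proof.
rewrite /gsum big_nat_recr//= mulr_sumr subn1/= subnn expr0 mul1r; congr (_ + _).
rewrite !big_mkord; apply: eq_bigr => j _; rewrite mulrA -exprS.
by congr (_ ^+ _ * _); have := ltn_ord j; lia.
Qed.

Lemma jacp0_off a b n : jacp a b 0 (n + 1) n = 0.
Proof. by rewrite /jacp /= /dlt; have -> : (n + 1 == n) = false by lia. Qed.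

Lemma hsumE k z a b n : hsum k z a b n = z ^+ k - jacp a b k n n
  + 2 * a n * \sum_(0 <= j < k) z ^+ (k - 1 - j) * jacp a b j (n + 1) n.
Proof.
rewrite /hsum; congr (_ + _ * _); case: k => [|k]; first by rewrite !big_geq.
by rewrite [RHS]big_ltn// jacp0_off mulr0 add0r.
Qed.

Lemma hsumS k z a b n : hsum k.+1 z a b n =
  z * (hsum k z a b n + jacp a b k n n) - jacp a b k.+1 n n
  + 2 * a n * jacp a b k (n + 1) n.
Proof.
rewrite !hsumE big_nat_recr//= subn1/= subnn expr0 mul1r.
have -> : \sum_(0 <= j < k) z ^+ (k - j) * jacp a b j (n + 1) n =
    z * \sum_(0 <= j < k) z ^+ (k - 1 - j) * jacp a b j (n + 1) n.
  rewrite mulr_sumr !big_mkord; apply: eq_bigr => j _; rewrite mulrA -exprS.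
  by congr (_ ^+ _ * _); have := ltn_ord j; lia.
rewrite exprS; ring.
Qed.

Lemma gsum0 z a b n : gsum 0 z a b n = 0.
Proof. by rewrite /gsum big_geq. Qed.

Lemma hsum0 z a b n : hsum 0 z a b n = 0.
Proof.
by rewrite /hsum big_geq// /jacp/= /dlt eqxx expr0 subrr mulr0 addr0.
Qed.

Lemma gsum_hsum k z a b n : 2 * (z - b n) * gsum k z a b n =
  hsum k z a b n + hsum k z a b (n - 1) - jacp a b k n n
  + jacp a b k (n - 1) (n - 1).
Proof.
elim: k => [|k IH].
  by rewrite gsum0 !hsum0 /jacp /= /dlt !eqxx; ring.
rewrite gsumS !hsumS mulrDr mulrCA IH subrK.
rewrite [jacp a b k.+1 n n]jacpS bmul_tril /jop (jacp_sym a b k n (n - 1)).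
ring.
Qed.

(** By induction on k: multiplying by J on the right, which is multiplication by
    z on u, changes the antisymmetrized power only next to the diagonal, and the
    eigenvalue equation eliminates the value of u at n - 1. *)
Lemma bvec_anti_jacp k z a b u : (forall n, jop a b u n = z * u n) ->
  forall n, bvec (anti (jacp a b k)) u n =
    2 * a n * gsum k z a b n * u (n + 1) - hsum k z a b n * u n.
Proof.
move=> Ju; elim: k => [|k IH] n.
  rewrite gsum0 hsum0 mulr0 !mul0r subr0; apply: fsbig1 => l _.
  by rewrite /anti /jacp /= /dlt; case: ltgtP => //; rewrite ?oppr0 mul0r.
set X := jacp a b k.
have bX : banded k X := @banded_jacp a b k.
have bXa := banded_anti bX.
(* the difference of (X J)_a and X_a J is supported next to the diagonal *)
pose D m l := anti (jacp a b k.+1) m l - bmul (anti X) (tri a b) m l.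
have JE m l : jacp a b k.+1 m l = jop a b (X m) l.
  by rewrite jacpS -jacp_comm bmul_trir.
have D0 l : l \notin [:: n - 1; n; n + 1] -> D n l = 0.
  rewrite /D bmul_trir /anti !inE !JE /jop => nl.
  have [nl'|nl'] := ltP n l.
    have -> : (n < l + 1) = true by lia.
    have -> : (n < l - 1) = true by lia.
    by rewrite subrr.
  have -> : (n < l + 1) = false by lia.
  have -> : (n < l - 1) = false by lia.
  have -> : (l < n) = true by lia.
  have -> : (l + 1 < n) = true by lia.
  have -> : (l - 1 < n) = true by lia.
  ring.
have -> : bvec (anti (jacp a b k.+1)) u n = bvec D u n + z * bvec (anti X) u n.
  have -> : z * bvec (anti X) u n = bvec (bmul (anti X) (tri a b)) u n.
    rewrite -(bvecA _ bXa (@banded_tri a b)) /bvec.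
    rewrite -(bmulZr z (fun l _ => u l) bXa); apply: eq_bmul => // i j.
    by rewrite -Ju -(bvec_tri a b u).
  have bT := banded_mul bXa (@banded_tri a b); rewrite addn1 in bT.
  have bA := banded_anti (@banded_jacp a b k.+1).
  rewrite /bvec (bmul_win _ _ _ bA) (bmul_win _ _ _ bT) (@bmul_win _ k.+1).
    rewrite -big_split/=; apply: eq_bigr => l _; rewrite /D; ring.
  by move=> i j ij; rewrite /D bA// bT// subr0.
rewrite IH gsumS hsumS /bvec (@bmul_seq _ _ _ _ _ [:: n - 1; n; n + 1]).
- rewrite !big_cons big_nil addr0 /D !bmul_trir /anti !JE /jop.
  rewrite !addrK ?subrK !ltxx.
  have l1 : (n < n - 1) = false by lia.
  have l2 : (n - 1 < n) = true by lia.
  have l3 : (n < n + 1) = true by lia.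
  have l4 : (n + 1 < n) = false by lia.
  have l5 : (n < n - 1 - 1) = false by lia.
  have l6 : (n - 1 - 1 < n) = true by lia.
  have l7 : (n < n + 1 + 1) = true by lia.
  rewrite ?(l1, l2, l3, l4, l5, l6, l7).
  have := Ju n; rewrite /jop => /eqP; rewrite -subr_eq0 => /eqP e.
  have sX : sym X := @jacp_sym a b k.
  rewrite -/X (sX n (n + 1)) (sX n (n - 1)).
  have := congr1 (fun t => - X n n * t) e; rewrite mulr0 => {}e.
  apply/eqP; rewrite -subr_eq0; apply/eqP; rewrite -[RHS]e; ring.
- by rewrite /= !inE; lia.
- by move=> l /D0 ->; rewrite mul0r.
Qed.

End Lax.

(** * Differential inequalities for families of real curves *)

Section RealCurves.
Variable R : realType.
Implicit Types (f g : R -> R) (t d e : R).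

Lemma is_derive_small f t d :
  (forall e, 0 < e -> exists2 r, 0 < r & forall h, `|h| < r ->
     `|f (t + h) - f t - h * d| <= e * `|h|) ->
  is_derive t 1 f d.
Proof.
move=> H.
have lim : h^-1 *: ((f \o shift t) (h *: (1 : R)) - f t) @[h --> (0 : R)^'] --> d.
  apply/cvgrPdist_le => e e0; have [r r0 Hr] := H _ e0.
  exists r => // h /=; rewrite sub0r normrN => hr h0.
  have := Hr _ hr; rewrite /= /GRing.scale/= mulr1 [h + t]addrC => {}Hr.
  rewrite -[d](mulKf h0) -mulrBr normrM normfV ler_pdivrMl ?normr_gt0//.
  by rewrite distrC [leRHS]mulrC.
split; first by rewrite /derivable; apply: (cvgP d).
by rewrite /derive; apply: cvg_lim.
Qed.

Lemma is_derive_smallP f t d : is_derive t 1 f d ->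
  forall e, 0 < e -> exists2 r, 0 < r & forall h, `|h| < r ->
     `|f (t + h) - f t - h * d| <= e * `|h|.
Proof.
move=> [df dfe] e e0.
have : h^-1 *: ((f \o shift t) (h *: (1 : R)) - f t) @[h --> (0 : R)^'] --> d.
  by rewrite -dfe.
move/cvgrPdist_le => /(_ e e0)[r /= r0 Hr]; exists r => // h hr.
have [->|h0] := eqVneq h 0; first by rewrite addr0 subrr mul0r subrr normr0 mulr0.
have := Hr h; rewrite /ball /= sub0r normrN => /(_ hr h0).
rewrite /= /GRing.scale/= mulr1 [h + t]addrC => {}Hr.
rewrite -(@ler_pM2l _ `|h^-1|) ?normr_gt0 ?invr_eq0// -normrM mulrBr mulKf//.
by rewrite distrC (le_trans Hr)// mulrCA normfV mulVf ?mulr1// normr_eq0.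
Qed.

Lemma is_derive_quad f t d C r : 0 < r ->
  (forall h, `|h| <= r -> `|f (t + h) - f t - h * d| <= C * h ^+ 2) ->
  is_derive t 1 f d.
Proof.
move=> r0 H; apply: is_derive_small => e e0.
exists (Num.min r (e / (`|C| + 1))).
  by rewrite lt_min r0 divr_gt0// ltr_wpDl.
move=> h; rewrite lt_min => /andP[hr he].
rewrite (le_trans (H _ (ltW hr)))// -(real_normK (num_real h)) expr2 mulrA ler_wpM2r//.
apply: (@le_trans _ _ ((`|C| + 1) * `|h|)).
  by rewrite ler_wpM2r// (le_trans (ler_norm _))// lerDl.
by rewrite mulrC -ler_pdivlMr ?ltW// ltr_wpDl.
Qed.

Lemma drv_cst t (c : R) : is_derive t 1 (fun=> c) 0.
Proof. exact: is_derive_cst. Qed.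

Lemma drvD f g t d e : is_derive t 1 f d -> is_derive t 1 g e ->
  is_derive t 1 (fun s => f s + g s) (d + e).
Proof. exact: is_deriveD. Qed.

Lemma drvN f t d : is_derive t 1 f d -> is_derive t 1 (fun s => - f s) (- d).
Proof. exact: is_deriveN. Qed.

Lemma drvB f g t d e : is_derive t 1 f d -> is_derive t 1 g e ->
  is_derive t 1 (fun s => f s - g s) (d - e).
Proof. exact: is_deriveB. Qed.

Lemma drvM f g t d e : is_derive t 1 f d -> is_derive t 1 g e ->
  is_derive t 1 (fun s => f s * g s) (f t * e + g t * d).
Proof. exact: is_deriveM. Qed.

Lemma drvZ f t d (c : R) : is_derive t 1 f d ->
  is_derive t 1 (fun s => c * f s) (c * d).
Proof. exact: is_deriveZ. Qed.

Lemma drv_sum (I : Type) (r : seq I) (P : pred I) (F : I -> R -> R)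
    (D : I -> R) t :
  (forall i, is_derive t 1 (F i) (D i)) ->
  is_derive t 1 (fun s => \sum_(i <- r | P i) F i s) (\sum_(i <- r | P i) D i).
Proof.
move=> H; elim: r => [|i r IH].
  rewrite big_nil; apply: (@is_derive_eq _ _ _ _ _ _ 0) => //.
  rewrite (_ : (fun s => _) = fun=> 0); first exact: drv_cst.
  by apply/funext => s; rewrite big_nil.
rewrite big_cons (_ : (fun s => _) =
    (fun s => if P i then F i s + \sum_(j <- r | P j) F j s
              else \sum_(j <- r | P j) F j s)); last first.
  by apply/funext => s; rewrite big_cons.
by case: (P i) => //; exact: drvD.
Qed.

Lemma drv_comp f g t d e : is_derive (g t) 1 f d -> is_derive t 1 g e ->
  is_derive t 1 (fun s => f (g s)) (d * e).
Proof. exact: is_derive1_comp. Qed.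

Lemma drv_scale f t d (c : R) : is_derive (c * t) 1 f d ->
  is_derive t 1 (fun s => f (c * s)) (c * d).
Proof.
move=> df; rewrite mulrC; apply: (@drv_comp f (fun s => c * s)) => //.
by rewrite -[X in is_derive _ _ _ X]mulr1; apply: drvZ; exact: is_derive_id.
Qed.

Lemma drv_unique f t d e : is_derive t 1 f d -> is_derive t 1 f e -> d = e.
Proof. by move=> [_ <-] [_ <-]. Qed.

Lemma drv_near f g t d : (\forall s \near t, f s = g s) ->
  is_derive t 1 f d -> is_derive t 1 g d.
Proof.
move=> /nbhs_ballP[r r0 fg] df; apply: is_derive_small => e e0.
have [r' r'0 H] := is_derive_smallP df e0.
exists (Num.min r r'); first by rewrite lt_min r0.
move=> h; rewrite lt_min => /andP[hr hr'].
rewrite -fg; last by rewrite /ball/= opprD addNKr normrN.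
by rewrite -fg; [exact: H|exact: ballxx].
Qed.

Lemma drv_continuous f t d : is_derive t 1 f d -> {for t, continuous f}.
Proof.
by move=> [df _]; apply/differentiable_continuous; rewrite -derivable1_diffP.
Qed.

Lemma derivs_within f (f' : R -> R) (a b : R) :
  (forall x, a <= x <= b -> is_derive x 1 f (f' x)) ->
  {within `[a, b], continuous f}.
Proof.
move=> df; apply: derivable_within_continuous => x; rewrite in_itv/= => /df.
by case.
Qed.

Lemma mvt f (f' : R -> R) (a b : R) : a <= b ->
  (forall x, a <= x <= b -> is_derive x 1 f (f' x)) ->
  exists2 c, a <= c <= b & f b - f a = f' c * (b - a).
Proof.
move=> ab df; have [] := @MVT_segment _ f f' a b ab.
- by move=> x; rewrite in_itv/= => /andP[/ltW ax /ltW xb]; apply: df; rewrite ax.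
- exact: derivs_within df.
- by move=> c; rewrite in_itv/=; exists c.
Qed.

Lemma deriv_ge0_le f (f' : R -> R) (a b : R) : a <= b ->
  (forall x, a <= x <= b -> is_derive x 1 f (f' x)) ->
  (forall x, a <= x <= b -> 0 <= f' x) -> f a <= f b.
Proof.
move=> ab df f0; have [c cab e] := mvt ab df.
by rewrite -subr_ge0 e mulr_ge0 ?f0// subr_ge0.
Qed.

Lemma deriv_bound f (f' : R -> R) t (h M : R) :
  (forall s, `|s| <= `|h| -> is_derive (t + s) 1 f (f' (t + s))) ->
  (forall s, `|s| <= `|h| -> `|f' (t + s)| <= M) ->
  `|f (t + h) - f t| <= M * `|h|.
Proof.
move=> df bf.
have [h0|/ltW h0] := leP 0 h.
  have [|x|c cab ->] := @mvt f f' t (t + h); first by rewrite lerDl.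
    move=> /andP[tx xth]; rewrite -(subrK t x) addrC; apply: df.
    by rewrite !ger0_norm// ?subr_ge0// lerBlDl.
  rewrite [t + h]addrC addrK normrM ler_wpM2r// -(subrK t c) addrC; apply: bf.
  by move: cab => /andP[tc ch]; rewrite !ger0_norm// ?subr_ge0// lerBlDl.
have [|x|c cab] := @mvt f f' (t + h) t; first by rewrite gerDl.
  move=> /andP[tx xth]; rewrite -(subrK t x) addrC; apply: df.
  by rewrite !ler0_norm ?subr_le0//; lra.
rewrite distrC => ->; rewrite normrM opprD addNKr normrN ler_wpM2r//.
rewrite -(subrK t c) addrC; apply: bf.
by move: cab => /andP[tc ch]; rewrite !ler0_norm ?subr_le0//; lra.
Qed.

Lemma deriv_expR_lin t (L : R) :
  is_derive t 1 (fun s => expR (L * s)) (L * expR (L * t)).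
Proof. by apply: (@drv_scale expR); exact: is_derive_expR. Qed.

(** The weight exp(L|t|) is used in all estimates below instead of iterated
    integrals: it treats both time directions at once and gains a factor 1/2
    whenever a Lipschitz constant L is integrated against exp(2L|t|). *)
Lemma exp_comparison f (f' : R -> R) (A L T : R) :
  (forall t, `|t| <= T -> is_derive t 1 f (f' t)) ->
  (forall t, `|t| <= T -> `|f' t| <= A * (L * expR (L * `|t|))) ->
  forall t, `|t| <= T -> `|f t - f 0| <= A * (expR (L * `|t|) - 1).
Proof.
have pos (g g' : R -> R) (T' : R) :
    (forall t, 0 <= t <= T' -> is_derive t 1 g (g' t)) ->
    (forall t, 0 <= t <= T' -> `|g' t| <= A * (L * expR (L * t))) ->
    0 <= T' -> `|g T' - g 0| <= A * (expR (L * T') - 1).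
  move=> dg bg T0.
  have E t : is_derive t 1 (fun s => A * expR (L * s)) (A * (L * expR (L * t))).
    exact: drvZ (deriv_expR_lin _ _).
  rewrite ler_norml; apply/andP; split.
    have /= := @deriv_ge0_le (fun s => g s + A * expR (L * s)) _ 0 T' T0
      (fun t tT => drvD (dg t tT) (E t)).
    rewrite mulr0 expR0 => H; have {H}: g 0 + A * 1 <= g T' + A * expR (L * T').
      by apply: H => t /bg; rewrite ler_norml -lerBlDr sub0r => /andP[].
    lra.
  have /= := @deriv_ge0_le (fun s => A * expR (L * s) - g s) _ 0 T' T0
    (fun t tT => drvB (E t) (dg t tT)).
  rewrite mulr0 expR0 => H; have {H}: A * 1 - g 0 <= A * expR (L * T') - g T'.
    by apply: H => t /bg; rewrite ler_norml subr_ge0 => /andP[].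
  lra.
move=> df bf t tT; have [t0|/ltW t0] := leP 0 t.
  move: tT; rewrite ger0_norm// => tT; apply: (pos f f') => // s /andP[s0 st].
    by apply: df; rewrite ger0_norm// (le_trans st).
  by have := bf s; rewrite ger0_norm//; apply; rewrite (le_trans st).
move: tT; rewrite ler0_norm// => tT.
have := pos (fun s => f (- 1 * s)) (fun s => - 1 * f' (- 1 * s)) (- t).
rewrite mulN1r opprK mulr0; apply.
- move=> s /andP[s0 st]; apply: drv_scale; apply: df.
  by rewrite mulN1r normrN ger0_norm// (le_trans st).
- move=> s /andP[s0 st]; rewrite !mulN1r normrN.
  by have := bf (- s); rewrite [`|- s|]normrN (ger0_norm s0); apply; exact: le_trans tT.
- by rewrite oppr_ge0.
Qed.

Lemma geo_small (c e : R) : 0 < e -> exists k, c / 2 ^+ k <= e.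
Proof.
move=> e0; exists (Num.truncn (c / e)).+1; set k := (Num.truncn _).+1.
have : c / e < 2 ^+ k.
  rewrite (lt_le_trans (truncnS_gt _))// -natrX ler_nat ltnW//.
  exact: ltn_expl.
by rewrite ltr_pdivrMr// ler_pdivrMr ?exprn_gt0// mulrC => /ltW.
Qed.

Lemma le_geo (x y c : R) : (forall k, x <= y + c / 2 ^+ k) -> x <= y.
Proof.
move=> H; apply/ler_addgt0Pr => e /(geo_small c)[k ce].
by rewrite (le_trans (H k))// lerD2l.
Qed.

(** Each application of the differential inequality halves the current bound N in
    the weighted sup norm up to the additive constant; the a priori bound N0
    starts the iteration. The index set I is arbitrary, which makes this a
    Gronwall inequality in the space of bounded families. *)
Lemma gronwall (I : Type) (e e' : I -> R -> R) (L c T N0 : R) :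
  0 < L -> 0 <= c ->
  (forall i t, `|t| <= T -> is_derive t 1 (e i) (e' i t)) ->
  (forall i, `|e i 0| <= c) ->
  (forall t N, `|t| <= T -> (forall j, `|e j t| <= N) ->
     forall i, `|e' i t| <= L * (N + c)) ->
  (forall i t, `|t| <= T -> `|e i t| <= N0) ->
  forall i t, `|t| <= T -> `|e i t| <= 3 * c * expR (2 * L * `|t|).
Proof.
move=> L0 c0 de e0 be eN0.
have exp1 t : 1 <= expR (2 * L * `|t|).
  by rewrite -[leLHS]expR0 ler_expR !mulr_ge0// ltW.
have step N : 0 <= N ->
    (forall i t, `|t| <= T -> `|e i t| <= N * expR (2 * L * `|t|)) ->
    (forall i t, `|t| <= T -> `|e i t| <= (N / 2 + 3 / 2 * c) * expR (2 * L * `|t|)).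
  move=> N_ge0 eN i t tT.
  have := @exp_comparison (e i) (e' i) ((N + c) / 2) (2 * L) T (de i).
  move=> /(_ _ t tT) H.
  have {H} : `|e i t - e i 0| <= (N + c) / 2 * (expR (2 * L * `|t|) - 1).
    apply: H => s sT; rewrite (le_trans (be s _ sT (fun j => eN j s sT) i))//.
    rewrite [leRHS](_ : _ = L * (N * expR (2 * L * `|s|) + c * expR (2 * L * `|s|))).
      by rewrite ler_pM2l// lerD2l ler_peMr.
    by field.
  have := e0 i; have := exp1 t; have := ler_normD (e i t - e i 0) (e i 0).
  rewrite subrK; set E := expR _ => *.
  have : 0 <= (N + c) / 2 by rewrite divr_ge0// addr_ge0.
  nra.
pose N := Num.max N0 0.
have N_ge0 : 0 <= N by rewrite le_max lexx orbT.
have iter k : forall i t, `|t| <= T ->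
    `|e i t| <= (N / 2 ^+ k + 3 * c) * expR (2 * L * `|t|).
  elim: k => [|k IH] i t tT.
    rewrite expr0 divr1 (le_trans (eN0 i t tT))//.
    have N0N : N0 <= N by rewrite le_max lexx.
    have := exp1 t; set E := expR _ => *.
    by rewrite (le_trans N0N)//; nra.
  have N'0 : 0 <= N / 2 ^+ k + 3 * c by rewrite addr_ge0 ?divr_ge0 ?exprn_ge0 ?mulr_ge0.
  rewrite (le_trans (step _ N'0 IH i t tT))// ler_wpM2r ?expR_ge0//.
  rewrite exprS invfM; set u := (2 ^+ k)^-1; lra.
move=> i t tT; set E := expR _.
apply: (@le_geo _ _ (N * E)) => k.
apply: (le_trans (iter k i t tT)); rewrite -/E mulrDl addrC lerD2l.
by rewrite mulrAC.
Qed.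

Lemma local_primitive (f : R -> R) (n : R) : 0 < n -> continuous f ->
  exists F : R -> R, F 0 = 0 /\ forall t, `|t| < n -> is_derive t 1 F (f t).
Proof.
move=> n0 cf.
pose G t := (\int[lebesgue_measure]_(s in [set` `[- n, t]]) f s)%R.
exists (fun t => G t - G 0); split; first by rewrite subrr.
move=> t; rewrite ltr_norml => /andP[nt tn].
have [|||dG Ge] := @continuous_FTC1_closed R f (- n) t n tn.
- apply: continuous_compact_integrable; first exact: segment_compact.
  exact: continuous_subspaceT.
- exact: nt.
- exact: cf.
rewrite -[f t]subr0; apply: (@drvB G (fun=> G 0)).
by split; [exact: dG|rewrite -derive1E; exact: Ge].
Qed.

(** The fundamental theorem of calculus gives an antiderivative on each interval
    (-n, n); those that vanish at 0 agree on overlaps. *)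
Lemma primitive (f : R -> R) : continuous f ->
  exists F : R -> R, F 0 = 0 /\ forall t, is_derive t 1 F (f t).
Proof.
move=> cf.
have /choice[F HF] : forall n : nat, exists F : R -> R,
    F 0 = 0 /\ forall t, `|t| < n.+1%:R -> is_derive t 1 F (f t).
  by move=> n; exact: local_primitive.
pose b (t : R) := Num.truncn `|t|.
have tb t : `|t| < (b t).+1%:R by exact: truncnS_gt.
have agree n m t : `|t| < n.+1%:R -> `|t| < m.+1%:R -> F n t = F m t.
  move=> tn tm; have [Fn dn] := HF n; have [Fm dm] := HF m.
  have := @deriv_bound (fun s => F n s - F m s) (fun=> 0) 0 t 0.
  rewrite mul0r add0r Fn Fm !subr0 => H; apply/eqP.
  rewrite -subr_eq0 -normr_le0; apply: H => [s st|s _]; last by rewrite normr0.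
  rewrite add0r -(subrr (f s)); apply: drvB; [apply: dn|apply: dm];
    exact: le_lt_trans st _.
exists (fun t => F (b t) t); split; first exact: (HF _).1.
move=> t; apply: (@drv_near (F (b t).+1)); last first.
  by apply: (HF _).2; rewrite (lt_trans (tb t))// ltr_nat.
exists 1 => //= s; rewrite /ball/= distrC => ts; apply: agree => //.
rewrite -(subrK t s) (le_lt_trans (ler_normD _ _))// -natr1 addrC.
by rewrite ltrD// (tb t).
Qed.

End RealCurves.

(** * The Picard theorem for families of real functions *)

Section Picard.
Variable R : realType.

Lemma le_of_eq (x y : R) : x = y -> x <= y. Proof. by move->. Qed.

(** The limit is the supremum of the lower bounds u k - c / 2^k. *)
Lemma geo_limit (u : nat -> R) (c : R) : 0 <= c ->
  (forall k n, `|u (k + n)%N - u k| <= c / 2 ^+ k) ->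
  exists l, forall k, `|l - u k| <= c / 2 ^+ k.
Proof.
move=> c0 H; pose E := [set u k - c / 2 ^+ k | k in [set: nat]].
have geo0 k : 0 <= c / 2 ^+ k by rewrite divr_ge0// exprn_ge0.
have ubE m : ubound E (u m + c / 2 ^+ m).
  move=> _ [k _ <-]; have [km|/ltnW mk] := leqP k m.
    have := H k (m - k)%N; rewrite subnKC// => /ler_normlP[h _].
    have := geo0 m; lra.
  have := H m (k - m)%N; rewrite subnKC// => /ler_normlP[_ h].
  have := geo0 k; lra.
exists (sup E) => k; rewrite ler_norml; apply/andP; split.
  rewrite -lerBlDr opprK addrC; apply: ub_le_sup; last by exists k.
  by exists (u 0 + c / 2 ^+ 0)%R; exact: ubE.
rewrite lerBlDr addrC; apply: ge_sup; last exact: ubE.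
by exists (u 0 - c / 2 ^+ 0)%R; exists 0%N.
Qed.

(** Antiderivatives are chosen once and for all, so that the Picard map is a
    function. *)
Definition prim (f : R -> R) : R -> R :=
  if pselect (continuous f) is left cf then projT1 (cid (primitive cf)) else f.

Lemma primP (f : R -> R) : continuous f ->
  prim f 0 = 0 /\ forall t : R, is_derive t 1 (prim f) (f t).
Proof. by rewrite /prim; case: pselect => // cf _; case: (cid _). Qed.

Variables (I : Type) (f : R -> (I -> R) -> I -> R) (x0 : I -> R) (L C : R).

Definition ucont (x : R -> I -> R) := forall t e, 0 < e ->
  exists2 r, 0 < r & forall s, `|s - t| < r -> forall j, `|x s j - x t j| <= e.

Lemma ucont_deriv (x x' : R -> I -> R) :
  (forall (t : R) i, is_derive t 1 (x^~ i) (x' t i)) ->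
  (forall T, exists K, forall t i, `|t| <= T -> `|x' t i| <= K) ->
  ucont x.
Proof.
move=> dx bx t e e0; have [K HK] := bx (`|t| + 1).
exists (Num.min 1 (e / (`|K| + 1))).
  by rewrite lt_min ltr01 divr_gt0// ltr_wpDl.
move=> s; rewrite lt_min => /andP[/ltW s1 se] j.
have := @deriv_bound _ (x^~ j) (x'^~ j) t (s - t) K.
rewrite /= [t + (s - t)]addrC subrK => H.
apply: (@le_trans _ _ (K * `|s - t|)).
  apply: H => h hs.
  by apply: HK; rewrite (le_trans (ler_normD _ _))// lerD2l (le_trans hs).
apply: (@le_trans _ _ ((`|K| + 1) * `|s - t|)).
  by rewrite ler_wpM2r// (le_trans (ler_norm _))// lerDl.
by rewrite mulrC -ler_pdivlMr ?ltW// ltr_wpDl.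
Qed.

Hypothesis L0 : 0 < L.
Hypothesis lip : forall t x y (d : R) i, (forall j, `|x j - y j| <= d) ->
  `|f t x i - f t y i| <= L * d.
Hypothesis fC : forall t i, `|f t x0 i| <= C.
Hypothesis fcont : forall x, ucont x -> forall i, continuous (fun t : R => f t (x t) i).

Let pic (x : R -> I -> R) t i := x0 i + prim (fun s => f s (x s) i) t.
Let X k := iter k pic (fun=> x0).
Let B : R := `|C| / L.
Let W (t : R) := expR (2 * L * `|t|).

Let W1 t : 1 <= W t.
Proof. by rewrite -[leLHS]expR0 ler_expR !mulr_ge0// ltW. Qed.

Let W0 t : 0 <= W t. Proof. exact: expR_ge0. Qed.

Let B0 : 0 <= B. Proof. by rewrite divr_ge0// ltW. Qed.

Let BW t : 0 <= 2 * B * W t.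
Proof. by rewrite mulr_ge0 ?W0// mulr_ge0 ?B0. Qed.

Let picP x : ucont x -> (forall i, pic x 0 i = x0 i) /\
  forall (t : R) i, is_derive t 1 ((pic x)^~ i) (f t (x t) i).
Proof.
move=> cx; split => [i|t i]; rewrite /pic.
  by rewrite (primP (@fcont _ cx i)).1 addr0.
rewrite -[f t (x t) i]add0r; have dp := (primP (@fcont _ cx i)).2 t.
exact: (drvD (drv_cst t (x0 i)) dp).
Qed.

Let f_bound x t i : (forall j, `|x t j - x0 j| <= B * W t) ->
  `|f t (x t) i| <= 2 * L * B * W t.
Proof.
move=> H; rewrite -(subrK (f t x0 i) (f t (x t) i)).
rewrite (le_trans (ler_normD _ _))// (_ : _ * W t = L * (B * W t) + L * B * W t).
  rewrite lerD//; first exact: lip.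
  rewrite /B [L * _]mulrC divfK ?gt_eqF// (le_trans (fC t i))//.
  by rewrite (le_trans (ler_norm _))// ler_peMr.
by ring.
Qed.

Let f_bound_loc x : (forall t j, `|x t j - x0 j| <= B * W t) ->
  forall T, exists K, forall t i, `|t| <= T -> `|f t (x t) i| <= K.
Proof.
move=> H T; exists (2 * L * B * W T) => t i tT.
rewrite (le_trans (f_bound _ (H t)))// ler_wpM2l//.
  by rewrite !mulr_ge0 ?invr_ge0 ?(ltW L0).
by rewrite /W ler_expR ler_pM2l ?mulr_gt0// (le_trans tT) ?ler_norm.
Qed.

Let pic_close x y t i c : ucont x -> ucont y ->
  (forall t j, `|x t j - y t j| <= c * W t) ->
  `|pic x t i - pic y t i| <= c / 2 * W t.
Proof.
move=> cx cy xy; have [x00 dx] := picP cx; have [y00 dy] := picP cy.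
have c0 : 0 <= c.
  by have := xy 0 i; rewrite /W normr0 mulr0 expR0 mulr1; exact: le_trans.
have := @exp_comparison _ (fun t => pic x t i - pic y t i)
  (fun t => f t (x t) i - f t (y t) i) (c / 2) (2 * L) `|t|
  (fun t _ => drvB (dx t i) (dy t i)) _ t (lexx _).
rewrite x00 y00 subrr subr0 => H.
apply: (@le_trans _ _ (c / 2 * (W t - 1))).
  apply: H => s _; rewrite (le_trans (@lip _ _ _ _ i (xy s)))// -/(W s).
  rewrite [leLHS](_ : _ = c / 2 * (2 * L * W s))//; by field.
by rewrite ler_wpM2l ?divr_ge0// gerBl.
Qed.

Let X_inv k : ucont (X k) /\ forall t i, `|X k t i - x0 i| <= B * W t.
Proof.
elim: k => [|k [cX bX]].
  split=> [t e e0|t i]; first by exists 1 => // s _ j; rewrite subrr normr0 ltW.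
  by rewrite subrr normr0 mulr_ge0 ?W0.
have [X0 dX] := picP cX.
split; first exact: ucont_deriv dX (f_bound_loc bX).
move=> t i; have := @exp_comparison _ ((X k.+1)^~ i) (fun t => f t (X k t) i) B (2 * L) `|t|
  (fun t _ => dX t i) _ t (lexx _).
rewrite /= X0 => H.
apply: (@le_trans _ _ (B * (W t - 1))).
  apply: H => s _; rewrite (le_trans (f_bound _ (bX s)))// -/(W s).
  rewrite [leLHS](_ : _ = B * (2 * L * W s))//; by ring.
by rewrite ler_wpM2l// gerBl.
Qed.

Let X_step k t i : `|X k.+1 t i - X k t i| <= B / 2 ^+ k * W t.
Proof.
elim: k t i => [|k IH] t i; first by rewrite expr0 divr1; exact: (X_inv 1).2.
rewrite exprSr invfM mulrA.
exact: (@pic_close _ _ t i _ (X_inv k.+1).1 (X_inv k).1 IH).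
Qed.

Let X_cauchy k n t i : `|X (k + n) t i - X k t i| <= (2 * B * W t) / 2 ^+ k.
Proof.
suff : `|X (k + n) t i - X k t i| <= (2 * B * W t) / 2 ^+ k * (1 - (2 ^+ n)^-1).
  by move/le_trans; apply; rewrite ler_piMr ?divr_ge0 ?exprn_ge0 ?BW ?gerBl ?invr_ge0 ?exprn_ge0.
elim: n => [|n IH]; first by rewrite addn0 !subrr normr0 expr0 invr1 subrr mulr0.
rewrite addnS -(subrK (X (k + n) t i) (X _.+1 t i)) -addrA.
rewrite (le_trans (ler_normD _ _))// (le_trans (lerD (X_step _ t i) IH))//.
rewrite exprD exprS !invfM; set u := (2 ^+ k)^-1; set v := (2 ^+ n)^-1.
by apply: le_of_eq; field.
Qed.

(** The Picard map contracts by the factor 1/2 in the sup norm weighted by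
    exp(2L|t|). The hypotheses are global in time and in the state, and so is the
    solution. *)
Lemma picard : exists x : R -> I -> R,
  [/\ x 0 = x0, forall (t : R) i, is_derive t 1 (x^~ i) (f t (x t) i) &
   forall T, exists K, forall t i, `|t| <= T -> `|x t i - x0 i| <= K].
Proof.
have /choice[x xP] : forall t, exists x : I -> R, forall i k,
    `|x i - X k t i| <= 2 * B * W t / 2 ^+ k.
  move=> t; have /choice[x xP] : forall i, exists l, forall k,
      `|l - X k t i| <= 2 * B * W t / 2 ^+ k.
    by move=> i; apply: geo_limit => // k n; exact: X_cauchy.
  by exists x.
have bx t i : `|x t i - x0 i| <= B * W t.
  apply: (@le_geo _ _ _ (2 * B * W t)) => k.
  rewrite -(subrK (X k t i) (x t i)) -addrA (le_trans (ler_normD _ _))// [leRHS]addrC.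
  by rewrite lerD//; exact: (X_inv k).2.
have cx : ucont x.
  move=> t e e0; have e3 : 0 < e / 3 by rewrite divr_gt0.
  have [k Hk] := geo_small (2 * B * W (`|t| + 1)) e3.
  have [r r0 Hr] := (X_inv k).1 t _ e3.
  have xX s j : `|s - t| < 1 -> `|x s j - X k s j| <= e / 3.
    move=> st; rewrite (le_trans (xP s j k))// (le_trans _ Hk)//.
    rewrite ler_wpM2r ?invr_ge0 ?exprn_ge0// ler_wpM2l ?(mulr_ge0 _ B0)// /W ler_expR.
    rewrite ler_pM2l ?mulr_gt0// [leRHS]ger0_norm ?addr_ge0//.
    rewrite -(subrK t s) (le_trans (ler_normD _ _))// addrC lerD2l; exact: ltW.
  exists (Num.min 1 r); first by rewrite lt_min ltr01.
  move=> s; rewrite lt_min => /andP[s1 sr] j.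
  have /xX : `|t - t| < 1 by rewrite subrr normr0.
  move=> /(_ j) h1; have h2 := xX s j s1; have h3 := Hr s sr j.
  rewrite (_ : _ - _ = (x s j - X k s j) + (X k s j - X k t j) - (x t j - X k t j)).
    rewrite (le_trans (ler_normB _ _))// (le_trans (lerD (ler_normD _ _) (lexx _)))//.
    lra.
  by ring.
have [p0 dp] := picP cx.
have xE : x = pic x.
  apply/funext => t; apply/funext => i; apply/eqP.
  rewrite -subr_eq0 -normr_le0; apply: (@le_geo _ _ _ (2 * B * W t)) => k.
  rewrite -(subrK (X k.+1 t i) (x t i)) -addrA add0r.
  rewrite (le_trans (ler_normD _ _))//.
  have h1 := xP t i k.+1.
  have h2 : `|X k.+1 t i - pic x t i| <= 2 * B / 2 ^+ k / 2 * W t.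
    apply: pic_close => //; first exact: (X_inv k).1.
    by move=> s j; rewrite distrC mulrAC; exact: xP.
  rewrite (le_trans (lerD h1 h2))// exprS invfM; set u := (2 ^+ k)^-1.
  by apply: le_of_eq; field.
exists x; split.
- by apply/funext => i; rewrite [in LHS]xE p0.
- by move=> t i; rewrite {1}xE.
- move=> T; exists (B * W T) => t i tT; rewrite (le_trans (bx t i))// ler_wpM2l//.
  by rewrite /W ler_expR ler_pM2l ?mulr_gt0// (le_trans tT) ?ler_norm.
Qed.

End Picard.

(** * Lipschitz functionals and commuting flows *)

Section Lipschitz.
Variables (R : realType) (I : Type).
Local Notation E := (I -> R).
Implicit Types (x : E) (A B : Type).

Definition bounded_by (M : R) x := forall i, `|x i| <= M.
Definition near_by (d : R) (x y : E) := forall i, `|x i - y i| <= d.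

(** The constants are uniform over the index: entries of an infinite matrix form
    one family. *)
Definition lipf A (F : A -> E -> R) := forall M : R, exists2 C : R, 0 <= C &
  forall al x y d, bounded_by M x -> bounded_by M y -> 0 <= d -> near_by d x y ->
    `|F al x| <= C /\ `|F al x - F al y| <= C * d.

Lemma lip_reindex A B (g : B -> A) (F : A -> E -> R) :
  lipf F -> lipf (fun b => F (g b)).
Proof. by move=> H M; have [C C0 HC] := H M; exists C => // b; exact: HC. Qed.

Lemma lip_cst A (c : R) : lipf (fun (_ : A) (_ : E) => c).
Proof.
move=> M; exists `|c| => // _ x y d _ _ d0 _; rewrite lexx subrr normr0; split=> //.
exact: mulr_ge0.
Qed.

Lemma lip_coord A (g : A -> I) : lipf (fun al x => x (g al)).
Proof.
move=> M; exists (`|M| + 1); first by rewrite addr_ge0.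
move=> al x y d bx _ d0 xy; split.
  by rewrite (le_trans (bx _))// (le_trans (ler_norm _))// lerDl.
by rewrite (le_trans (xy _))// ler_peMl// lerDr.
Qed.

Lemma lipD A (F G : A -> E -> R) : lipf F -> lipf G ->
  lipf (fun al x => F al x + G al x).
Proof.
move=> HF HG M; have [C C0 HC] := HF M; have [D D0 HD] := HG M.
exists (C + D); first by rewrite addr_ge0.
move=> al x y d bx by_ d0 xy.
have [h1 h2] := HC al x y d bx by_ d0 xy; have [h3 h4] := HD al x y d bx by_ d0 xy.
split; first by rewrite (le_trans (ler_normD _ _))// lerD.
rewrite (_ : _ - _ = (F al x - F al y) + (G al x - G al y)); last by ring.
by rewrite (le_trans (ler_normD _ _))// mulrDl lerD.
Qed.

Lemma lipM A (F G : A -> E -> R) : lipf F -> lipf G ->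
  lipf (fun al x => F al x * G al x).
Proof.
move=> HF HG M; have [C C0 HC] := HF M; have [D D0 HD] := HG M.
exists (2 * C * D); first by rewrite !mulr_ge0.
move=> al x y d bx by_ d0 xy.
have [h1 h2] := HC al x y d bx by_ d0 xy; have [h3 h4] := HD al x y d bx by_ d0 xy.
have [h5 _] : `|F al y| <= C /\ _ := HC al y y 0 by_ by_ (lexx _) (fun i => ltac:(by rewrite subrr normr0)).
split.
  rewrite normrM (le_trans (ler_pM _ _ h1 h3))// -mulrA ler_peMl ?mulr_ge0//.
  lra.
rewrite (_ : _ - _ = (F al x - F al y) * G al x + F al y * (G al x - G al y)); last by ring.
rewrite (le_trans (ler_normD _ _))// !normrM.
rewrite (_ : 2 * C * D * d = C * d * D + C * (D * d)); last by ring.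
by rewrite lerD// ler_pM.
Qed.

Lemma lipN A (F : A -> E -> R) : lipf F -> lipf (fun al x => - F al x).
Proof.
move=> HF M; have [C C0 HC] := HF M; exists C => // al x y d bx by_ d0 xy.
by rewrite normrN -opprD normrN; exact: HC.
Qed.

Lemma lip_if A (b : A -> bool) (F G : A -> E -> R) : lipf F -> lipf G ->
  lipf (fun al x => if b al then F al x else G al x).
Proof.
move=> HF HG M; have [C C0 HC] := HF M; have [D D0 HD] := HG M.
exists (C + D); first by rewrite addr_ge0.
move=> al x y d bx by_ d0 xy.
have [h1 h2] := HC al x y d bx by_ d0 xy; have [h3 h4] := HD al x y d bx by_ d0 xy.
case: (b al); split; rewrite ?mulrDl.
- by rewrite (le_trans h1)// lerDl.
- by rewrite (le_trans h2)// lerDl mulr_ge0.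
- by rewrite (le_trans h3)// lerDr.
- by rewrite (le_trans h4)// lerDr mulr_ge0.
Qed.

(** Functionals that are Lipschitz on balls and whose derivative along every
    curve of a class is given by a functional of the same kind: this is all the
    differential calculus in sup norm that the proof needs, and it is closed
    under sums and products, so that every polynomial in the coefficients
    qualifies without its derivative having to be written down. *)
Definition diff_along (Sol : (R -> E) -> Prop) A (F : A -> E -> R) := lipf F /\
  exists2 D : A -> E -> R, lipf D &
    forall y, Sol y -> forall (t : R) al,
      is_derive t 1 (fun s => F al (y s)) (D al (y t)).

Variable Sol : (R -> E) -> Prop.
Local Notation calc := (diff_along Sol).

Lemma calc_cst A (c : R) : calc (fun (_ : A) (_ : E) => c).
Proof.
split; first exact: lip_cst.
by exists (fun _ _ => 0); [exact: lip_cst|move=> y _ t al; exact: drv_cst].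
Qed.

Lemma calc_reindex A B (g : B -> A) (F : A -> E -> R) :
  calc F -> calc (fun b => F (g b)).
Proof.
move=> [LF [D LD HD]]; split; first exact: lip_reindex.
by exists (fun b => D (g b)); [exact: lip_reindex|move=> y Sy t b; exact: HD].
Qed.

Lemma calcD A (F G : A -> E -> R) : calc F -> calc G ->
  calc (fun al x => F al x + G al x).
Proof.
move=> [LF [D LD HD]] [LG [D' LD' HD']]; split; first exact: lipD.
exists (fun al x => D al x + D' al x); first exact: lipD.
by move=> y Sy t al; apply: drvD; [exact: HD|exact: HD'].
Qed.

Lemma calcN A (F : A -> E -> R) : calc F -> calc (fun al x => - F al x).
Proof.
move=> [LF [D LD HD]]; split; first exact: lipN.
exists (fun al x => - D al x); first exact: lipN.
by move=> y Sy t al; apply: drvN; exact: HD.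
Qed.

Lemma calcB A (F G : A -> E -> R) : calc F -> calc G ->
  calc (fun al x => F al x - G al x).
Proof. by move=> CF CG; apply: calcD => //; exact: calcN. Qed.

Lemma calcM A (F G : A -> E -> R) : calc F -> calc G ->
  calc (fun al x => F al x * G al x).
Proof.
move=> [LF [D LD HD]] [LG [D' LD' HD']]; split; first exact: lipM.
exists (fun al x => F al x * D' al x + G al x * D al x).
  by apply: lipD; exact: lipM.
by move=> y Sy t al; apply: drvM; [exact: HD|exact: HD'].
Qed.

Lemma calc_sum A n (F : 'I_n -> A -> E -> R) : (forall k, calc (F k)) ->
  calc (fun al x => \sum_(k < n) F k al x).
Proof.
elim: n F => [|n IH] F HF.
  rewrite (_ : (fun _ _ => _) = fun _ _ => 0); first exact: calc_cst.
  by apply/funext => al; apply/funext => x; rewrite big_ord0.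
rewrite (_ : (fun _ _ => _) = fun al x =>
    \sum_(k < n) F (widen_ord (leqnSn n) k) al x + F ord_max al x).
  by apply: calcD => //; exact: IH.
by apply/funext => al; apply/funext => x; rewrite big_ord_recr.
Qed.

Lemma calc_if A (b : A -> bool) (F G : A -> E -> R) : calc F -> calc G ->
  calc (fun al x => if b al then F al x else G al x).
Proof.
move=> [LF [D LD HD]] [LG [D' LD' HD']]; split; first exact: lip_if.
exists (fun al x => if b al then D al x else D' al x); first exact: lip_if.
by move=> y Sy t al; case: (b al); [exact: HD|exact: HD'].
Qed.

End Lipschitz.

Section Flows.
Variables (R : realType) (I : Type).
Local Notation E := (I -> R).

Lemma taylor (f g : R -> R) (t h K : R) :
  (forall s : R, `|s| <= `|h| -> is_derive (t + s) 1 f (g (t + s))) ->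
  (forall s, `|s| <= `|h| -> `|g (t + s) - g t| <= K * `|s|) -> 0 <= K ->
  `|f (t + h) - f t - h * g t| <= K * h ^+ 2.
Proof.
move=> df dg K0.
have := @deriv_bound R (fun s => f s - s * g t) (fun s => g s - g t) t h (K * `|h|).
rewrite (_ : _ - _ - _ = f (t + h) - f t - h * g t); last by ring.
rewrite -mulrA -expr2 real_normK ?num_real//; apply => [s hs|s hs].
  have dl : is_derive (t + s) 1 (fun u => g t * u) (g t * 1).
    by apply: drvZ; exact: is_derive_id.
  rewrite mulr1 in dl; rewrite (_ : (fun u => f u - u * g t) =
    (fun u => f u - g t * u)); last by apply/funext => u; rewrite [u * _]mulrC.
  exact: drvB (df s hs) dl.
by rewrite (le_trans (dg _ hs))// ler_wpM2l.
Qed.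

Definition vfield_lip (X : E -> E) := lipf (fun i x => X x i).

Definition is_sol (X : E -> E) (y : R -> E) :=
  forall (t : R) i, is_derive t 1 (y^~ i) (X (y t) i).

Lemma sol_unique (X : E -> E) (x y : R -> E) : vfield_lip X ->
  is_sol X x -> is_sol X y -> x 0 = y 0 ->
  (forall T, exists M, forall t, `|t| <= T -> bounded_by M (x t) /\ bounded_by M (y t)) ->
  x = y.
Proof.
move=> LX sx sy xy0 bxy; apply/funext => t; apply/funext => i.
have [M HM] := bxy `|t|; have [C C0 HC] := LX M.
have de j (s : R) : `|s| <= `|t| ->
    is_derive s 1 (fun s => x s j - y s j) (X (x s) j - X (y s) j).
  by move=> _; exact: drvB (sx s j) (sy s j).
have e0 j : `|x 0 j - y 0 j| <= 0 by rewrite xy0 subrr normr0.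
have be s N : `|s| <= `|t| -> (forall j, `|x s j - y s j| <= N) ->
    forall j, `|X (x s) j - X (y s) j| <= (C + 1) * (N + 0).
  move=> sT HN j; have [bx by_] := HM s sT.
  have N0 : 0 <= N := le_trans (normr_ge0 _) (HN j).
  have [_ h] := HC j _ _ N bx by_ N0 HN.
  by rewrite addr0 (le_trans h)// ler_wpM2r// lerDl.
have bd j s : `|s| <= `|t| -> `|x s j - y s j| <= M + M.
  move=> sT; have [bx by_] := HM s sT.
  by rewrite (le_trans (ler_normB _ _))// lerD.
have := gronwall (ltr_wpDl C0 ltr01) (lexx 0) de e0 be bd i (lexx _).
by rewrite mulr0 mul0r normr_le0 subr_eq0 => /eqP.
Qed.

Section Commute.
Variables (X Y WXY WYX : E -> E) (good : E -> Prop).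
Hypotheses (LX : vfield_lip X) (LY : vfield_lip Y).
Hypothesis LXY : vfield_lip WXY.
Hypothesis dXY : forall y, is_sol Y y -> (forall t, good (y t)) ->
  forall (t : R) i, is_derive t 1 (fun s => X (y s) i) (WXY (y t) i).
Hypothesis dYX : forall y, is_sol X y -> (forall t, good (y t)) ->
  forall (t : R) i, is_derive t 1 (fun s => Y (y s) i) (WYX (y t) i).
Hypothesis W_eq : forall e, good e -> WXY e =1 WYX e.

Variable x : R -> R -> E.
Hypothesis x_good : forall s t, good (x s t).
Hypothesis x_sol : forall t, is_sol X (x^~ t).
Hypothesis x0_sol : is_sol Y (x 0).
Hypothesis x_bnd : forall T, exists M, forall s t,
  `|s| <= T -> `|t| <= T -> bounded_by M (x s t).
Hypothesis x_loc : forall T, exists M, forall s t, `|s| <= T -> `|t| <= T ->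
  exists y, [/\ is_sol Y y, forall h, good (y h), y 0 = x s t &
    forall h, `|h| <= 1 -> bounded_by M (y h)].

Let sol_quad (Z : E -> E) y (M C t h : R) i : is_sol Z y ->
  (forall al x y d, bounded_by M x -> bounded_by M y -> 0 <= d -> near_by d x y ->
    `|Z x al| <= C /\ `|Z x al - Z y al| <= C * d) ->
  0 <= C -> (forall s, `|s| <= `|h| -> bounded_by M (y (t + s))) ->
  `|y (t + h) i - y t i - h * Z (y t) i| <= C * C * h ^+ 2.
Proof.
move=> sy HC C0 by_.
have b0 : bounded_by M (y t) by rewrite -[t]addr0; apply: by_; rewrite normr0.
have self (s : R) : `|s| <= `|h| -> forall j, `|Z (y (t + s)) j| <= C.
  move=> hs j; have [] // := HC j _ _ 0 (by_ s hs) (by_ s hs) (lexx _) _.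
  by move=> k; rewrite subrr normr0.
have lip1 (s : R) : `|s| <= `|h| -> near_by (C * `|s|) (y (t + s)) (y t).
  move=> hs j; apply: (@deriv_bound R (y^~ j) (fun u => Z (y u) j)) => u us.
    exact: sy.
  by apply: self; exact: le_trans hs.
apply: (@taylor (y^~ i) (fun u => Z (y u) i)) => [s hs|s hs|].
- exact: sy.
- have [_ h'] := HC i _ _ _ (by_ s hs) b0 (mulr_ge0 C0 (normr_ge0 s)) (lip1 s hs).
  by rewrite -mulrA.
- exact: mulr_ge0.
Qed.

Let cross_quad : forall T, exists K, forall s t h i, `|s| <= T -> `|t| <= T ->
  `|h| <= 1 -> `|x s (t + h) i - x s t i - h * Y (x s t) i| <= K * h ^+ 2.
Proof.
move=> T; have [M1 HM1] := x_bnd (`|T| + 1); have [M2 HM2] := x_loc T.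
pose M3 := `|M1| + `|M2|.
have [CY CY0 HCY] := LY M3.
pose M := M3 + CY.
have M1M : M1 <= M3 by rewrite (le_trans (ler_norm _))// lerDl.
have M2M : M2 <= M3 by rewrite (le_trans (ler_norm _))// lerDr.
have M3M : M3 <= M by rewrite lerDl.
have bndW (m m' : R) (e : E) : m <= m' -> bounded_by m e -> bounded_by m' e.
  by move=> mm be i; exact: le_trans mm.
have [C1 C10 HX] := LX M; have [C2 C20 HY] := LY M; have [C3 C30 HW] := LXY M.
pose C := C1 + C2 + C3 + 1.
have C1C : C1 <= C by rewrite /C; lra.
have C2C : C2 <= C by rewrite /C; lra.
have C3C : C3 <= C by rewrite /C; lra.
have C_gt0 : 0 < C by rewrite /C; lra.
have C1' : 1 <= C by rewrite /C; lra.
have HX' al e e' d : bounded_by M e -> bounded_by M e' -> 0 <= d -> near_by d e e' ->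
    `|X e al| <= C /\ `|X e al - X e' al| <= C * d.
  move=> b1 b2 d0 ee; have [h1 h2] := HX al e e' d b1 b2 d0 ee.
  by split; [exact: le_trans C1C|rewrite (le_trans h2)// ler_wpM2r].
have HY' al e e' d : bounded_by M e -> bounded_by M e' -> 0 <= d -> near_by d e e' ->
    `|Y e al| <= C /\ `|Y e al - Y e' al| <= C * d.
  move=> b1 b2 d0 ee; have [h1 h2] := HY al e e' d b1 b2 d0 ee.
  by split; [exact: le_trans C2C|rewrite (le_trans h2)// ler_wpM2r].
have HW' al e e' d : bounded_by M e -> bounded_by M e' -> 0 <= d -> near_by d e e' ->
    `|WXY e al| <= C /\ `|WXY e al - WXY e' al| <= C * d.
  move=> b1 b2 d0 ee; have [h1 h2] := HW al e e' d b1 b2 d0 ee.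
  by split; [exact: le_trans C3C|rewrite (le_trans h2)// ler_wpM2r].
exists (3 * (C * C + C) * expR (2 * C * `|T|)) => s0 t h i s0T tT h1.
have T0 : 0 <= T := le_trans (normr_ge0 _) tT.
have TT : `|T| = T by rewrite ger0_norm.
pose c := (C * C + C) * h ^+ 2.
have h20 : 0 <= h ^+ 2 by rewrite sqr_ge0.
have CC0 : 0 <= C * C by rewrite mulr_ge0// ltW.
have c0 : 0 <= c by rewrite mulr_ge0// addr_ge0// ltW.
have thT u : `|u| <= `|h| -> `|t + u| <= `|T| + 1.
  by move=> uh; rewrite TT (le_trans (ler_normD _ _))// lerD// (le_trans uh).
have inT s : `|s| <= T -> `|s| <= `|T| + 1.
  by rewrite TT => sT; rewrite (le_trans sT)// lerDl.
have bx s u : `|s| <= T -> `|u| <= `|h| -> bounded_by M3 (x s (t + u)).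
  by move=> sT uh; apply: bndW M1M _; apply: HM1; [exact: inT|exact: thT].
have bxt s : `|s| <= T -> bounded_by M3 (x s t).
  by move=> sT; have := bx s 0 sT; rewrite addr0; apply; rewrite normr0.
have YC s j : `|s| <= T -> `|Y (x s t) j| <= CY.
  move=> sT; have [] // := HCY j _ _ 0 (bxt s sT) (bxt s sT) (lexx _) _.
  by move=> k; rewrite subrr normr0.
have hYC s j : `|s| <= T -> `|h * Y (x s t) j| <= CY.
  move=> sT; rewrite normrM -[leRHS]mul1r ler_pM// ?YC//.
pose e j s := x s (t + h) j - x s t j - h * Y (x s t) j.
pose e' j s := X (x s (t + h)) j - X (x s t) j - h * WYX (x s t) j.
have de j (s : R) : `|s| <= T -> is_derive s 1 (e j) (e' j s).
  move=> sT; apply: drvB; first by apply: drvB; exact: x_sol.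
  by apply: drvZ; exact: (dYX (x_sol t)).
have e0 j : `|e j 0| <= c.
  apply: le_trans (_ : C * C * h ^+ 2 <= c); last first.
    by rewrite /c ler_wpM2r// lerDl ltW.
  apply: (@sol_quad Y (x 0) M C t h j x0_sol HY' (ltW C_gt0)).
  by move=> s sh; apply: bndW M3M _; apply: bx => //; rewrite normr0.
have bd j s : `|s| <= T -> `|e j s| <= M3 + M3 + CY.
  move=> sT; rewrite (le_trans (ler_normB _ _))// lerD ?hYC//.
  by rewrite (le_trans (ler_normB _ _))// lerD//; [exact: bx|exact: bxt].
have be s N : `|s| <= T -> (forall j, `|e j s| <= N) ->
    forall j, `|e' j s| <= C * (N + c).
  move=> sT HN j.
  have N0 : 0 <= N := le_trans (normr_ge0 _) (HN j).
  (* the second-order expansion of X in the direction Y is read off along a genuine Y-curve *)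
  have [y [sy gy y0 by_]] := HM2 s t sT tT.
  have byM u : `|u| <= `|h| -> bounded_by M (y (0 + u)).
    move=> uh; rewrite add0r.
    exact: (bndW _ _ _ M3M (bndW _ _ _ M2M (by_ u (le_trans uh h1)))).
  pose Ls : E := fun k => x s t k + h * Y (x s t) k.
  have bL : bounded_by M Ls.
    by move=> k; rewrite (le_trans (ler_normD _ _))// lerD// ?hYC//; exact: bxt.
  have byh : bounded_by M (y h) by have := byM h (lexx _); rewrite add0r.
  have q1 : near_by (C * C * h ^+ 2) (y h) Ls.
    move=> k; have := @sol_quad Y y M C 0 h k sy HY' (ltW C_gt0) byM.
    by rewrite add0r y0 /Ls opprD addrA.
  have e1 : `|X (x s (t + h)) j - X Ls j| <= C * N.
    apply: (HX' j _ _ N _ bL N0 _).2.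
      by apply: bndW M3M _; apply: bx.
    by move=> k; rewrite /Ls opprD addrA; exact: HN.
  have e2 : `|X (y h) j - X Ls j| <= C * (C * C * h ^+ 2).
    by apply: (HX' j _ _ _ byh bL _ q1).2; rewrite mulr_ge0.
  have e3 : `|X (y h) j - X (x s t) j - h * WXY (x s t) j| <= C * C * h ^+ 2.
    have := @taylor (fun u => X (y u) j) (fun u => WXY (y u) j) 0 h (C * C).
    rewrite add0r y0; apply => // [u uh|u uh]; rewrite ?add0r.
      exact: dXY.
    have lip1 : near_by (C * `|u|) (y u) (x s t).
      move=> k; rewrite -y0.
      have H := @deriv_bound R (y^~ k) (fun w => Y (y w) k) 0 u C.
      rewrite /= add0r in H; apply: H => v vu; first exact: sy.
      have bv := byM v (le_trans vu uh).
      by apply: (HY' k _ _ 0 bv bv (lexx _) _).1 => k'; rewrite subrr normr0.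
    have bu := byM u uh; rewrite add0r in bu.
    rewrite -mulrA; apply: (HW' j _ _ _ bu _ _ lip1).2.
      by have := byM 0; rewrite addr0 y0; apply; rewrite normr0.
    by rewrite mulr_ge0// ltW.
  rewrite /e' -(W_eq (x_good s t)).
  rewrite (_ : _ - _ - _ = (X (x s (t + h)) j - X Ls j) - (X (y h) j - X Ls j)
     + (X (y h) j - X (x s t) j - h * WXY (x s t) j)); last by ring.
  rewrite (le_trans (ler_normD _ _))//.
  rewrite (le_trans (lerD (ler_normB _ _) (lexx _)))//.
  rewrite (le_trans (lerD (lerD e1 e2) e3))// /c.
  by apply: le_of_eq; ring.
have := gronwall C_gt0 c0 de e0 be bd i s0T => /le_trans; apply.
rewrite /c (_ : _ * expR _ = 3 * (C * C + C) * expR (2 * C * `|s0|) * h ^+ 2); last by ring.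
rewrite ler_wpM2r// ler_wpM2l//.
  by rewrite mulr_ge0// addr_ge0// ltW.
by rewrite ler_expR ler_pM2l ?TT// mulr_gt0.
Qed.

(** The infinitesimal commutation of X and Y is the equality of the derivative of
    X along Y-curves with the derivative of Y along X-curves. For small h the
    curve s |-> x s t + h Y (x s t) therefore solves the X-equation up to O(h^2),
    as does s |-> x s (t + h), and they start O(h^2) apart; by Gronwall they stay
    so. Hence x is a Y-curve in t for every s, and its diagonal follows X + Y.
    Working with curves only avoids differentiating flows in their initial
    value. *)
Lemma commuting_diagonal (t : R) i :
  is_derive t 1 (fun s => x s s i) (X (x t t) i + Y (x t t) i).
Proof.
have [K HK] := cross_quad (`|t| + 1).
have [M HM] := x_bnd (`|t| + 1).
have [C1 C10 HX] := LX M; have [C2 C20 HY] := LY M.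
have inT h : `|h| <= 1 -> `|t + h| <= `|t| + 1.
  by move=> h1; rewrite (le_trans (ler_normD _ _))// lerD2l.
have tT : `|t| <= `|t| + 1 by rewrite lerDl.
have bx h : `|h| <= 1 -> bounded_by M (x (t + h) t) by move=> /inT h1; exact: HM.
have b0 : bounded_by M (x t t) by exact: HM.
apply: (@is_derive_quad _ _ _ _ (K + C1 * C1 + C2 * C1) 1) => // h h1.
have e1 := HK (t + h) t h i (inT h h1) tT h1.
have bxh s : `|s| <= `|h| -> bounded_by M (x (t + s) t).
  by move=> sh; apply: bx; exact: le_trans h1.
have e2 := @sol_quad X (x^~ t) M C1 t h i (x_sol t) HX C10 bxh.
have e3 : `|Y (x (t + h) t) i - Y (x t t) i| <= C2 * (C1 * `|h|).
  apply: (HY i _ _ _ (bx h h1) b0 _ _).2; first exact: mulr_ge0.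
  move=> k; apply: (@deriv_bound R (fun s => x s t k) (fun s => X (x s t) k)) => u uh.
    exact: x_sol.
  by apply: (HX k _ _ 0 (bxh u uh) (bxh u uh) (lexx _) _).1 => k'; rewrite subrr normr0.
rewrite (_ : _ - _ - _ =
  (x (t + h) (t + h) i - x (t + h) t i - h * Y (x (t + h) t) i)
  + (x (t + h) t i - x t t i - h * X (x t t) i)
  + h * (Y (x (t + h) t) i - Y (x t t) i)); last by ring.
rewrite !mulrDl (le_trans (ler_normD _ _))// lerD//.
  by rewrite (le_trans (ler_normD _ _))// lerD.
rewrite normrM -(real_normK (num_real h)) expr2.
rewrite (_ : C2 * C1 * _ = `|h| * (C2 * (C1 * `|h|))); last by ring.
by rewrite ler_wpM2l.
Qed.

End Commute.
End Flows.

(** * Powers of a Jacobi matrix along a Lax flow *)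

Section LaxMore.
Variable K : comNzRingType.
Implicit Types (X Y Z Q : int -> int -> K) (a b u : int -> K).

Lemma bmulBl N M X Y Z : banded N X -> banded M Y ->
  bmul (fun j k => X j k - Y j k) Z =2 (fun j k => bmul X Z j k - bmul Y Z j k).
Proof.
move=> bX bY j k.
have -> : bmul (fun j k => X j k - Y j k) Z j k =
    bmul (fun j k => X j k + (-1) * Y j k) Z j k.
  by apply: eq_bmul => // ? ?; rewrite mulN1r.
by rewrite (bmulDl _ bX (bandedZ _ bY)) (bmulZl _ _ bY) mulN1r.
Qed.

Lemma bmulBr N X Y Z : banded N X ->
  bmul X (fun j k => Y j k - Z j k) =2 (fun j k => bmul X Y j k - bmul X Z j k).
Proof.
move=> bX j k.
have -> : bmul X (fun j k => Y j k - Z j k) j k =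
    bmul X (fun j k => Y j k + (-1) * Z j k) j k.
  by apply: eq_bmul => // ? ?; rewrite mulN1r.
by rewrite (bmulDr _ _ bX) (bmulZr _ _ bX) mulN1r.
Qed.

Lemma commZl N c X Y : banded N X ->
  comm (fun j k => c * X j k) Y =2 (fun j k => c * comm X Y j k).
Proof.
move=> bX j k; rewrite /comm (bmulZl _ _ bX) mulrBr; congr (_ - _).
rewrite (@bmul_winr _ N) ?(bmul_winr _ _ _ bX); last exact: bandedZ.
by rewrite mulr_sumr; apply: eq_bigr => l _; rewrite mulrCA.
Qed.

Lemma triZ c a b : tri (fun n => c * a n) (fun n => c * b n) =2
  (fun j k => c * tri a b j k).
Proof. by move=> j k; rewrite /tri /jop; ring. Qed.

(** The Leibniz rule for J^k with J' = [Q, J], in one inductive step. *)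
Lemma comm_jacpS N Q a b a' b' k : banded N Q ->
    comm Q (tri a b) =2 tri a' b' -> forall m n,
  jop a' b' (fun i => jacp a b k i n) m +
    jop a b (fun i => comm Q (jacp a b k) i n) m = comm Q (jacp a b k.+1) m n.
Proof.
move=> bQ QJ m n; rewrite -!bmul_tril.
have bT := @banded_tri K a b; have bP := @banded_jacp K a b k.
rewrite -(eq_bmul QJ (fun _ _ => erefl)) /comm.
rewrite (bmulBl _ (banded_mul bQ bT) (banded_mul bT bQ)) (bmulBr _ _ bT).
rewrite -(bmulA _ bQ bT) -(bmulA _ bT bQ) (bmulA _ bT bP).
rewrite (eq_bmul (fun _ _ => erefl) (@jacpS _ a b k)) (eq_bmul (@jacpS _ a b k) (fun _ _ => erefl)).
ring.
Qed.

Lemma comm0 N Q m n : banded N Q -> comm Q (fun m n => dlt K n m) m n = 0.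
Proof. by move=> bQ; rewrite /comm (bmul1r bQ) (bmul1l bQ) subrr. Qed.

Lemma comm_pmx N Q a b d c m n : banded N Q ->
  comm Q (pmx d c a b) m n = \sum_(k < d) c k * comm Q (jacp a b k) m n.
Proof.
move=> bQ; rewrite /comm (bmul_win _ _ _ bQ) (bmul_winr _ _ _ bQ).
under eq_bigr do rewrite mulr_sumr.
under [X in _ - X]eq_bigr do rewrite mulr_suml.
rewrite exchange_big [X in _ - X]exchange_big -sumrB; apply: eq_bigr => k _.
rewrite (bmul_win _ _ _ bQ) (bmul_winr _ _ _ bQ) mulrBr !mulr_sumr.
by congr (_ - _); apply: eq_bigr => l _; ring.
Qed.

End LaxMore.

Section LaxDeriv.
Variable R : realType.

Lemma deriv_jop (a b u : R -> int -> R) (a' b' u' : int -> R) (t : R) n :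
  (forall m, is_derive t 1 (a^~ m) (a' m)) ->
  (forall m, is_derive t 1 (b^~ m) (b' m)) ->
  (forall m, is_derive t 1 (u^~ m) (u' m)) ->
  is_derive t 1 (fun s => jop (a s) (b s) (u s) n)
    (jop a' b' (u t) n + jop (a t) (b t) u' n).
Proof.
move=> da db du; rewrite /jop.
have := drvD (drvD (drvM (da n) (du (n + 1))) (drvM (da (n - 1)) (du (n - 1))))
  (drvM (db n) (du n)).
by move/is_derive_eq; apply; ring.
Qed.

Lemma deriv_jacp N (Q : int -> int -> R) (a b : R -> int -> R)
    (a' b' : int -> R) (t : R) : banded N Q ->
  (forall m, is_derive t 1 (a^~ m) (a' m)) ->
  (forall m, is_derive t 1 (b^~ m) (b' m)) ->
  comm Q (tri (a t) (b t)) =2 tri a' b' ->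
  forall k m n, is_derive t 1 (fun s => jacp (a s) (b s) k m n)
    (comm Q (jacp (a t) (b t) k) m n).
Proof.
move=> bQ da db QJ; elim=> [|k IH] m n.
  by rewrite (comm0 _ _ bQ); exact: drv_cst.
rewrite -(comm_jacpS k bQ QJ).
exact: (deriv_jop (u := fun s i => jacp (a s) (b s) k i n)).
Qed.

Lemma jacp_le (a b : int -> R) M : 0 <= M -> (forall n, `|a n| <= M) ->
  (forall n, `|b n| <= M) -> forall k m n, `|jacp a b k m n| <= (3 * M) ^+ k.
Proof.
move=> M0 Ma Mb; elim=> [|k IH] m n.
  by rewrite /jacp/= /dlt expr0; case: (_ == _); rewrite ?normr1 ?normr0.
rewrite exprS -[jacp _ _ _ _ _]/(jop a b (fun i => jacp a b k i n) m) /jop.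
rewrite (_ : 3 * M * _ = M * (3 * M) ^+ k + M * (3 * M) ^+ k + M * (3 * M) ^+ k); last by ring.
rewrite (le_trans (ler_normD _ _))// lerD ?normrM ?ler_pM//.
by rewrite (le_trans (ler_normD _ _))// lerD ?normrM ?ler_pM.
Qed.

Lemma jacp_square (a b : int -> R) k N m n : (k <= N)%N ->
  jacp a b (k + k) m n =
  \sum_(l <- win N m) jacp a b k m l * jacp a b k n l.
Proof.
move=> kN; rewrite -jacpD (bmul_win _ _ _ (banded_le kN (@banded_jacp _ a b k))).
by apply: eq_bigr => l _; rewrite (jacp_sym a b k l).
Qed.

Lemma jacp_diag_ge (a b : int -> R) k n l :
  jacp a b k n l ^+ 2 <= jacp a b (k + k) n n.
Proof.
have [nl|nl] := leqP `|n - l| k; last first.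
  rewrite banded_jacp// expr0n/= (jacp_square _ _ _ _ (leqnn k)) sumr_ge0// => i _.
  by rewrite -expr2 sqr_ge0.
rewrite (jacp_square _ _ _ _ (leqnn k)) (bigD1_seq l) ?win_uniq ?mem_win//= -expr2 lerDl.
by rewrite sumr_ge0// => i _; rewrite -expr2 sqr_ge0.
Qed.

Lemma jacp_diag_ge0 (a b : int -> R) k n : 0 <= jacp a b (k + k) n n.
Proof. by rewrite (le_trans _ (jacp_diag_ge a b k n n))// sqr_ge0. Qed.

(** J^(2k) is a square, so that its off-diagonal entries are controlled by the
    diagonal ones. *)
Lemma jacp_offdiag (a b : int -> R) k D m n :
  (forall i, jacp a b (k + k) i i <= D) -> `|jacp a b (k + k) m n| <= D.
Proof.
move=> HD; pose N := (k + `|m - n|)%N.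
have Nm : jacp a b (k + k) m m = \sum_(l <- win N m) jacp a b k m l ^+ 2.
  by rewrite (@jacp_square _ _ _ N)// ?leq_addr//; apply: eq_bigr => l _; rewrite expr2.
have Nn : \sum_(l <- win N m) jacp a b k n l ^+ 2 = jacp a b (k + k) n n.
  rewrite -jacpD (@bmul_seq _ _ _ _ _ (win N m) (win_uniq _ _)).
    by apply: eq_bigr => l _; rewrite (jacp_sym a b k l) expr2.
  by move=> l; rewrite mem_win => nl; rewrite banded_jacp ?mul0r//; rewrite /N in nl; lia.
have : `|jacp a b (k + k) m n| <= (jacp a b (k + k) m m + jacp a b (k + k) n n) / 2.
  rewrite (@jacp_square _ _ _ N)// ?leq_addr// Nm -Nn -big_split/= mulr_suml.
  rewrite (le_trans (ler_norm_sum _ _ _))// ler_sum// => l _.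
  rewrite normrM -(real_normK (num_real (jacp a b k m l))).
  rewrite -(real_normK (num_real (jacp a b k n l))).
  have := sqr_ge0 (`|jacp a b k m l| - `|jacp a b k n l|).
  by rewrite sqrrB; lra.
have := HD m; have := HD n; lra.
Qed.

(** The bound involves the size of J^(2k) only through its diagonal, and k not at
    all. *)
Lemma comm_diag_le (a b : int -> R) k N (Q : int -> int -> R) CQ D n :
  banded N Q -> (forall i j, `|Q i j| <= CQ) ->
  (forall i, jacp a b (k + k) i i <= D) ->
  `|comm Q (jacp a b (k + k)) n n| <= 2 * (2 * N).+1%:R * CQ * D.
Proof.
move=> bQ HQ HD.
have D0 : 0 <= D := le_trans (jacp_diag_ge0 a b k 0) (HD 0).
have C0 : 0 <= CQ := le_trans (normr_ge0 _) (HQ 0 0).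
have HX i j := @jacp_offdiag a b k D i j HD.
rewrite /comm (bmul_win _ _ _ bQ) (bmul_winr _ _ _ bQ).
rewrite (_ : 2 * _ * CQ * D = (2 * N).+1%:R * (CQ * D) + (2 * N).+1%:R * (CQ * D)); last by ring.
have cnt (F : int -> R) : (forall l, `|F l| <= CQ * D) ->
    `|\sum_(l <- win N n) F l| <= (2 * N).+1%:R * (CQ * D).
  move=> HF; rewrite sum_win (le_trans (ler_norm_sum _ _ _))//.
  apply: (le_trans (ler_sum _ (fun i _ => HF _))).
  by rewrite sumr_const card_ord mulr_natl.
rewrite (le_trans (ler_normB _ _))// lerD//; apply: cnt => l; rewrite normrM.
  by rewrite ler_pM.
by rewrite [leRHS]mulrC ler_pM.
Qed.

(** A constant factor is lost when roots of growing order are taken; Bernoulli's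
    inequality suffices. *)
Lemma pow_root (r s D : R) : 0 <= r -> 0 < s ->
  (forall i, r ^+ (2 ^ i) <= D * s ^+ (2 ^ i)) -> r <= s.
Proof.
move=> r0 s0 H; rewrite leNgt; apply/negP => sr.
pose d := r / s - 1.
have d0 : 0 < d by rewrite subr_gt0 ltr_pdivlMr// mul1r.
have bern m : 1 + m%:R * d <= (r / s) ^+ m.
  have -> : r / s = 1 + d by rewrite /d; ring.
  have d1 : 0 <= 1 + d by rewrite ltW// ltr_wpDr// ltW.
  elim: m => [|m IH]; first by rewrite mul0r addr0 expr0.
  rewrite exprS (le_trans _ (ler_wpM2l d1 IH))//.
  rewrite -natr1; have : 0 <= m%:R * d ^+ 2 by rewrite mulr_ge0// sqr_ge0.
  by lra.
have [k Hk] := geo_small (`|D|) d0.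
have k2 : `|D| <= (2 ^ k)%:R * d.
  by move: Hk; rewrite ler_pdivrMr ?exprn_gt0// natrX mulrC.
have := H k; rewrite -ler_pdivrMr ?exprn_gt0// -exprVn -exprMn.
have := bern (2 ^ k)%N; have := ler_norm D; lra.
Qed.

End LaxDeriv.

(** * The Toda vector field *)

Section StateCalculus.
Variables (R : realType) (I : Type) (ia ib : int -> I).
Variable Sol : (R -> I -> R) -> Prop.
Hypothesis coord : diff_along Sol (fun (al : I) x => x al).
Local Notation calc := (diff_along Sol).

Lemma diff_along_ext A (F G : A -> (I -> R) -> R) :
  (forall al x, F al x = G al x) -> calc G -> calc F.
Proof.
move=> FG; rewrite (_ : F = G)//.
by apply/funext => al; apply/funext => x.
Qed.

Definition calc2 (X : (I -> R) -> int -> int -> R) :=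
  calc (fun (mn : int * int) x => X x mn.1 mn.2).

Lemma calc_coord A (g : A -> I) : calc (fun al x => x (g al)).
Proof. exact: (calc_reindex g coord). Qed.

Local Notation jac k x := (jacp (fun n => x (ia n)) (fun n => x (ib n)) k).

Lemma calc_jacp k : calc2 (fun x => jac k x).
Proof.
elim: k => [|k IH].
  apply: (@diff_along_ext _ _ (fun (mn : int * int) x =>
    if mn.1 == mn.2 then 1 else 0)) => [[m n] x|]; last first.
    by apply: (@calc_if _ _ _ _ (fun mn : int * int => mn.1 == mn.2)); exact: calc_cst.
  by rewrite /jacp/= /dlt; case: (_ == _).
apply: (@diff_along_ext _ _ (fun (mn : int * int) x =>
   x (ia mn.1) * jac k x (mn.1 + 1) mn.2 +
   x (ia (mn.1 - 1)) * jac k x (mn.1 - 1) mn.2 + x (ib mn.1) * jac k x mn.1 mn.2)).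
  by [].
have IHg (g : int * int -> int) : calc (fun mn x => jac k x (g mn) mn.2).
  exact: (calc_reindex (fun mn => (g mn, mn.2)) IH).
apply: calcD; first apply: calcD; (apply: calcM; first exact: calc_coord).
- exact: (IHg (fun mn => mn.1 + 1)).
- exact: (IHg (fun mn => mn.1 - 1)).
- exact: (IHg (fun mn => mn.1)).
Qed.

Lemma calc_pmx d c : calc2 (fun x => pmx d c (fun n => x (ia n)) (fun n => x (ib n))).
Proof.
apply: calc_sum => k; apply: calcM; first exact: calc_cst.
exact: calc_jacp.
Qed.

Lemma calc_anti X : calc2 X -> calc2 (fun x => anti (X x)).
Proof.
move=> HX; apply: calc_if; first exact: HX.
by apply: calc_if; [apply: calcN; exact: HX|exact: calc_cst].
Qed.

Lemma calc_bmul N X Y : (forall x, banded N (X x)) -> calc2 X -> calc2 Y ->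
  calc2 (fun x => bmul (X x) (Y x)).
Proof.
move=> bX HX HY.
apply: (@diff_along_ext _ _ (fun (mn : int * int) x => \sum_(l < (2 * N).+1)
  X x mn.1 (mn.1 - N%:Z + l%:Z) * Y x (mn.1 - N%:Z + l%:Z) mn.2)).
  by move=> [m n] x /=; rewrite (bmul_win _ _ _ (bX x)) sum_win.
apply: calc_sum => l; apply: calcM.
  exact: (calc_reindex (fun mn => (mn.1, mn.1 - N%:Z + l%:Z)) HX).
exact: (calc_reindex (fun mn => (mn.1 - N%:Z + l%:Z, mn.2)) HY).
Qed.

Lemma calc_comm N M X Y : (forall x, banded N (X x)) -> (forall x, banded M (Y x)) ->
  calc2 X -> calc2 Y -> calc2 (fun x => comm (X x) (Y x)).
Proof.
move=> bX bY HX HY; apply: calcB; first exact: calc_bmul HX HY.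
exact: calc_bmul HY HX.
Qed.

Lemma calc_tri : calc2 (fun x => tri (fun n => x (ia n)) (fun n => x (ib n))).
Proof. exact: (calc_jacp 1). Qed.

End StateCalculus.

Section TodaField.
Variable R : realType.
Local Notation E := (int + int -> R).
Implicit Types (x : E) (p q : {poly R}) (M : R).

Definition coef_a x n : R := x (inl n).
Definition coef_b x n : R := x (inr n).

Definition polym p (a b : int -> R) := pmx (size p) (fun k => p`_k) a b.
Definition toda_gen p a b := anti (polym p a b).
Definition lax p a b := comm (toda_gen p a b) (tri a b).

(** The Toda equation on the pair of sequences (a, b): the left injection carries
    the a's and the right one the b's. No positivity is imposed, as perturbed
    states of later estimates need not be positive. *)
Definition toda_field p x (i : int + int) : R :=
  match i with
  | inl n => lax p (coef_a x) (coef_b x) n (n + 1)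
  | inr n => lax p (coef_a x) (coef_b x) n n
  end.

Lemma banded_gen p a b : banded (size p) (toda_gen p a b).
Proof. exact: banded_anti (@banded_pmx _ _ _ _ _). Qed.

Lemma lax_entries p a b : lax p a b =2
  tri (fun n => a n * (polym p a b (n + 1) (n + 1) - polym p a b n n))
      (fun n => 2 * (a n * polym p a b (n + 1) n - a (n - 1) * polym p a b n (n - 1))).
Proof.
exact: comm_anti_tri (@banded_pmx _ _ _ _ _) (@pmx_sym _ _ _ _ _) (@pmx_tri _ _ _ _ _).
Qed.

Lemma lax_tri p x : lax p (coef_a x) (coef_b x) =2
  tri (coef_a (toda_field p x)) (coef_b (toda_field p x)).
Proof.
move=> j k; rewrite lax_entries /tri /jop /coef_a /coef_b /toda_field.
by rewrite !lax_entries !tri_up !tri_diag.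
Qed.

Lemma lipf_along I A (F : A -> (I -> R) -> R) :
  diff_along (fun _ => False) F -> lipf F.
Proof. by case. Qed.

Lemma lip_state I : diff_along (fun _ : R -> I -> R => False) (fun (al : I) (x : I -> R) => x al).
Proof.
by split; [exact: lip_coord|exists (fun _ _ => 0) => //; exact: lip_cst].
Qed.

Lemma lip_toda_gen p : lipf (fun (mn : int * int) x =>
  toda_gen p (coef_a x) (coef_b x) mn.1 mn.2).
Proof.
apply: lipf_along; apply: calc_anti.
exact: (calc_pmx inl inr (lip_state _)).
Qed.

Lemma calc_toda_field (I : Type) (ia ib : int -> I) (Sol : (R -> I -> R) -> Prop) p :
  diff_along Sol (fun (al : I) (x : I -> R) => x al) ->
  diff_along Sol (fun i (x : I -> R) => toda_field p
    (fun j => match j with inl n => x (ia n) | inr n => x (ib n) end) i).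
Proof.
move=> coord; have H : calc2 Sol (fun x : I -> R => lax p (fun n => x (ia n)) (fun n => x (ib n))).
  apply: (calc_comm (N := size p) (M := 1)) => [x|x||].
  - exact: banded_gen.
  - exact: banded_tri.
  - by apply: calc_anti; exact: calc_pmx.
  - exact: calc_tri.
apply: (diff_along_ext (G := fun i (x : I -> R) => lax p (fun n => x (ia n)) (fun n => x (ib n))
  (match i with inl n => n | inr n => n end)
  (match i with inl n => n + 1 | inr n => n end))) => [[n|n] x //|].
exact: (calc_reindex (fun i => (match i with inl n => n | inr n => n end,
  match i with inl n => n + 1 | inr n => n end)) H).
Qed.

Lemma lip_toda_field p : vfield_lip (toda_field p).
Proof.
have := calc_toda_field inl inr p (lip_state (int + int)) => /lipf_along H.
move: H; congr lipf; apply/funext => i; exact/funext.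
Qed.

Definition clip M (v : R) := Num.max (- M) (Num.min M v).

Lemma clip_id M v : `|v| <= M -> clip M v = v.
Proof.
move=> /ler_normlP[h1 h2]; rewrite /clip min_r// max_r//; lra.
Qed.

Lemma clip_le M v : 0 <= M -> `|clip M v| <= M.
Proof.
move=> M0; rewrite /clip ler_norml le_max lexx /= ge_max.
by apply/andP; split; [lra|rewrite ge_min lexx].
Qed.

Lemma clip_lip M v w : `|clip M v - clip M w| <= `|v - w|.
Proof.
have /ler_normlP[] := lexx `|v - w|; set d := `|v - w| => h1 h2.
have d0 : 0 <= d by exact: normr_ge0.
rewrite /clip ler_norml; clearbody d.
by case: (leP M v) => ?; case: (leP M w) => ?; do ?[case: (leP (- M) _) => ?];
  apply/andP; split; lra.
Qed.

End TodaField.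

(** * Global solutions of the Toda equation *)

Section Cutoff.
Variables (R : realType) (I : Type) (i0 : I) (M : R).
Hypothesis M0 : 0 < M.
Implicit Types x y : I -> R.

Definition bump01 (v : R) : R := Num.max 0 (Num.min 1 (2 - `|v| / M)).

Lemma bump01_ge0 v : 0 <= bump01 v.
Proof. by rewrite /bump01 le_max lexx. Qed.

Lemma bump01_le1 v : bump01 v <= 1.
Proof. by rewrite /bump01 ge_max ler01 ge_min lexx. Qed.

Lemma bump01_1 v : `|v| <= M -> bump01 v = 1.
Proof.
move=> vM; rewrite /bump01 min_l; first by rewrite max_r.
have : `|v| / M <= 1 by rewrite ler_pdivrMr// mul1r.
by lra.
Qed.

Lemma bump01_0 v : 2 * M < `|v| -> bump01 v = 0.
Proof.
move=> vM; rewrite /bump01 max_l// ge_min; apply/orP; right.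
have : 2 <= `|v| / M by rewrite ler_pdivlMr// ltW.
by lra.
Qed.

Lemma bump01_lip v w : `|bump01 v - bump01 w| <= `|v - w| / M.
Proof.
have : `| `|v| / M - `|w| / M| <= `|v - w| / M.
  rewrite -mulrBl normrM [`|M^-1|]ger0_norm ?invr_ge0 ?(ltW M0)//.
  by rewrite ler_wpM2r ?invr_ge0 ?(ltW M0)// ler_dist_dist.
have : 0 <= `|v - w| / M by rewrite divr_ge0// ltW.
rewrite /bump01; move: (`|v - w| / M) (`|v| / M) (`|w| / M) => d s u d0 /ler_normlP[].
rewrite ler_norml => h1 h2.
by case: (leP 1 (2 - s)) => ?; case: (leP 1 (2 - u)) => ?;
  do ?[case: (leP 0 _) => ?]; apply/andP; split; lra.
Qed.

(** An infimum of Lipschitz functions of the coordinates is Lipschitz in sup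
    norm. *)
Definition cutoff x : R := inf (range (fun i => bump01 (x i))).

Let lb x : has_lbound (range (fun i => bump01 (x i))).
Proof. by exists 0 => _ [i _ <-]; exact: bump01_ge0. Qed.

Let ne x : range (fun i => bump01 (x i)) !=set0.
Proof. by exists (bump01 (x i0)), i0. Qed.

Lemma cutoff_le x i : cutoff x <= bump01 (x i).
Proof. by apply: ge_inf; [exact: lb|exists i]. Qed.

Lemma cutoff_ge x c : (forall i, c <= bump01 (x i)) -> c <= cutoff x.
Proof. by move=> H; apply: lb_le_inf; [exact: ne|move=> _ [i _ <-]]. Qed.

Lemma cutoff_ge0 x : 0 <= cutoff x.
Proof. by apply: cutoff_ge => i; exact: bump01_ge0. Qed.

Lemma cutoff_le1 x : cutoff x <= 1.
Proof. exact: le_trans (cutoff_le x i0) (bump01_le1 _). Qed.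

Lemma cutoff_1 x : bounded_by M x -> cutoff x = 1.
Proof.
move=> bx; apply/eqP; rewrite eq_le cutoff_le1/=.
by apply: cutoff_ge => i; rewrite bump01_1.
Qed.

Lemma cutoff_neq0 x : cutoff x != 0 -> bounded_by (2 * M) x.
Proof.
move=> c0 i; rewrite leNgt; apply/negP => /bump01_0 b0.
by move/eqP: c0; apply; apply/eqP; rewrite eq_le cutoff_ge0 andbT -b0 cutoff_le.
Qed.

Lemma cutoff_lip x y d : near_by d x y -> `|cutoff x - cutoff y| <= d / M.
Proof.
have half z w : near_by d z w -> cutoff z - d / M <= cutoff w.
  move=> zw; apply: cutoff_ge => i; rewrite lerBlDl.
  apply: (le_trans (cutoff_le z i)); rewrite -lerBlDr.
  apply: (le_trans (ler_norm _)); apply: (le_trans (bump01_lip _ _)).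
  by rewrite ler_pM2r ?invr_gt0.
move=> xy; have := half x y xy.
have : cutoff y - d / M <= cutoff x by apply: half => i; rewrite distrC.
by rewrite ler_norml => h1 h2; apply/andP; split; lra.
Qed.

End Cutoff.

Section Existence.
Variables (R : realType) (p : {poly R}) (M0 : R).
Hypothesis M0_gt0 : 0 < M0.
Let M := 3 * M0.
Let M_gt0 : 0 < M. Proof. by rewrite mulr_gt0. Qed.
Notation E := (int + int -> R).

Let clipx (x : E) : E := fun i => clip (2 * M) (x i).
Let chi (x : E) := cutoff M x.
Let i0 : int + int := inl 0.

Let cutf (x : E) i := chi x * toda_field p (clipx x) i.

Let cutfE x i : cutf x i = chi x * toda_field p x i.
Proof.
rewrite /cutf; have [->|c0] := eqVneq (chi x) 0; first by rewrite !mul0r.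
congr (_ * toda_field p _ _); apply/funext => j; rewrite /clipx clip_id//.
exact: (cutoff_neq0 i0 M_gt0 c0).
Qed.

Let cutf_lip : exists2 L, 0 < L & (forall x i, `|cutf x i| <= L) /\
  forall x y d i, near_by d x y -> `|cutf x i - cutf y i| <= L * d.
Proof.
have [C C0 HC] := lip_toda_field p (2 * M).
have M20 : 0 <= 2 * M by rewrite mulr_ge0// ltW.
have bcl x : bounded_by (2 * M) (clipx x) by move=> i; exact: clip_le.
have bf x i : `|toda_field p (clipx x) i| <= C.
  have [] // := HC i _ _ 0 (bcl x) (bcl x) (lexx _) _.
  by move=> j; rewrite subrr normr0.
have c1 x : `|chi x| <= 1.
  by rewrite ger0_norm ?(cutoff_ge0 i0)// (cutoff_le1 i0).
exists (C / M + C + 1).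
  by rewrite ltr_wpDl// addr_ge0// divr_ge0// ltW.
split=> [x i|x y d i xy].
  rewrite normrM (le_trans (ler_pM (normr_ge0 _) (normr_ge0 _) (c1 x) (bf x i)))//.
  have : 0 <= C / M by rewrite divr_ge0// ltW.
  lra.
have d0 : 0 <= d := le_trans (normr_ge0 _) (xy i0).
have clxy : near_by d (clipx x) (clipx y).
  by move=> j; rewrite (le_trans (clip_lip _ _ _)).
have [_ e1] := HC i _ _ d (bcl x) (bcl y) d0 clxy.
have e2 := cutoff_lip i0 M_gt0 xy.
rewrite (_ : _ - _ = (chi x - chi y) * toda_field p (clipx x) i +
  chi y * (toda_field p (clipx x) i - toda_field p (clipx y) i)); last first.
  by rewrite /cutf; ring.
rewrite (le_trans (ler_normD _ _))// !normrM.
have h1 := ler_pM (normr_ge0 _) (normr_ge0 _) e2 (bf x i).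
have h2 := ler_pM (normr_ge0 _) (normr_ge0 _) (c1 y) e1.
rewrite (le_trans (lerD h1 h2))// (_ : d / M * C + 1 * (C * d) = (C / M + C) * d); last by ring.
by rewrite ler_wpM2r// lerDl.
Qed.

Variable x0 : E.
Hypothesis bx0 : bounded_by M0 x0.

Let cut_sol : exists x : R -> E, [/\ x 0 = x0, is_sol cutf x &
  forall T, exists K, forall t, `|t| <= T -> bounded_by K (x t)].
Proof.
have [L L0 [fb fl]] := cutf_lip.
have [|||x [e0 dx bx]] := @picard R (int + int) (fun _ => cutf) x0 L L L0.
- by move=> t x y d i; exact: fl.
- by move=> t i; exact: fb.
- move=> x cx i t; apply/cvgrPdist_le => e e_gt0.
  have [|r r0 Hr] := cx t (e / L); first by rewrite divr_gt0.
  exists r => //= s; rewrite /ball_/= distrC => sr.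
  rewrite distrC (le_trans (fl _ _ (e / L) _ _))//; first exact: Hr.
  by rewrite mulrCA divff ?mulr1// gt_eqF.
exists x; split=> // T; have [K HK] := bx T; exists (K + M0) => t tT i.
rewrite -(subrK (x0 i) (x t i)) (le_trans (ler_normD _ _))// lerD//.
exact: HK.
Qed.

(** The diagonal of J^(2k) obeys a differential inequality whose constant comes
    from the generator alone and not from k; taking 2k-th roots as k grows
    removes the exponential factor. This replaces the conservation of the
    operator norm under unitary conjugation. The cut-off factor only multiplies
    the generator, so the argument applies to the cut-off equation and then
    shows that the cut-off is never active. *)
Let isospectral x : x 0 = x0 -> is_sol cutf x ->
  (forall T, exists K, forall t, `|t| <= T -> bounded_by K (x t)) ->
  forall t, bounded_by M (x t).
Proof.
move=> e0 sx bx.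
have [CP CP0 HCP] := lip_toda_gen p (2 * M).
pose N := size p.
pose Q t m n := chi (x t) * toda_gen p (coef_a (x t)) (coef_b (x t)) m n.
have bQ t : banded N (Q t) by apply: bandedZ; exact: banded_gen.
have Qb t m n : `|Q t m n| <= CP.
  rewrite /Q; have [->|c0] := eqVneq (chi (x t)) 0; first by rewrite mul0r normr0.
  have b2 := cutoff_neq0 i0 M_gt0 c0.
  have [h _] := HCP (m, n) _ _ 0 b2 b2 (lexx _) (fun i => ltac:(by rewrite subrr normr0)).
  rewrite normrM -[leRHS]mul1r ler_pM// ger0_norm ?(cutoff_ge0 i0)//.
  exact: cutoff_le1.
have QJ t : comm (Q t) (tri (coef_a (x t)) (coef_b (x t))) =2
    tri (coef_a (cutf (x t))) (coef_b (cutf (x t))).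
  move=> m n; rewrite (commZl _ _ (@banded_gen _ _ _ _)).
  have := lax_tri p (x t) m n; rewrite /lax => ->.
  by rewrite -triZ /tri /jop /coef_a /coef_b !cutfE.
have dJ (t : R) k m n : is_derive t 1
    (fun s => jacp (coef_a (x s)) (coef_b (x s)) k m n)
    (comm (Q t) (jacp (coef_a (x t)) (coef_b (x t)) k) m n).
  apply: (deriv_jacp (bQ t)) (QJ t) _ _ _.
    by move=> i; exact: sx.
  by move=> i; exact: sx.
pose L := 2 * (2 * N).+1%:R * CP + 1.
have L0 : 0 < L by rewrite ltr_wpDl// !mulr_ge0.
have ba : forall n, `|coef_a (x 0) n| <= M0 by move=> n; rewrite e0; exact: bx0.
have bb : forall n, `|coef_b (x 0) n| <= M0 by move=> n; rewrite e0; exact: bx0.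
have growth t k n : jacp (coef_a (x t)) (coef_b (x t)) (k + k) n n <=
    3 * M ^+ (k + k) * expR (2 * L * `|t|).
  have [K HK] := bx `|t|.
  apply: (le_trans (ler_norm _)).
  apply: (@gronwall R int (fun n s => jacp (coef_a (x s)) (coef_b (x s)) (k + k) n n)
    (fun n s => comm (Q s) (jacp (coef_a (x s)) (coef_b (x s)) (k + k)) n n)
    L (M ^+ (k + k)) `|t| ((3 * `|K|) ^+ (k + k))) => //.
  - by rewrite exprn_ge0// ltW.
  - by move=> i; apply: jacp_le => //; exact: ltW.
  - move=> s D sT HD i.
    have HD' j : jacp (coef_a (x s)) (coef_b (x s)) (k + k) j j <= D.
      exact: le_trans (ler_norm _) (HD j).
    have D0 : 0 <= D := le_trans (normr_ge0 _) (HD 0).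
    have Mk0 : 0 <= M ^+ (k + k) by rewrite exprn_ge0// ltW.
    apply: (le_trans (comm_diag_le _ (bQ s) (Qb s) HD')).
    rewrite /L mulrDr [leRHS]addrC -[leLHS]add0r lerD// ?mulr_ge0 ?(ltW L0)//.
    by rewrite ler_wpM2r// lerDl.
  - move=> i s sT; apply: jacp_le => // n'; rewrite (le_trans (HK s sT _))//.
      exact: ler_norm.
    exact: ler_norm.
have low t n k : jacp (coef_a (x t)) (coef_b (x t)) 2 n n ^+ (2 ^ k) <=
    jacp (coef_a (x t)) (coef_b (x t)) (2 ^ k + 2 ^ k) n n.
  elim: k => [|k IH]; first by rewrite expn0 expr1.
  rewrite expnS mul2n -addnn exprD -expr2.
  apply: le_trans (jacp_diag_ge _ _ _ _ n).
  by rewrite ler_sqr ?nnegrE//; [rewrite exprn_ge0// (jacp_diag_ge0 _ _ 1)|exact: jacp_diag_ge0].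
have two t n : jacp (coef_a (x t)) (coef_b (x t)) 2 n n <= M ^+ 2.
  apply: (@pow_root _ _ _ (3 * expR (2 * L * `|t|))).
  - exact: (jacp_diag_ge0 _ _ 1).
  - by rewrite exprn_gt0.
  - move=> k; apply: (le_trans (low t n k)); apply: (le_trans (growth t _ n)).
    by rewrite -exprM mul2n -addnn mulrAC.
have ent t n l : `|tri (coef_a (x t)) (coef_b (x t)) n l| <= M.
  have := le_trans (jacp_diag_ge (coef_a (x t)) (coef_b (x t)) 1 n l) (two t n).
  rewrite -(real_normK (num_real (jacp _ _ _ _ _))) ler_sqr ?nnegrE ?(ltW M_gt0)//.
move=> t [n|n].
  by have := ent t n (n + 1); rewrite tri_up.
by have := ent t n n; rewrite tri_diag.
Qed.

Lemma toda_solution : exists x : R -> E,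
  [/\ x 0 = x0, is_sol (toda_field p) x & forall t, bounded_by M (x t)].
Proof.
have [x [e0 sx bx]] := cut_sol; exists x.
have bM := isospectral e0 sx bx.
split=> // t i; have := sx t i; rewrite cutfE /chi (cutoff_1 i0 M_gt0 (bM t)) mul1r.
exact.
Qed.

End Existence.

(** f exp(-F) is constant for an antiderivative F of c. *)
Lemma positivity (R : realType) (f c : R -> R) : continuous c ->
  (forall t : R, is_derive t 1 f (f t * c t)) -> 0 < f 0 -> forall t, 0 < f t.
Proof.
move=> cc df f0 t; have [F [F0 dF]] := primitive cc.
have dE (s : R) : is_derive s 1 (fun s => expR (- F s)) (expR (- F s) * - c s).
  exact: (drv_comp (g := fun s => - F s) (is_derive_expR _) (drvN (dF s))).
have := @deriv_bound R (fun s => f s * expR (- F s)) (fun=> 0) 0 t 0.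
rewrite add0r mul0r F0 oppr0 expR0 mulr1 => H.
have {H} : `|f t * expR (- F t) - f 0| <= 0.
  apply: H => [s _|s _]; last by rewrite normr0.
  have := drvM (df (0 + s)) (dE (0 + s)) => /is_derive_eq; apply; ring.
rewrite normr_le0 subr_eq0 => /eqP e.
by rewrite -(pmulr_lgt0 _ (expR_gt0 (- F t))) e.
Qed.

Lemma toda_positive (R : realType) (p : {poly R}) (x : R -> int + int -> R) M :
  is_sol (toda_field p) x -> (forall t, bounded_by M (x t)) ->
  (forall n, 0 < x 0 (inl n)) -> forall t n, 0 < x t (inl n).
Proof.
move=> sx bx x00 t n.
pose g s m := polym p (coef_a (x s)) (coef_b (x s)) m m.
apply: (@positivity R (fun s => x s (inl n)) (fun s => g s (n + 1) - g s n)) => //.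
  have gc m : continuous (g^~ m).
    have coord : diff_along (is_sol (toda_field p)) (fun (al : int + int) y => y al).
      split; first exact: lip_coord.
      exists (fun al y => toda_field p y al); first exact: lip_toda_field.
      by move=> y sy s al; exact: sy.
    have [_ [D _ HD]] := calc_pmx inl inr coord (size p) (fun k => p`_k).
    move=> s; apply: drv_continuous; exact: (HD x sx s (m, m)).
  by move=> s; apply: cvgB; exact: gc.
move=> s; have := sx s (inl n); rewrite /toda_field lax_entries tri_up.
exact.
Qed.

(** * The Toda flow on Jacobi matrices *)

Section TodaFlowTheory.
Variable R : realType.
Local Notation E := (int + int -> R).
Implicit Types (J : jacobi R) (p q : {poly R}).

Definition raw J : E := fun i => match i with inl n => ja J n | inr n => jb J n end.

Lemma raw_inj J J' : raw J = raw J' -> J = J'.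
Proof.
case: J => a b a0 bd; case: J' => a' b' a'0 bd' e.
have ea : a = a' by apply/funext => n; have := congr1 (@^~ (inl n)) e.
have eb : b = b' by apply/funext => n; have := congr1 (@^~ (inr n)) e.
by subst; congr Jacobi; exact: Prop_irrelevance.
Qed.

Lemma raw_bounded J : exists2 M : R, 0 < M & bounded_by M (raw J).
Proof.
have [M HM] := jac_bounded J; exists (`|M| + 1); first by rewrite ltr_wpDl.
by move=> [n|n]; have [h1 h2] := HM n;
  rewrite /raw (le_trans _ (ler_wpDr ler01 (ler_norm M))).
Qed.

Lemma polymE n p (a b : int -> R) i j : (size p <= n)%N ->
  polym p a b i j = \sum_(k < n) p`_k * jacp a b k i j.
Proof.
move=> pn; rewrite /polym /pmx.
rewrite (big_ord_widen n (fun k => p`_k * jacp a b k i j) pn) big_mkcond.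
apply: eq_bigr => k _; case: ltnP => // pk.
by rewrite nth_default ?mul0r.
Qed.

Lemma polymD p q (a b : int -> R) i j :
  polym (p + q) a b i j = polym p a b i j + polym q a b i j.
Proof.
pose n := maxn (size p) (size q).
rewrite !(@polymE n) ?leq_maxl ?leq_maxr ?size_polyD// -big_split/=.
by apply: eq_bigr => k _; rewrite coefD mulrDl.
Qed.

Lemma polymZ c p (a b : int -> R) i j :
  polym (c *: p) a b i j = c * polym p a b i j.
Proof.
rewrite !(@polymE (size p)) ?size_scale_leq// mulr_sumr.
by apply: eq_bigr => k _; rewrite coefZ mulrA.
Qed.

Lemma toda_fieldE p (x : E) i : toda_field p x i = match i with
  | inl n => coef_a x n * (polym p (coef_a x) (coef_b x) (n + 1) (n + 1) -
                        polym p (coef_a x) (coef_b x) n n)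
  | inr n => 2 * (coef_a x n * polym p (coef_a x) (coef_b x) (n + 1) n -
                  coef_a x (n - 1) * polym p (coef_a x) (coef_b x) n (n - 1))
  end.
Proof.
by case: i => n; rewrite /toda_field lax_entries ?tri_up ?tri_diag.
Qed.

Lemma toda_fieldD p q (x : E) i :
  toda_field (p + q) x i = toda_field p x i + toda_field q x i.
Proof. by rewrite !toda_fieldE; case: i => n; rewrite !polymD; ring. Qed.

Lemma toda_fieldZ c p (x : E) i : toda_field (c *: p) x i = c * toda_field p x i.
Proof. by rewrite !toda_fieldE; case: i => n; rewrite !polymZ; ring. Qed.

Definition shift_state n (x : E) : E :=
  fun i => match i with inl m => x (inl (m + n)) | inr m => x (inr (m + n)) end.

Lemma raw_shift n J : raw (jshift n J) = shift_state n (raw J).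
Proof. by apply/funext => -[]. Qed.

Lemma jacp_shift (a b : int -> R) (n : int) k i j :
  jacp (fun m => a (m + n)) (fun m => b (m + n)) k i j = jacp a b k (i + n) (j + n).
Proof.
elim: k i => [|k IH] i.
  by rewrite /jacp/= /dlt (inj_eq (addIr n)).
rewrite -[LHS]/(jop _ _ (fun m => jacp _ _ k m j) i) /jop !IH.
rewrite -[RHS]/(jop _ _ (fun m => jacp _ _ k m (j + n)) (i + n)) /jop.
by rewrite [i + 1 + n]addrAC [i - 1 + n]addrAC.
Qed.

Lemma polym_shift p (a b : int -> R) (n : int) i j :
  polym p (fun m => a (m + n)) (fun m => b (m + n)) i j = polym p a b (i + n) (j + n).
Proof. by apply: eq_bigr => k _; rewrite jacp_shift. Qed.

Lemma toda_field_shift p n (x : E) :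
  toda_field p (shift_state n x) = shift_state n (toda_field p x).
Proof.
apply/funext => i; rewrite toda_fieldE.
rewrite -[coef_a (shift_state n x)]/(fun m => coef_a x (m + n)).
rewrite -[coef_b (shift_state n x)]/(fun m => coef_b x (m + n)).
case: i => m; rewrite !polym_shift /shift_state toda_fieldE.
  by rewrite [m + 1 + n]addrAC.
by rewrite [m + 1 + n]addrAC [m - 1 + n]addrAC.
Qed.

Lemma toda_sol_quad p (x : R -> E) M : is_sol (toda_field p) x ->
  (forall t, bounded_by M (x t)) -> exists2 C, 0 <= C & forall t h i,
    `|x (t + h) i - x t i - h * toda_field p (x t) i| <= C * h ^+ 2.
Proof.
move=> sx bx; have [C C0 HC] := lip_toda_field p M.
exists (C * C); first exact: mulr_ge0.
move=> t h i.
have Xb s j : `|toda_field p (x s) j| <= C.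
  have [] // := HC j _ _ 0 (bx s) (bx s) (lexx _) _.
  by move=> k; rewrite subrr normr0.
apply: (@taylor R (x^~ i) (fun s => toda_field p (x s) i)) => [s _|s _|].
- exact: sx.
- have lip1 : near_by (C * `|s|) (x (t + s)) (x t).
    move=> j; apply: (@deriv_bound R (x^~ j) (fun u => toda_field p (x u) j)) => u _.
      exact: sx.
    exact: Xb.
  rewrite -mulrA; apply: (HC i _ _ _ (bx _) (bx _) _ lip1).2.
  exact: mulr_ge0.
- exact: mulr_ge0.
Qed.

(** A componentwise solution that stays bounded satisfies the equation in norm,
    because its second-order Taylor remainder is uniform in the component. *)
Lemma sol_toda_flow p (F : R -> jacobi R) J M : F 0 = J ->
  is_sol (toda_field p) (fun t => raw (F t)) -> (forall t, bounded_by M (raw (F t))) ->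
  is_toda_flow p J F.
Proof.
move=> F0 sF bF; split=> // t e e0.
have [C C0 HC] := toda_sol_quad sF bF.
have r0 : 0 < e / (3 * C + 1) by rewrite divr_gt0// ltr_wpDl// mulr_ge0.
exists (e / (3 * C + 1)) => // h /=; rewrite sub0r normrN => hr h0 j k.
pose g i := h^-1 * (raw (F (t + h)) i - raw (F t) i) - toda_field p (raw (F t)) i.
have -> : h^-1 * (jmx (F (t + h)) j k - jmx (F t) j k) -
   commZ (antisym (poly_mx p (F t))) (jmx (F t)) j k =
   tri (fun n => g (inl n)) (fun n => g (inr n)) j k.
  have := lax_tri p (raw (F t)) j k.
  rewrite -[lax _ _ _ _ _]/(commZ (antisym (poly_mx p (F t))) (jmx (F t)) j k) => ->.
  rewrite -![jmx _ _ _]/(tri (ja _) (jb _) j k) /tri /jop /coef_a /coef_b /g /raw.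
  ring.
have gC i : `|g i| <= C * `|h|.
  rewrite -(@ler_pM2l _ `|h|) ?normr_gt0// -normrM /g mulrBr mulVKf//.
  rewrite (le_trans (HC t h i))// [leRHS]mulrCA -[`|h| * `|h|]expr2 real_normK ?num_real//.
have Ch0 : 0 <= C * `|h| by rewrite mulr_ge0.
have d1 (m : int) : `|dlt R k m| <= 1.
  by rewrite /dlt; case: (_ == _); rewrite ?normr1 ?normr0.
apply: (@le_trans _ _ (3 * (C * `|h|))).
  rewrite /tri /jop (_ : 3 * _ = C * `|h| * 1 + C * `|h| * 1 + C * `|h| * 1); last by ring.
  rewrite (le_trans (ler_normD _ _))// lerD ?normrM ?ler_pM//.
  by rewrite (le_trans (ler_normD _ _))// lerD ?normrM ?ler_pM.
move: hr; rewrite ltr_pdivlMr ?ltr_wpDl ?mulr_ge0// => /ltW; apply: le_trans.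
by have := normr_ge0 h; lra.
Qed.

(** Differentiability in norm bounds a flow near each time, and compactness of
    [-T, T] turns this into the local bound that uniqueness requires. *)
Lemma toda_flow_sol p (F : R -> jacobi R) J : is_toda_flow p J F ->
  is_sol (toda_field p) (fun t => raw (F t)) /\
  (forall T, exists M, forall t, `|t| <= T -> bounded_by M (raw (F t))).
Proof.
move=> [F0 dF].
have ent (t : R) e : 0 < e -> \forall h \near (0 : R)^', forall i,
    `|h^-1 * (raw (F (t + h)) i - raw (F t) i) - toda_field p (raw (F t)) i| <= e.
  move=> e0; apply: filterS (dF t e e0) => h H [n|n].
    by have := H n (n + 1); rewrite -![jmx _ _ _]/(tri (ja _) (jb _) n (n + 1)) !tri_up.
  by have := H n n; rewrite -![jmx _ _ _]/(tri (ja _) (jb _) n n) !tri_diag.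
have ent' (t e : R) : 0 < e -> exists2 r, 0 < r & forall h, `|h| < r -> forall i,
    `|raw (F (t + h)) i - raw (F t) i - h * toda_field p (raw (F t)) i| <= e * `|h|.
  move=> e0; have [r /= r0 Hr] := ent t e e0; exists r => // h hr i.
  have [->|h0] := eqVneq h 0.
    by rewrite addr0 mul0r !subrr normr0 mulr0.
  have := Hr h; rewrite /ball_/= sub0r normrN => /(_ hr h0 i) H.
  rewrite -(@ler_pM2l _ `|h^-1|) ?normr_gt0 ?invr_eq0// -normrM mulrBr mulKf//.
  by rewrite (le_trans H)// mulrCA normfV mulVf ?mulr1// normr_eq0.
split=> [t i|T].
  apply: is_derive_small => e /(ent' t)[r r0 H]; exists r => // h hr; exact: H.
have K : compact `[- T, T] by exact: segment_compact.
have /compact_near_coveringP/(_ R (+oo%R)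
    (fun M t => bounded_by M (raw (F t))) _) H := K.
have {H} [] := H _.
  move=> t _; have [M M0 bM] := raw_bounded (F t).
  have [C C0 HC] := lip_toda_field p M.
  have [r r0 Hr] := ent' t 1 ltr01.
  exists ((ball t (Num.min 1 r)), [set N : R | M + C + 1 < N]) => /=.
    split; first by apply: nbhsx_ballx; rewrite lt_min ltr01.
    by exists (M + C + 1); split; rewrite ?num_real.
  move=> [s N] /= [ts MN] i.
  have {ts} : `|s - t| < Num.min 1 r by rewrite distrC.
  rewrite lt_min => /andP[st1 str].
  have := Hr _ str i; rewrite [t + _]addrC subrK mul1r => h1.
  have h2 := bM i.
  have [h3 _] := HC i _ _ 0 bM bM (lexx _) (fun i => ltac:(by rewrite subrr normr0)).
  rewrite (_ : raw _ _ = raw (F t) i + (s - t) * toda_field p (raw (F t)) i +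
    (raw (F s) i - raw (F t) i - (s - t) * toda_field p (raw (F t)) i)); last by ring.
  have h4 : `|(s - t) * toda_field p (raw (F t)) i| <= 1 * C.
    by rewrite normrM ler_pM// ltW.
  rewrite (le_trans (ler_normD _ _))// (le_trans (lerD (ler_normD _ _) (lexx _)))//.
  have := ltW st1; lra.
move=> M [_ HM]; exists (M + 1) => t tT; apply: (HM (M + 1)); first by rewrite ltrDl.
by rewrite /= in_itv/= -ler_norml.
Qed.

Lemma toda_flow_exists p J (M0 : R) : 0 < M0 -> bounded_by M0 (raw J) ->
  exists F, is_toda_flow p J F /\ forall t, bounded_by (3 * M0) (raw (F t)).
Proof.
move=> M00 bJ; have [x [x0 sx bx]] := toda_solution p M00 bJ.
have xpos t n : 0 < x t (inl n).
  by apply: (toda_positive sx bx) => m; rewrite x0; exact: ja_gt0.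
have xbd t : exists M : R, forall n, `|x t (inl n)| <= M /\ `|x t (inr n)| <= M.
  by exists (3 * M0) => n; split; exact: bx.
pose F t := Jacobi (xpos t) (xbd t).
have rF t : raw (F t) = x t by apply/funext => -[].
exists F; split=> [|t]; last by rewrite rF.
apply: (@sol_toda_flow _ _ _ (3 * M0)).
- by apply: raw_inj; rewrite rF.
- by move=> t i; rewrite rF (_ : (fun _ => _) = x^~ i)//; apply/funext => s; rewrite rF.
- by move=> t; rewrite rF.
Qed.

Lemma toda_flowP p J : is_toda_flow p J (toda_flow p J).
Proof.
rewrite /toda_flow; case: pselect => [ex|nex]; first by case: (cid ex).
have [M M0 bM] := raw_bounded J.
by have [F [HF _]] := toda_flow_exists p M0 bM; case: nex; exists F.
Qed.

Lemma toda_flow0 p J : toda_flow p J 0 = J.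
Proof. exact: (toda_flowP p J).1. Qed.

Lemma toda_flow_is_sol p J : is_sol (toda_field p) (fun t => raw (toda_flow p J t)).
Proof. exact: (toda_flow_sol (toda_flowP p J)).1. Qed.

(** Every locally bounded solution is the Toda flow; scaling, shift equivariance
    and the flow bounds follow by exhibiting a solution. *)
Lemma toda_flow_unique p J (x : R -> E) : is_sol (toda_field p) x ->
  x 0 = raw J -> (forall T, exists M, forall t, `|t| <= T -> bounded_by M (x t)) ->
  (fun t => raw (toda_flow p J t)) = x.
Proof.
move=> sx x0 bx; apply: (sol_unique (lip_toda_field p)) => //.
- exact: toda_flow_is_sol.
- by rewrite toda_flow0.
- move=> T; have [M HM] := bx T.
  have [M' HM'] := (toda_flow_sol (toda_flowP p J)).2 T.
  exists (Num.max M M') => t tT; split=> i.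
    by rewrite le_max (HM' t tT i) orbT.
  by rewrite le_max (HM t tT i).
Qed.

Lemma toda_flow_bnd p J (M0 : R) t : 0 < M0 -> bounded_by M0 (raw J) ->
  bounded_by (3 * M0) (raw (toda_flow p J t)).
Proof.
move=> M00 bJ; have [F [HF bF]] := toda_flow_exists p M00 bJ.
have [sF lF] := toda_flow_sol HF.
by have /(congr1 (@^~ t))/= -> := toda_flow_unique sF (congr1 raw HF.1) lF.
Qed.

Lemma toda_flow_locbnd p J : exists M, forall t, bounded_by M (raw (toda_flow p J t)).
Proof.
have [M M0 bM] := raw_bounded J.
by exists (3 * M) => t; exact: toda_flow_bnd.
Qed.

Lemma toda_scale p J c : toda (c *: p) J = toda_flow p J c.
Proof.
apply: raw_inj; rewrite /toda.
have [M HM] := toda_flow_locbnd p J.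
have -> // := congr1 (@^~ (1 : R)) (@toda_flow_unique (c *: p) J
  (fun t => raw (toda_flow p J (c * t))) _ _ _); rewrite /= ?mulr1//.
- move=> t i; rewrite toda_fieldZ.
  exact: (drv_scale (f := fun s => raw (toda_flow p J s) i) (toda_flow_is_sol p J _ _)).
- by rewrite mulr0 toda_flow0.
- by move=> T; exists M.
Qed.

Lemma toda_flow_shift p J n t : toda_flow p (jshift n J) t = jshift n (toda_flow p J t).
Proof.
apply: raw_inj; rewrite raw_shift.
have [M HM] := toda_flow_locbnd p J.
have -> // := congr1 (@^~ t) (@toda_flow_unique p (jshift n J)
  (fun t => shift_state n (raw (toda_flow p J t))) _ _ _).
- move=> s i; rewrite toda_field_shift.
  by case: i => m; exact: (toda_flow_is_sol p J).
- by rewrite toda_flow0 raw_shift.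
- by move=> T; exists M => s _ [m|m]; exact: HM.
Qed.

End TodaFlowTheory.

(** * Complex curves and the coefficients of the Toda cocycle *)

Section ComplexCurves.
Variable R : realType.
Local Notation C := R[i].
Implicit Types (f g : R -> C) (t : R) (d e z : C).

Lemma cReM (x y : C) : complex.Re (x * y) =
  complex.Re x * complex.Re y - complex.Im x * complex.Im y.
Proof. by case: x; case: y. Qed.

Lemma cImM (x y : C) : complex.Im (x * y) =
  complex.Re x * complex.Im y + complex.Im x * complex.Re y.
Proof. by case: x => a b; case: y. Qed.

Lemma cReD (x y : C) : complex.Re (x + y) = complex.Re x + complex.Re y.
Proof. by case: x; case: y. Qed.

Lemma cImD (x y : C) : complex.Im (x + y) = complex.Im x + complex.Im y.
Proof. by case: x; case: y. Qed.

Lemma cReN (x : C) : complex.Re (- x) = - complex.Re x.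
Proof. by case: x. Qed.

Lemma cImN (x : C) : complex.Im (- x) = - complex.Im x.
Proof. by case: x. Qed.

Lemma complexP (x y : C) : complex.Re x = complex.Re y ->
  complex.Im x = complex.Im y -> x = y.
Proof. by case: x => a b; case: y => c d /= -> ->. Qed.

Definition cder f t d := is_derive t 1 (fun s => complex.Re (f s)) (complex.Re d) /\
  is_derive t 1 (fun s => complex.Im (f s)) (complex.Im d).

Lemma cder_eq f t d e : cder f t d -> d = e -> cder f t e.
Proof. by move=> + <-. Qed.

Lemma cder_ext f g t d : (forall s, f s = g s) -> cder g t d -> cder f t d.
Proof. by move=> fg; rewrite (_ : f = g)//; apply/funext. Qed.

Lemma cder_cst z t : cder (fun=> z) t 0.
Proof. by split; exact: drv_cst. Qed.

Lemma cder_real (f : R -> R) t (d : R) : is_derive t 1 f d ->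
  cder (fun s => (f s)%:C) t d%:C.
Proof. by move=> df; split => //; exact: drv_cst. Qed.

Lemma cderD f g t d e : cder f t d -> cder g t e ->
  cder (fun s => f s + g s) t (d + e).
Proof.
move=> [f1 f2] [g1 g2]; split; rewrite ?cReD ?cImD.
  by have := drvD f1 g1; congr is_derive; apply/funext => s; rewrite cReD.
by have := drvD f2 g2; congr is_derive; apply/funext => s; rewrite cImD.
Qed.

Lemma cderN f t d : cder f t d -> cder (fun s => - f s) t (- d).
Proof.
move=> [f1 f2]; split; rewrite ?cReN ?cImN.
  by have := drvN f1; congr is_derive; apply/funext => s; rewrite cReN.
by have := drvN f2; congr is_derive; apply/funext => s; rewrite cImN.
Qed.

Lemma cderB f g t d e : cder f t d -> cder g t e ->
  cder (fun s => f s - g s) t (d - e).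
Proof. by move=> df dg; apply: cderD => //; exact: cderN. Qed.

Lemma cderM f g t d e : cder f t d -> cder g t e ->
  cder (fun s => f s * g s) t (f t * e + d * g t).
Proof.
move=> [f1 f2] [g1 g2]; split.
  have := drvB (drvM f1 g1) (drvM f2 g2).
  rewrite (_ : (fun s => complex.Re (f s * g s)) = (fun s =>
    complex.Re (f s) * complex.Re (g s) - complex.Im (f s) * complex.Im (g s))).
    by move/is_derive_eq; apply; rewrite cReD !cReM; ring.
  by apply/funext => s; rewrite cReM.
have := drvD (drvM f1 g2) (drvM f2 g1).
rewrite (_ : (fun s => complex.Im (f s * g s)) = (fun s =>
  complex.Re (f s) * complex.Im (g s) + complex.Im (f s) * complex.Re (g s))).
  by move/is_derive_eq; apply; rewrite cImD !cImM; ring.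
by apply/funext => s; rewrite cImM.
Qed.

Lemma cderZ z f t d : cder f t d -> cder (fun s => z * f s) t (z * d).
Proof.
move=> df; have := cderM (cder_cst z t) df.
by move/cder_eq; apply; rewrite mul0r addr0.
Qed.

Lemma cder_sum (I : Type) (r : seq I) (F : I -> R -> C) (D : I -> C) t :
  (forall i, cder (F i) t (D i)) ->
  cder (fun s => \sum_(i <- r) F i s) t (\sum_(i <- r) D i).
Proof.
move=> H; elim: r => [|i r IH].
  rewrite big_nil; apply: (@cder_ext _ (fun=> 0)) => [s|]; last exact: cder_cst.
  by rewrite big_nil.
rewrite big_cons; apply: (@cder_ext _ (fun s => F i s + \sum_(j <- r) F j s)).
  by move=> s; rewrite big_cons.
exact: cderD.
Qed.

Lemma cder_unique f t d e : cder f t d -> cder f t e -> d = e.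
Proof.
move=> [f1 f2] [g1 g2]; apply: complexP.
  exact: drv_unique f1 g1.
exact: drv_unique f2 g2.
Qed.

Lemma cder_const f : (forall t, cder f t 0) -> forall t, f t = f 0.
Proof.
move=> df t; apply: complexP.
  exact: (@is_derive_0_is_cst _ (fun s => complex.Re (f s)) t 0 (fun s => (df s).1)).
exact: (@is_derive_0_is_cst _ (fun s => complex.Im (f s)) t 0 (fun s => (df s).2)).
Qed.

End ComplexCurves.

Section ComplexCalculus.
Variables (R : realType) (I : Type) (Sol : (R -> I -> R) -> Prop).
Local Notation C := R[i].
Local Notation calc := (diff_along Sol).

Definition cdiff_along A (F : A -> (I -> R) -> C) :=
  calc (fun al x => complex.Re (F al x)) /\ calc (fun al x => complex.Im (F al x)).
Local Notation ccalc := cdiff_along.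

Lemma ccalc_ext A (F G : A -> (I -> R) -> C) :
  (forall al x, F al x = G al x) -> ccalc G -> ccalc F.
Proof.
move=> FG; rewrite (_ : F = G)//.
by apply/funext => al; apply/funext => x.
Qed.

Lemma ccalc_cst A (z : C) : ccalc (fun (_ : A) _ => z).
Proof. by split; exact: calc_cst. Qed.

Lemma ccalc_real A (F : A -> (I -> R) -> R) : calc F -> ccalc (fun al x => (F al x)%:C).
Proof. by move=> HF; split => //; exact: calc_cst. Qed.

Lemma ccalcD A (F G : A -> (I -> R) -> C) : ccalc F -> ccalc G ->
  ccalc (fun al x => F al x + G al x).
Proof.
move=> [F1 F2] [G1 G2]; split.
  by apply: diff_along_ext (calcD F1 G1) => al x; rewrite cReD.
by apply: diff_along_ext (calcD F2 G2) => al x; rewrite cImD.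
Qed.

Lemma ccalcN A (F : A -> (I -> R) -> C) : ccalc F -> ccalc (fun al x => - F al x).
Proof.
move=> [F1 F2]; split.
  by apply: diff_along_ext (calcN F1) => al x; rewrite cReN.
by apply: diff_along_ext (calcN F2) => al x; rewrite cImN.
Qed.

Lemma ccalcM A (F G : A -> (I -> R) -> C) : ccalc F -> ccalc G ->
  ccalc (fun al x => F al x * G al x).
Proof.
move=> [F1 F2] [G1 G2]; split.
  by apply: diff_along_ext (calcB (calcM F1 G1) (calcM F2 G2)) => al x; rewrite cReM.
by apply: diff_along_ext (calcD (calcM F1 G2) (calcM F2 G1)) => al x; rewrite cImM.
Qed.

Lemma ccalc_sum A n (F : 'I_n -> A -> (I -> R) -> C) : (forall k, ccalc (F k)) ->
  ccalc (fun al x => \sum_(k < n) F k al x).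
Proof.
elim: n F => [|n IH] F HF.
  by apply: ccalc_ext (ccalc_cst _ 0) => al x; rewrite big_ord0.
apply: (@ccalc_ext _ _ (fun al x =>
    \sum_(k < n) F (widen_ord (leqnSn n) k) al x + F ord_max al x)).
  by move=> al x; rewrite big_ord_recr.
by apply: ccalcD => //; exact: IH.
Qed.

End ComplexCalculus.

Section CocycleField.
Variable R : realType.
Local Notation C := R[i].
Local Notation E := (int + int -> R).
Implicit Types (J : jacobi R) (p q : {poly R}) (z : C) (x : E).

Lemma jacpC (a b : int -> R) k m n :
  jacp (fun i => (a i)%:C) (fun i => (b i)%:C) k m n = (jacp a b k m n)%:C.
Proof.
elim: k m => [|k IH] m; first by rewrite /jacp/= /dlt rmorph_nat.
rewrite -[LHS]/(jop _ _ (fun i => jacp _ _ k i n) m) /jop !IH.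
by rewrite -[X in _ = X%:C]/(jop _ _ (fun i => jacp _ _ k i n) m) /jop !rmorphD !rmorphM.
Qed.

Definition coef_aC x (n : int) : C := (coef_a x n)%:C.
Definition coef_bC x (n : int) : C := (coef_b x n)%:C.

Definition Gs p z x n : C := \sum_(k < size p) (p`_k)%:C * gsum k z (coef_aC x) (coef_bC x) n.
Definition Hs p z x n : C := \sum_(k < size p) (p`_k)%:C * hsum k z (coef_aC x) (coef_bC x) n.

Lemma Gs_toda p z J n : G_toda p z J n = Gs p z (raw J) n.
Proof.
apply: eq_bigr => k _; congr (_ * _); rewrite /G_mon /gsum.
by apply: eq_bigr => j _; rewrite jacpC.
Qed.

Lemma Hs_toda p z J n : H_toda p z J n = Hs p z (raw J) n.
Proof.
apply: eq_bigr => k _; congr (_ * _); rewrite /H_mon /hsum jacpC.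
by congr (_ + _ * _); apply: eq_bigr => j _; rewrite jacpC.
Qed.

Definition Bdiag p z x : C := 2 * (z - coef_bC x 1) * Gs p z x 1 - Hs p z x 1.

(** The entries of B_p; true stands for the first row or column. *)
Definition Bcoef p z x (r c : bool) : C :=
  match r, c with
  | true, true => Bdiag p z x
  | true, false => 2 * Gs p z x 1
  | false, true => - (2 * coef_aC x 0 ^+ 2 * Gs p z x 0)
  | false, false => - Bdiag p z x
  end.

Lemma B_todaE p z J : B_toda p z J =
  mx2 (Bcoef p z (raw J) true true) (Bcoef p z (raw J) true false)
      (Bcoef p z (raw J) false true) (Bcoef p z (raw J) false false).
Proof. by rewrite /B_toda !Gs_toda !Hs_toda. Qed.

Lemma coef_sumD p q (F : nat -> C) :
  \sum_(k < size (p + q)) ((p + q)`_k)%:C * F k =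
  \sum_(k < size p) (p`_k)%:C * F k + \sum_(k < size q) (q`_k)%:C * F k.
Proof.
pose n := maxn (size p) (size q).
have widen (r : {poly R}) : (size r <= n)%N ->
    \sum_(k < size r) (r`_k)%:C * F k = \sum_(k < n) (r`_k)%:C * F k.
  move=> rn; rewrite (big_ord_widen n (fun k => (r`_k)%:C * F k) rn) big_mkcond.
  apply: eq_bigr => k _; case: ltnP => // rk.
  by rewrite nth_default ?mul0r.
rewrite !widen ?leq_maxl ?leq_maxr ?size_polyD// -big_split/=.
by apply: eq_bigr => k _; rewrite coefD rmorphD mulrDl.
Qed.

Lemma GsD p q z x m : Gs (p + q) z x m = Gs p z x m + Gs q z x m.
Proof. exact: (coef_sumD p q (fun k => gsum k z (coef_aC x) (coef_bC x) m)). Qed.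

Lemma HsD p q z x m : Hs (p + q) z x m = Hs p z x m + Hs q z x m.
Proof. exact: (coef_sumD p q (fun k => hsum k z (coef_aC x) (coef_bC x) m)). Qed.

Lemma BcoefD p q z x r c : Bcoef (p + q) z x r c = Bcoef p z x r c + Bcoef q z x r c.
Proof. by case: r; case: c; rewrite /Bcoef /Bdiag ?GsD ?HsD; ring. Qed.

Section CalcB.
Variables (I : Type) (ia ib : int -> I) (Sol : (R -> I -> R) -> Prop).
Hypothesis coord : diff_along Sol (fun (al : I) (x : I -> R) => x al).
Let sub (x : I -> R) : E := fun i => match i with inl n => x (ia n) | inr n => x (ib n) end.
Local Notation ccalc := (cdiff_along Sol).

Let ccalc_jacp k (m n : int) : ccalc (fun (_ : unit) (x : I -> R) => jacp (coef_aC (sub x)) (coef_bC (sub x)) k m n).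
Proof.
apply: (@ccalc_ext _ _ _ _ _ (fun (_ : unit) (x : I -> R) =>
   (jacp (fun n => x (ia n)) (fun n => x (ib n)) k m n)%:C)).
  by move=> _ x; rewrite jacpC.
apply: ccalc_real.
exact: (calc_reindex (fun _ => (m, n)) (calc_jacp ia ib coord k)).
Qed.

Let ccalc_Gs p z n : ccalc (fun (_ : unit) (x : I -> R) => Gs p z (sub x) n).
Proof.
apply: ccalc_sum => k; apply: ccalcM; first exact: ccalc_cst.
apply: (@ccalc_ext _ _ _ _ _ (fun (_ : unit) (x : I -> R) => \sum_(j < k)
  z ^+ (k - 1 - j) * jacp (coef_aC (sub x)) (coef_bC (sub x)) j n n)).
  by move=> _ x; rewrite /gsum big_mkord.
by apply: ccalc_sum => j; apply: ccalcM; [exact: ccalc_cst|exact: ccalc_jacp].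
Qed.

Let ccalc_ca n : ccalc (fun (_ : unit) (x : I -> R) => coef_aC (sub x) n).
Proof. exact: (ccalc_real (calc_coord coord (fun=> ia n))). Qed.

Let ccalc_cb n : ccalc (fun (_ : unit) (x : I -> R) => coef_bC (sub x) n).
Proof. exact: (ccalc_real (calc_coord coord (fun=> ib n))). Qed.

Let ccalc_Hs p z n : ccalc (fun (_ : unit) (x : I -> R) => Hs p z (sub x) n).
Proof.
apply: ccalc_sum => k; apply: ccalcM; first exact: ccalc_cst.
apply: (@ccalc_ext _ _ _ _ _ (fun (_ : unit) (x : I -> R) => z ^+ k - jacp (coef_aC (sub x)) (coef_bC (sub x)) k n n
  + 2 * coef_aC (sub x) n * \sum_(j < k)
  z ^+ (k - 1 - j) * jacp (coef_aC (sub x)) (coef_bC (sub x)) j (n + 1) n)).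
  by move=> _ x; rewrite hsumE big_mkord.
apply: ccalcD.
  by apply: ccalcD; [exact: ccalc_cst|apply: ccalcN; exact: ccalc_jacp].
apply: ccalcM; first by apply: ccalcM; [exact: ccalc_cst|exact: ccalc_ca].
by apply: ccalc_sum => j; apply: ccalcM; [exact: ccalc_cst|exact: ccalc_jacp].
Qed.

Lemma ccalc_Bcoef p z r c : ccalc (fun (_ : unit) (x : I -> R) => Bcoef p z (sub x) r c).
Proof.
have d : ccalc (fun (_ : unit) (x : I -> R) => Bdiag p z (sub x)).
  apply: ccalcD; last by apply: ccalcN; exact: ccalc_Hs.
  apply: ccalcM; last exact: ccalc_Gs.
  apply: ccalcM; first exact: ccalc_cst.
  by apply: ccalcD; [exact: ccalc_cst|apply: ccalcN; exact: ccalc_cb].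
case: r; case: c => //; rewrite /Bcoef.
- by apply: ccalcM; [exact: ccalc_cst|exact: ccalc_Gs].
- apply: ccalcN; apply: ccalcM; last exact: ccalc_Gs.
  apply: ccalcM; first exact: ccalc_cst.
  by rewrite /= ; apply: ccalcM; exact: ccalc_ca.
- exact: ccalcN.
Qed.

End CalcB.
End CocycleField.

(** * Linear equations in two complex unknowns *)

Section ComplexNorm.
Variable R : realType.
Local Notation C := R[i].
Implicit Types (v w z : C).

(** The l^1 norm of C = R^2: unlike the norm of C it is real valued, and it
    controls both coordinates. *)
Definition cn w : R := `|complex.Re w| + `|complex.Im w|.

Lemma cn_ge0 w : 0 <= cn w. Proof. exact: addr_ge0. Qed.

Lemma cn0 : cn 0 = 0. Proof. by rewrite /cn !normr0 addr0. Qed.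

Lemma cn0_eq0 w : cn w <= 0 -> w = 0.
Proof.
move=> h; have /eqP : cn w = 0 by apply/eqP; rewrite eq_le h cn_ge0.
by rewrite paddr_eq0// !normr_eq0 => /andP[/eqP a /eqP b]; exact: complexP.
Qed.

Lemma cnD v w : cn (v + w) <= cn v + cn w.
Proof. by rewrite /cn cReD cImD addrACA lerD// ler_normD. Qed.

Lemma cnM v w : cn (v * w) <= cn v * cn w.
Proof.
rewrite /cn cReM cImM mulrDl !mulrDr.
apply: (le_trans (lerD (ler_normB _ _) (ler_normD _ _))).
by rewrite !normrM; lra.
Qed.

Lemma cn_Re w : `|complex.Re w| <= cn w. Proof. by rewrite lerDl. Qed.
Lemma cn_Im w : `|complex.Im w| <= cn w. Proof. by rewrite lerDr. Qed.

Definition part (b : bool) w : R := if b then complex.Re w else complex.Im w.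

Lemma part_cn b w : `|part b w| <= cn w.
Proof. by case: b; [exact: cn_Re|exact: cn_Im]. Qed.

Lemma cn_parts (K : R) w : (forall b, `|part b w| <= K) -> cn w <= 2 * K.
Proof. by move=> H; have := H true; have := H false; rewrite /cn /=; lra. Qed.

Lemma partD b v w : part b (v + w) = part b v + part b w.
Proof. by case: b; [exact: cReD|exact: cImD]. Qed.

Lemma partN b w : part b (- w) = - part b w.
Proof. by case: b; [exact: cReN|exact: cImN]. Qed.

End ComplexNorm.

Section LinearODE.
Variable R : realType.
Local Notation C := R[i].
Local Notation V := (bool -> C).
Implicit Types (m : bool -> bool -> C) (v w : V).

Definition lin m v (r : bool) : C := m r true * v true + m r false * v false.

Lemma cn_lin m v r (K N : R) : (forall r c, cn (m r c) <= K) ->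
  (forall c, cn (v c) <= N) -> cn (lin m v r) <= 2 * K * N.
Proof.
move=> mK vN; rewrite /lin (le_trans (cnD _ _))//.
rewrite (_ : 2 * K * N = K * N + K * N); last by ring.
by rewrite lerD// (le_trans (cnM _ _))// ler_pM ?cn_ge0.
Qed.

Lemma linB m v w r : lin m (fun c => v c - w c) r = lin m v r - lin m w r.
Proof. by rewrite /lin; ring. Qed.

Definition ccont (f : R -> C) :=
  continuous (fun t => complex.Re (f t)) /\ continuous (fun t => complex.Im (f t)).

Lemma ccont_cder (f f' : R -> C) : (forall t, cder f t (f' t)) -> ccont f.
Proof. by move=> df; split => t; have [h1 h2] := df t; exact: drv_continuous. Qed.

Lemma ccontD (f g : R -> C) : ccont f -> ccont g -> ccont (fun t => f t + g t).
Proof.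
move=> [f1 f2] [g1 g2]; split=> t.
  under [fun t => _]eq_fun do rewrite cReD.
  by apply: cvgD; [exact: f1|exact: g1].
under [fun t => _]eq_fun do rewrite cImD.
by apply: cvgD; [exact: f2|exact: g2].
Qed.

Lemma ccontM (f g : R -> C) : ccont f -> ccont g -> ccont (fun t => f t * g t).
Proof.
move=> [f1 f2] [g1 g2]; split=> t.
  under [fun t => _]eq_fun do rewrite cReM.
  by apply: cvgB; apply: cvgM; [exact: f1|exact: g1|exact: f2|exact: g2].
under [fun t => _]eq_fun do rewrite cImM.
by apply: cvgD; apply: cvgM; [exact: f1|exact: g2|exact: f2|exact: g1].
Qed.

Lemma ccont_comp (f : R -> C) (g : R -> R) : ccont f -> continuous g ->
  ccont (fun t => f (g t)).
Proof.
by move=> [f1 f2] cg; split=> t;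
  [apply: (continuous_comp (cg t) (f1 _))|apply: (continuous_comp (cg t) (f2 _))].
Qed.

Lemma continuous_bounded (f : R -> R) (T : R) : continuous f ->
  exists K, forall t, `|t| <= T -> `|f t| <= K.
Proof.
move=> cf; have [T0|T0] := ltP T 0.
  by exists 0 => t tT; have := le_lt_trans tT T0; rewrite ltNge normr_ge0.
have cnf : {within `[- T, T], continuous (fun t => `|f t|)}.
  apply: continuous_subspaceT => t; apply: continuous_comp; first exact: cf.
  exact: norm_continuous.
have [||c _ Hc] := @EVT_max R (fun t => `|f t|) (- T) T.
- by lra.
- exact: cnf.
exists `|f c| => t tT; apply: Hc.
by rewrite in_itv/= -ler_norml.
Qed.

Lemma ccont_bounded (f : R -> C) (T : R) : ccont f ->
  exists2 K, 0 <= K & forall t, `|t| <= T -> cn (f t) <= K.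
Proof.
move=> [/(continuous_bounded T)[K1 H1] /(continuous_bounded T)[K2 H2]].
exists (`|K1| + `|K2|) => // t tT.
by rewrite lerD// (le_trans _ (ler_norm _))//; [exact: H1|exact: H2].
Qed.

Lemma lin_gronwall (m : R -> bool -> bool -> C) (v g : R -> V) (K d T : R) :
  0 <= K -> 0 <= d ->
  (forall t r c, `|t| <= T -> cn (m t r c) <= K) ->
  (forall t r, `|t| <= T -> cder (fun s => v s r) t (lin (m t) (v t) r + g t r)) ->
  (forall r, cn (v 0 r) <= d) -> (forall t r, `|t| <= T -> cn (g t r) <= d) ->
  (forall r, ccont (fun t => v t r)) ->
  forall t r, `|t| <= T -> cn (v t r) <= 6 * d * expR (2 * (4 * K + 1) * `|t|).
Proof.
move=> K0 d0 mK dv v0 gd cv.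
have [N0 HN0] : exists N0, forall (i : bool * bool) t, `|t| <= T ->
    `|part i.2 (v t i.1)| <= N0.
  have [K1 K10 H1] := ccont_bounded T (cv true).
  have [K2 K20 H2] := ccont_bounded T (cv false).
  exists (K1 + K2) => -[r b] t tT; rewrite (le_trans (part_cn _ _))//.
  by case: r; [rewrite (le_trans (H1 t tT))// lerDl|rewrite (le_trans (H2 t tT))// lerDr].
have L0 : 0 < 4 * K + 1 by rewrite ltr_wpDl// mulr_ge0.
have dpart (i : bool * bool) (t : R) : `|t| <= T -> is_derive t 1
    (fun s => part i.2 (v s i.1)) (part i.2 (lin (m t) (v t) i.1 + g t i.1)).
  by case: i => r b tT; have [h1 h2] := dv t r tT; case: b.
have bpart t N : `|t| <= T -> (forall i : bool * bool, `|part i.2 (v t i.1)| <= N) ->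
    forall i : bool * bool,
    `|part i.2 (lin (m t) (v t) i.1 + g t i.1)| <= (4 * K + 1) * (N + d).
  move=> tT HN [r b] /=.
  have N_ge0 : 0 <= N := le_trans (normr_ge0 _) (HN (true, true)).
  have vN c : cn (v t c) <= 2 * N by apply: cn_parts => b'; exact: (HN (c, b')).
  have h1 := cn_lin r (fun r c => mK t r c tT) vN.
  rewrite (le_trans (part_cn _ _))// (le_trans (cnD _ _))//.
  rewrite (le_trans (lerD h1 (gd t r tT)))//.
  have : 0 <= K * d by rewrite mulr_ge0.
  by lra.
have v0' (i : bool * bool) : `|part i.2 (v 0 i.1)| <= d.
  by rewrite (le_trans (part_cn _ _)).
have := gronwall L0 d0 dpart v0' bpart HN0 => H t r tT.
rewrite (_ : 6 * d * _ = 2 * (3 * d * expR (2 * (4 * K + 1) * `|t|))); last by ring.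
by apply: cn_parts => b; exact: (H (r, b)).
Qed.

(** The coefficients and the source are bounded in time, so that the right-hand
    side is globally Lipschitz. *)
Lemma lin_exists (m : R -> bool -> bool -> C) (g : R -> V) (v0 : V) (K : R) :
  (forall t r c, cn (m t r c) <= K) -> (forall t r, cn (g t r) <= K) ->
  (forall r c, ccont (fun t => m t r c)) -> (forall r, ccont (fun t => g t r)) ->
  exists v : R -> V, v 0 = v0 /\
    forall t r, cder (fun s => v s r) t (lin (m t) (v t) r + g t r).
Proof.
move=> mK gK cm cg.
have K0 : 0 <= K := le_trans (cn_ge0 _) (gK 0 true).
pose vec (x : bool * bool -> R) (r : bool) : C := (x (r, true)) +i* (x (r, false)).
pose f t x (i : bool * bool) := part i.2 (lin (m t) (vec x) i.1 + g t i.1).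
pose x0 (i : bool * bool) := part i.2 (v0 i.1).
have vecx0 : vec x0 = v0 by apply/funext => r; apply: complexP.
have L0 : 0 < 4 * K + 1 by rewrite ltr_wpDl// mulr_ge0.
pose N := cn (v0 true) + cn (v0 false).
have cvec (x : R -> bool * bool -> R) r : ucont x -> ccont (fun t => vec (x t) r).
  move=> ux; split=> t; apply/cvgrPdist_le => e /(ux t)[r' r'0 Hr];
    exists r' => //= s; rewrite /ball_/= distrC => sr; rewrite distrC; exact: Hr.
have [|||x [e0 dx _]] := @picard R (bool * bool) f x0 (4 * K + 1) (2 * K * N + K) L0.
- move=> t x y d [r b] xy; rewrite /f/= -partN -partD.
  rewrite (_ : _ - _ = lin (m t) (fun c => vec x c - vec y c) r); last first.
    by rewrite linB; ring.
  have d0 : 0 <= d := le_trans (normr_ge0 _) (xy (true, true)).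
  have vd c : cn (vec x c - vec y c) <= 2 * d.
    by apply: cn_parts => b'; rewrite partD partN; have := xy (c, b'); case: b'.
  rewrite (le_trans (part_cn _ _))// (le_trans (cn_lin r (mK t) vd))//.
  by lra.
- move=> t [r b]; rewrite /f vecx0/= (le_trans (part_cn _ _))// (le_trans (cnD _ _))//.
  rewrite lerD// cn_lin// => c.
  by rewrite /N; case: c; rewrite ?lerDl ?lerDr ?cn_ge0.
- move=> x ux [r b].
  have : ccont (fun t => lin (m t) (vec (x t)) r + g t r).
    by apply: ccontD; [apply: ccontD; apply: ccontM; exact: cm || exact: cvec|exact: cg].
  by rewrite /f; case: b => -[].
exists (fun t => vec (x t)); split; first by rewrite e0.
move=> t r; split.
  exact: (dx t (r, true)).
exact: (dx t (r, false)).
Qed.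

End LinearODE.

(** * The Toda cocycle *)

Section SpectralDerivative.
Variables (R : realType) (Sol : (R -> int + int -> R) -> Prop) (z : R[i]).
Local Notation C := R[i].
Local Notation E := (int + int -> R).
Hypothesis coord : diff_along Sol (fun (al : int + int) (x : E) => x al).
Local Notation ccalc1 F := (cdiff_along Sol (fun (_ : unit) (x : E) => F x)).

Lemma ccalc_bound (F : E -> C) M : ccalc1 F ->
  exists2 K, 0 <= K & forall x, bounded_by M x -> cn (F x) <= K.
Proof.
move=> [[L1 _] [L2 _]]; have [K1 K10 H1] := L1 M; have [K2 K20 H2] := L2 M.
exists (K1 + K2); first exact: addr_ge0.
move=> x bx; rewrite lerD//.
  by apply: (H1 tt x x 0 bx bx (lexx _) _).1 => i; rewrite subrr normr0.
by apply: (H2 tt x x 0 bx bx (lexx _) _).1 => i; rewrite subrr normr0.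
Qed.

(** Differentiability in the spectral parameter at z, with a quadratic error
    that is uniform on bounded sets of states; the derivative has to be a
    functional of the same calculus so that it is continuous along the flow. *)
Definition zdiff (F : C -> E -> C) := ccalc1 (F z) /\
  exists2 F' : E -> C, ccalc1 F' & forall M, exists2 K : R, 0 <= K &
    forall x h, bounded_by M x -> cn h <= 1 ->
      [/\ cn (F z x) <= K, cn (F' x) <= K &
          cn (F (z + h) x - F z x - h * F' x) <= K * cn h ^+ 2].

Lemma zdiff_ext F G : (forall w x, F w x = G w x) -> zdiff G -> zdiff F.
Proof.
move=> FG; rewrite (_ : F = G)//.
by apply/funext => w; apply/funext => x.
Qed.

Lemma zdiff_indep F0 : ccalc1 F0 -> zdiff (fun _ => F0).
Proof.
move=> HF; split=> //; exists (fun=> 0); first exact: ccalc_cst.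
move=> M; have [K K0 HK] := ccalc_bound M HF; exists K => // x h bx h1.
rewrite cn0 mulr0 subr0 subrr cn0 K0; split=> //; first exact: HK.
by rewrite mulr_ge0// sqr_ge0.
Qed.

Lemma zdiff_cst (c : C) : zdiff (fun _ _ => c).
Proof. by apply: zdiff_indep; exact: ccalc_cst. Qed.

Lemma zdiff_id : zdiff (fun w _ => w).
Proof.
split; first exact: ccalc_cst.
exists (fun=> 1); first exact: ccalc_cst.
move=> M; exists (cn z + cn 1); first by rewrite addr_ge0 ?cn_ge0.
move=> x h _ _; rewrite lerDl lerDr !cn_ge0.
rewrite (_ : _ - _ - _ = 0) ?cn0; last by ring.
by split=> //; rewrite mulr_ge0 ?sqr_ge0 ?addr_ge0 ?cn_ge0.
Qed.

Lemma zdiffD F G : zdiff F -> zdiff G -> zdiff (fun w x => F w x + G w x).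
Proof.
move=> [CF [F' CF' HF]] [CG [G' CG' HG]]; split; first exact: ccalcD.
exists (fun x => F' x + G' x); first exact: ccalcD.
move=> M; have [K K0 HK] := HF M; have [L L0 HL] := HG M.
exists (K + L); first exact: addr_ge0.
move=> x h bx h1; have [a1 a2 a3] := HK x h bx h1; have [b1 b2 b3] := HL x h bx h1.
split; try by rewrite (le_trans (cnD _ _))// lerD.
rewrite (_ : _ - _ - _ = (F (z + h) x - F z x - h * F' x) +
   (G (z + h) x - G z x - h * G' x)); last by ring.
by rewrite (le_trans (cnD _ _))// mulrDl lerD.
Qed.

Lemma zdiffM F G : zdiff F -> zdiff G -> zdiff (fun w x => F w x * G w x).
Proof.
move=> [CF [F' CF' HF]] [CG [G' CG' HG]]; split; first exact: ccalcM.
exists (fun x => F' x * G z x + F z x * G' x).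
  by apply: ccalcD; exact: ccalcM.
move=> M; have [K K0 HK] := HF M; have [L L0 HL] := HG M.
have KL : 0 <= K * L by exact: mulr_ge0.
exists (6 * (K * L)); first exact: mulr_ge0.
move=> x h bx h1; have [a1 a2 a3] := HK x h bx h1; have [b1 b2 b3] := HL x h bx h1.
have h0 := cn_ge0 h.
have hh : cn h ^+ 2 <= cn h by rewrite expr2 ler_piMl.
have h2 : 0 <= cn h ^+ 2 by rewrite sqr_ge0.
have mul (u v : C) (s r : R) : cn u <= s -> cn v <= r -> cn (u * v) <= s * r.
  by move=> us vr; rewrite (le_trans (cnM _ _))// ler_pM ?cn_ge0.
have dF : cn (F (z + h) x - F z x) <= 2 * K * cn h.
  rewrite -(subrK (h * F' x) (_ - _)) (le_trans (cnD _ _))//.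
  have := mul h (F' x) _ _ (lexx _) a2; have := ler_wpM2l K0 hh; lra.
have dG : cn (G (z + h) x - G z x) <= 2 * L * cn h.
  rewrite -(subrK (h * G' x) (_ - _)) (le_trans (cnD _ _))//.
  have := mul h (G' x) _ _ (lexx _) b2; have := ler_wpM2l L0 hh; lra.
split.
- by rewrite (le_trans (mul _ _ _ _ a1 b1))//; lra.
- rewrite (le_trans (cnD _ _))//.
  by rewrite (le_trans (lerD (mul _ _ _ _ a2 b1) (mul _ _ _ _ a1 b2)))//; lra.
rewrite (_ : _ - _ - _ = F z x * (G (z + h) x - G z x - h * G' x)
  + (F (z + h) x - F z x - h * F' x) * G z x
  + (F (z + h) x - F z x) * (G (z + h) x - G z x)); last by ring.
have e1 := mul _ _ _ _ a1 b3; have e2 := mul _ _ _ _ a3 b1; have e3 := mul _ _ _ _ dF dG.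
rewrite (le_trans (cnD _ _))// (le_trans (lerD (cnD _ _) (lexx _)))//.
rewrite (le_trans (lerD (lerD e1 e2) e3))// expr2.
by apply: le_of_eq; ring.
Qed.

Lemma zdiffN F : zdiff F -> zdiff (fun w x => - F w x).
Proof.
move=> HF; apply: (zdiff_ext (G := fun w x => (-1) * F w x)).
  by move=> w x; rewrite mulN1r.
by apply: zdiffM => //; exact: zdiff_cst.
Qed.

Lemma zdiffX k : zdiff (fun w _ => w ^+ k).
Proof.
elim: k => [|k IH]; first exact: (zdiff_cst 1).
apply: (zdiff_ext (G := fun w _ => w * w ^+ k)); first by move=> w x; rewrite exprS.
by apply: zdiffM => //; exact: zdiff_id.
Qed.

Lemma zdiff_sum n (F : 'I_n -> C -> E -> C) : (forall k, zdiff (F k)) ->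
  zdiff (fun w x => \sum_(k < n) F k w x).
Proof.
elim: n F => [|n IH] F HF.
  by apply: (zdiff_ext (G := fun _ _ => 0)); [move=> w x; rewrite big_ord0|exact: zdiff_cst].
apply: (zdiff_ext (G := fun w x =>
    \sum_(k < n) F (widen_ord (leqnSn n) k) w x + F ord_max w x)).
  by move=> w x; rewrite big_ord_recr.
by apply: zdiffD => //; exact: IH.
Qed.

Let sta_calc n : diff_along Sol (fun (_ : unit) x => coef_a x n).
Proof. exact: (calc_coord coord (fun=> inl n)). Qed.

Let stb_calc n : diff_along Sol (fun (_ : unit) x => coef_b x n).
Proof. exact: (calc_coord coord (fun=> inr n)). Qed.

Let zdiff_jacp k (m n : int) : zdiff (fun _ x => jacp (coef_aC x) (coef_bC x) k m n).
Proof.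
apply: zdiff_indep.
apply: (@ccalc_ext _ _ _ _ _ (fun (_ : unit) (x : E) => (jacp (coef_a x) (coef_b x) k m n)%:C)).
  by move=> _ x; rewrite jacpC.
apply: ccalc_real.
exact: (calc_reindex (fun _ => (m, n)) (calc_jacp inl inr coord k)).
Qed.

Let zdiff_Gs p n : zdiff (fun w x => Gs p w x n).
Proof.
apply: zdiff_sum => k; apply: zdiffM; first exact: zdiff_cst.
apply: (zdiff_ext (G := fun w x => \sum_(j < k)
  w ^+ (k - 1 - j) * jacp (coef_aC x) (coef_bC x) j n n)).
  by move=> w x; rewrite /gsum big_mkord.
by apply: zdiff_sum => j; apply: zdiffM; [exact: zdiffX|exact: zdiff_jacp].
Qed.

Let zdiff_Hs p n : zdiff (fun w x => Hs p w x n).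
Proof.
apply: zdiff_sum => k; apply: zdiffM; first exact: zdiff_cst.
apply: (zdiff_ext (G := fun w x => w ^+ k - jacp (coef_aC x) (coef_bC x) k n n
  + 2 * coef_aC x n * \sum_(j < k) w ^+ (k - 1 - j) * jacp (coef_aC x) (coef_bC x) j (n + 1) n)).
  by move=> w x; rewrite hsumE big_mkord.
apply: zdiffD.
  by apply: zdiffD; [exact: zdiffX|apply: zdiffN; exact: zdiff_jacp].
apply: zdiffM; last first.
  by apply: zdiff_sum => j; apply: zdiffM; [exact: zdiffX|exact: zdiff_jacp].
apply: zdiff_indep; apply: ccalcM; first exact: ccalc_cst.
exact: (ccalc_real (sta_calc n)).
Qed.

Lemma zdiff_Bcoef p r c : zdiff (fun w x => Bcoef p w x r c).
Proof.
have d : zdiff (fun w x => Bdiag p w x).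
  apply: zdiffD; last by apply: zdiffN; exact: zdiff_Hs.
  apply: zdiffM; last exact: zdiff_Gs.
  apply: zdiffM; first exact: zdiff_cst.
  apply: zdiffD; first exact: zdiff_id.
  by apply: zdiffN; apply: zdiff_indep; exact: (ccalc_real (stb_calc 1)).
case: r; case: c => //; rewrite /Bcoef.
- by apply: zdiffM; [exact: zdiff_cst|exact: zdiff_Gs].
- apply: zdiffN; apply: zdiffM; last exact: zdiff_Gs.
  apply: zdiff_indep; apply: ccalcM; first exact: ccalc_cst.
  by apply: ccalcM; exact: (ccalc_real (sta_calc 0)).
- exact: zdiffN.
Qed.

End SpectralDerivative.

Section Cocycle.
Variable R : realType.
Local Notation C := R[i].
Local Notation E := (int + int -> R).
Local Notation V := (bool -> C).
Implicit Types (J : jacobi R) (p q : {poly R}) (z : C).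

Definition flow p J t : E := raw (toda_flow p J t).

Lemma coord_flow p : diff_along (is_sol (toda_field p))
  (fun (al : int + int) (x : E) => x al).
Proof.
split; first exact: (@lip_coord _ _ _ id).
exists (fun al y => toda_field p y al); first exact: lip_toda_field.
by move=> y sy s al; exact: sy.
Qed.

Lemma ccont_flow p J (F : E -> C) :
  cdiff_along (is_sol (toda_field p)) (fun (_ : unit) x => F x) ->
  ccont (fun t => F (flow p J t)).
Proof.
move=> [[_ [D1 _ H1]] [_ [D2 _ H2]]].
have sf := toda_flow_is_sol p J; split=> t.
  exact: (drv_continuous (f := fun s => complex.Re (F (flow p J s))) (H1 _ sf t tt)).
exact: (drv_continuous (f := fun s => complex.Im (F (flow p J s))) (H2 _ sf t tt)).
Qed.

(** Columns of the Toda cocycle, as functions on bool. *)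
Definition vsol p J z (v : R -> V) := forall t r,
  cder (fun s => v s r) t (lin (Bcoef p z (flow p J t)) (v t) r).

Lemma Bcoef_bound p J z : exists2 K : R, 0 <= K &
  forall t r c, cn (Bcoef p z (flow p J t) r c) <= K.
Proof.
have [M HM] := toda_flow_locbnd p J.
have H r c : exists2 K : R, 0 <= K & forall x : E, bounded_by M x -> cn (Bcoef p z x r c) <= K.
  exact: ccalc_bound (zdiff_Bcoef z (coord_flow p) p r c).1.
have [K1 K10 H1] := H true true; have [K2 K20 H2] := H true false.
have [K3 K30 H3] := H false true; have [K4 K40 H4] := H false false.
exists (K1 + K2 + K3 + K4); first by rewrite !addr_ge0.
move=> t r c; have := H1 _ (HM t); have := H2 _ (HM t); have := H3 _ (HM t);
  have := H4 _ (HM t); case: r; case: c; rewrite /flow; lra.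
Qed.

Lemma vsol_exists p J z (v0 : V) : exists v, v 0 = v0 /\ vsol p J z v.
Proof.
have [K K0 HK] := Bcoef_bound p J z.
have [||||v [e0 dv]] := @lin_exists R (fun t => Bcoef p z (flow p J t)) (fun _ _ => 0) v0 K.
- exact: HK.
- by move=> *; rewrite cn0.
- by move=> r c; exact: (@ccont_flow p J (fun x => Bcoef p z x r c) (zdiff_Bcoef z (coord_flow p) p r c).1).
- by move=> r; split=> t; exact: cvg_cst.
exists v; split=> // t r; have := dv t r; rewrite addr0; exact.
Qed.

Lemma vsol_ccont p J z v : vsol p J z v -> forall r, ccont (fun t => v t r).
Proof. by move=> sv r; exact: ccont_cder (fun t => sv t r). Qed.

Lemma vsol_unique p J z v w : vsol p J z v -> vsol p J z w -> v 0 = w 0 -> v = w.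
Proof.
move=> sv sw vw0; apply/funext => t; apply/funext => r.
have [K K0 HK] := Bcoef_bound p J z.
apply/eqP; rewrite -subr_eq0; apply/eqP; apply: cn0_eq0.
have du (s : R) c : cder (fun s => v s c - w s c) s
    (lin (Bcoef p z (flow p J s)) (fun c => v s c - w s c) c + 0).
  by rewrite addr0 linB; exact: cderB (sv s c) (sw s c).
have := @lin_gronwall R (fun t => Bcoef p z (flow p J t))
  (fun t r => v t r - w t r) (fun _ _ => 0) K 0 `|t| K0 (lexx _).
move=> H; have := H _ _ _ _ _ t r (lexx _); rewrite mulr0 mul0r; apply.
- by move=> *; exact: HK.
- by move=> *; exact: du.
- by move=> c; rewrite vw0 subrr cn0.
- by move=> *; rewrite cn0.
- by move=> c; apply: ccont_cder => s; exact: du.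
Qed.

Definition col2 (T : 'M[C]_2) (j : 'I_2) : V := fun r => T (if r then 0 else 1) j.

Lemma ord2P (i : 'I_2) : i = if i == 0 then 0 else 1.
Proof. by case: i => -[|[]] // h; apply: val_inj. Qed.

Lemma mulmx_B p z J (T : 'M[C]_2) i j :
  (B_toda p z J *m T) i j = lin (Bcoef p z (raw J)) (col2 T j) (i == 0).
Proof.
rewrite B_todaE mxE !big_ord_recl big_ord0 addr0 /mx2 !mxE /lin /col2.
rewrite (_ : lift ord0 ord0 = 1); last exact: val_inj.
by rewrite [in LHS](ord2P i); case: (i == 0); rewrite /= ?eqxx.
Qed.

Lemma cocycle_solP p J z (T : R -> 'M[C]_2) : is_toda_cocycle_sol p J z T <->
  T 0 = 1%:M /\ forall j, vsol p J z (fun t => col2 (T t) j).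
Proof.
split=> -[T0 dT]; split=> //.
  move=> j t r; have := dT t (if r then 0 else 1) j.
  rewrite mulmx_B toda_scale -/(flow p J t) (_ : (_ == 0) = r)//; last by case: r.
move=> t i j; rewrite mulmx_B toda_scale -/(flow p J t).
have := dT j t (i == 0); rewrite /col2 -ord2P; exact.
Qed.

Lemma toda_cocycleP p J z : is_toda_cocycle_sol p J z (toda_cocycle_sol p J z).
Proof.
rewrite /toda_cocycle_sol; case: pselect => [ex|nex]; first by case: (cid ex).
case: nex.
have H (j : 'I_2) := vsol_exists p J z (fun r => ((if r then 0 else 1) == j)%:R).
have [v Hv] := choice H.
exists (fun t => \matrix_(i, j) v j t (i == 0)); apply/cocycle_solP; split.
  apply/matrixP => i j; rewrite !mxE (Hv j).1.
  by rewrite {2}(ord2P i); case: (i == 0).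
move=> j; have := (Hv j).2; congr vsol; apply/funext => t; apply/funext => r.
by rewrite /col2 mxE; case: r.
Qed.

Local Notation Tm := toda_cocycle_sol.

Lemma Tm0 p J z : Tm p J z 0 = 1%:M.
Proof. exact: (toda_cocycleP p J z).1. Qed.

Lemma Tm_col p J z j : vsol p J z (fun t => col2 (Tm p J z t) j).
Proof. exact: ((cocycle_solP _ _ _ _).1 (toda_cocycleP p J z)).2. Qed.

Lemma det2 (T : 'M[C]_2) : \det T = T 0 0 * T 1 1 - T 0 1 * T 1 0.
Proof.
rewrite (expand_det_row _ 0) !big_ord_recl big_ord0 addr0 /cofactor !det_mx11 !mxE.
rewrite (_ : lift 0 0 = 1 :> 'I_2); last exact: val_inj.
rewrite (_ : lift 1 0 = 0 :> 'I_2); last exact: val_inj.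
by rewrite /= addn0 expr0 mul1r addn1 expr1 mulN1r mulrN.
Qed.

(** B_p is traceless. *)
Lemma Tm_det p J z t : \det (Tm p J z t) = 1.
Proof.
have H (s : R) : cder (fun s => \det (Tm p J z s)) s 0.
  apply: (@cder_ext _ _ (fun s => Tm p J z s 0 0 * Tm p J z s 1 1
    - Tm p J z s 0 1 * Tm p J z s 1 0)); first by move=> u; exact: det2.
  have := cderB (cderM (Tm_col p J z 0 s true) (Tm_col p J z 1 s false))
    (cderM (Tm_col p J z 1 s true) (Tm_col p J z 0 s false)).
  by move/cder_eq; apply; rewrite /lin /col2 /Bcoef; ring.
by rewrite (cder_const H) Tm0 det1.
Qed.

Lemma Bcoef_real p (s : R) (x : E) r c : exists w : R, Bcoef p s%:C x r c = w%:C.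
Proof.
have G n : exists w : R, Gs p s%:C x n = w%:C.
  exists (\sum_(k < size p) p`_k * gsum k s (coef_a x) (coef_b x) n).
  rewrite rmorph_sum; apply: eq_bigr => k _; rewrite rmorphM; congr (_ * _).
  rewrite rmorph_sum; apply: eq_bigr => j _; by rewrite rmorphM rmorphXn jacpC.
have H n : exists w : R, Hs p s%:C x n = w%:C.
  exists (\sum_(k < size p) p`_k * hsum k s (coef_a x) (coef_b x) n).
  rewrite rmorph_sum; apply: eq_bigr => k _; rewrite rmorphM; congr (_ * _).
  rewrite /hsum rmorphD rmorphB rmorphXn !rmorphM rmorph_nat jacpC; congr (_ + _ * _).
  rewrite rmorph_sum; apply: eq_bigr => j _; by rewrite rmorphM rmorphXn jacpC.
have [g1 e1] := G 1; have [g0 e0] := G 0; have [h1 f1] := H 1.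
have d : Bdiag p s%:C x = (2 * (s - coef_b x 1) * g1 - h1)%:C.
  by rewrite /Bdiag e1 f1 rmorphB !rmorphM rmorphB rmorph_nat.
case: r; case: c; rewrite /Bcoef ?d ?e1 ?e0.
- by eexists.
- by exists (2 * g1); rewrite rmorphM rmorph_nat.
- by exists (- (2 * coef_a x 0 ^+ 2 * g0)); rewrite rmorphN !rmorphM rmorph_nat.
- by eexists; rewrite -rmorphN.
Qed.

(** For real z the coefficients are real, so the imaginary part of a column is
    itself a solution, with zero initial value. *)
Lemma Tm_real p J (s : R) t i j : complex.Im (Tm p J s%:C t i j) = 0.
Proof.
pose v t := col2 (Tm p J s%:C t) j.
pose w t (r : bool) : C := (complex.Im (v t r))%:C.
have sv : vsol p J s%:C v := Tm_col p J s%:C j.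
have sw : vsol p J s%:C w.
  move=> u r; apply: cder_eq (cder_real (sv u r).2) _.
  have [a ea] := Bcoef_real p s (flow p J u) r true.
  have [b eb] := Bcoef_real p s (flow p J u) r false.
  rewrite /lin ea eb cImD !cImM /= !mul0r !addr0 rmorphD !rmorphM.
  by rewrite /w.
have s0 : vsol p J s%:C (fun _ _ => 0).
  by move=> u r; apply: cder_eq (cder_cst 0 u) _; rewrite /lin !mulr0 addr0.
have w0 : w 0 = fun=> 0.
  apply/funext => r; rewrite /w /v Tm0 /col2 mxE.
  by case: (_ == _); rewrite //= ?mulr1n ?mulr0n.
have := congr1 (fun f => complex.Re (f t (i == 0))) (vsol_unique sw s0 w0).
by rewrite /w /v /col2 -ord2P.
Qed.

End Cocycle.

(** * Analyticity in the spectral parameter *)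

Section Entire.
Variable R : realType.
Local Notation C := R[i].
Implicit Types (w z h : C) (f g : C -> C).

Lemma norm_le_cn w : `|w| <= (cn w)%:C.
Proof.
case: w => a b; rewrite normc_def lecR /cn /= -[leRHS]ger0_norm ?addr_ge0//.
rewrite -sqrtr_sqr ler_wsqrtr// sqrrD -[a ^+ 2]real_normK ?num_real//.
rewrite -[b ^+ 2]real_normK ?num_real// -addrA lerD2l lerDr.
by rewrite mulrn_wge0// mulr_ge0.
Qed.

Lemma cn_le_norm w : (cn w)%:C <= 2 * `|w|.
Proof.
case: w => a b; rewrite normc_def /cn /=.
rewrite (_ : 2 * _ = (2 * Num.sqrt (a ^+ 2 + b ^+ 2))%:C); last first.
  by rewrite rmorphM rmorph_nat.
have h c d : `|c| <= Num.sqrt (c ^+ 2 + d ^+ 2) :> R.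
  by rewrite -sqrtr_sqr ler_wsqrtr// lerDl sqr_ge0.
have h1 := h a b; have h2 := h b a; rewrite [_ + a ^+ 2]addrC in h2.
by rewrite lecR; lra.
Qed.

Lemma derivable_quad f z (D : C) (K : R) :
  (forall h, cn h <= 1 -> cn (f (z + h) - f z - h * D) <= K * cn h ^+ 2) ->
  derivable (f : C^o -> C^o) z 1.
Proof.
move=> H; apply: (cvgP (D : C^o)); apply/cvgrPdist_le => e e0.
have [r er r0] : exists2 r : R, e = r%:C & 0 < r.
  move: e0; case: e => a b; rewrite ltcE /= => /andP[/eqP b0 a0].
  by exists a; rewrite // b0.
pose s := Num.min (2^-1) (r / (4 * (`|K| + 1))).
have s0 : 0 < s.
  by rewrite lt_min invr_gt0 ltr0n/= divr_gt0// mulr_gt0// ltr_wpDl.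
exists s%:C; first by rewrite /= ltcR.
move=> h /=; rewrite sub0r normrN => hs h0.
have nh : exists2 n : R, `|h| = n%:C & 0 < n.
  have : 0 < `|h| by rewrite normr_gt0.
  by case: h {hs h0} => a b; rewrite normc_def ltcR => ?; eexists.
have [n hn n0] := nh.
have ns : n < s by move: hs; rewrite hn ltcR.
have ch : cn h <= 2 * n.
  have := cn_le_norm h; rewrite hn (_ : 2 * n%:C = (2 * n)%:C) ?lecR//.
  by rewrite rmorphM rmorph_nat.
have n1 : n < 2^-1 by move: ns; rewrite lt_min => /andP[].
have nr : n < r / (4 * (`|K| + 1)) by move: ns; rewrite lt_min => /andP[].
have /H h2 : cn h <= 1 by lra.
rewrite -[X in X - _](mulKf h0) -mulrBr normrM normfV hn.
rewrite /GRing.scale/= mulr1 [h + z]addrC.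
rewrite distrC er ler_pdivrMl ?ltcR//.
apply: (le_trans (norm_le_cn _)); rewrite -rmorphM lecR (le_trans h2)//.
have c2 : cn h ^+ 2 <= 4 * n ^+ 2.
  by rewrite (_ : 4 * _ = (2 * n) ^+ 2); [rewrite ler_sqr ?nnegrE ?cn_ge0// mulr_ge0// ltW|ring].
have n2 : 0 <= n ^+ 2 by rewrite sqr_ge0.
apply: (@le_trans _ _ ((`|K| + 1) * (4 * n ^+ 2))).
  apply: (@le_trans _ _ ((`|K| + 1) * cn h ^+ 2)).
    by rewrite ler_wpM2r ?sqr_ge0// (le_trans (ler_norm _))// lerDl.
  by rewrite ler_wpM2l// addr_ge0.
rewrite expr2 [leLHS](_ : _ = n * (n * (4 * (`|K| + 1)))); last by ring.
by rewrite ler_wpM2l ?(ltW n0)// -ler_pdivlMr ?(ltW nr)// mulr_gt0// ltr_wpDl.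
Qed.

Lemma entireD f g : entire f -> entire g -> entire (fun z => f z + g z).
Proof. by move=> ef eg z; exact: (derivableD (ef z) (eg z)). Qed.

Lemma entireM f g : entire f -> entire g -> entire (fun z => f z * g z).
Proof. by move=> ef eg z; exact: (derivableM (ef z) (eg z)). Qed.

Lemma entireN f : entire f -> entire (fun z => - f z).
Proof. by move=> ef z; exact: (derivableN (ef z)). Qed.

Lemma entire_cst (c : C) : entire (fun=> c).
Proof. by move=> z; exact: (@derivable_cst C C^o C^o). Qed.

Lemma entire_id : entire (fun z : C => z).
Proof. by move=> z; exact: (@derivable_id C C^o). Qed.

End Entire.

Section TodaEntire.
Variable R : realType.
Local Notation C := R[i].
Local Notation E := (int + int -> R).
Local Notation Tm := toda_cocycle_sol.

(** With D the solution of the linearized equation, the error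
    T(z + h) - T(z) - h D solves the equation at z + h with a source of order h^2
    and zero initial value, so it is O(h^2) by Gronwall. *)
Lemma Tm_entire (p : {poly R}) J i j : entire (fun z => Tm p J z 1 i j).
Proof.
move=> z.
have [M HM] := toda_flow_locbnd p J.
have zd r c := (zdiff_Bcoef z (coord_flow p) p r c).2.
have [B' HB'] : exists B' : bool -> bool -> E -> C, forall r c,
    cdiff_along (is_sol (toda_field p)) (fun (_ : unit) x => B' r c x) /\
    exists2 K : R, 0 <= K & forall x h, bounded_by M x -> cn h <= 1 ->
      [/\ cn (Bcoef p z x r c) <= K, cn (B' r c x) <= K &
          cn (Bcoef p (z + h) x r c - Bcoef p z x r c - h * B' r c x) <= K * cn h ^+ 2].
  have [F11 h11 k11] := zd true true; have [F12 h12 k12] := zd true false.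
  have [F21 h21 k21] := zd false true; have [F22 h22 k22] := zd false false.
  exists (fun r c => if r then if c then F11 else F12 else if c then F21 else F22).
  by case; case.
have [K K0 HK] : exists2 K : R, 0 <= K & forall r c x h, bounded_by M x -> cn h <= 1 ->
    [/\ cn (Bcoef p z x r c) <= K, cn (B' r c x) <= K &
        cn (Bcoef p (z + h) x r c - Bcoef p z x r c - h * B' r c x) <= K * cn h ^+ 2].
  have [_ [K1 K10 H1]] := HB' true true; have [_ [K2 K20 H2]] := HB' true false.
  have [_ [K3 K30 H3]] := HB' false true; have [_ [K4 K40 H4]] := HB' false false.
  exists (K1 + K2 + K3 + K4); first by rewrite !addr_ge0.
  move=> r c x h bx ch; have h20 := sqr_ge0 (cn h).
  have up (k : R) (a b d : C) : k <= K1 + K2 + K3 + K4 ->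
      [/\ cn a <= k, cn b <= k & cn d <= k * cn h ^+ 2] ->
      [/\ cn a <= K1 + K2 + K3 + K4, cn b <= K1 + K2 + K3 + K4 &
          cn d <= (K1 + K2 + K3 + K4) * cn h ^+ 2].
    move=> kK [a1 a2 a3]; split; [exact: le_trans kK|exact: le_trans kK|].
    by rewrite (le_trans a3)// ler_wpM2r.
  case: r; case: c.
  - by apply: (up K1); [lra|exact: H1].
  - by apply: (up K2); [lra|exact: H2].
  - by apply: (up K3); [lra|exact: H3].
  - by apply: (up K4); [lra|exact: H4].
pose v t := col2 (Tm p J z t) j.
have sv : vsol p J z v := Tm_col p J z j.
pose m t := Bcoef p z (flow p J t).
pose m' t r c := B' r c (flow p J t).
have cm r c : ccont (fun t => m t r c).
  exact: (@ccont_flow _ p J (fun x => Bcoef p z x r c) (zdiff_Bcoef z (coord_flow p) p r c).1).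
have cm' r c : ccont (fun t => m' t r c).
  exact: (@ccont_flow _ p J (B' r c) (HB' r c).1).
have cl r : ccont (fun t => lin (m' t) (v t) r).
  by apply: ccontD; apply: ccontM => //; exact: vsol_ccont sv _.
have cclip : continuous (clip (2 : R)).
  move=> t; apply/cvgrPdist_le => e e0; exists e => //= s ts.
  by rewrite (le_trans (clip_lip _ _ _))// ltW.
have [Kg Kg0 HKg] : exists2 Kg : R, 0 <= Kg & forall t r, `|t| <= 2 ->
    cn (lin (m' t) (v t) r) <= Kg.
  have [k1 k10 h1] := ccont_bounded 2 (cl true).
  have [k2 k20 h2] := ccont_bounded 2 (cl false).
  exists (k1 + k2) => [|t r t2]; first exact: addr_ge0.
  case: r; [have := h1 t t2|have := h2 t t2]; lra.
have flowM t : bounded_by M (flow p J t) := HM t.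
(* D is the candidate for the derivative in z: it solves the linearized equation,
   with the source frozen outside [-2, 2] to keep it bounded *)
have [||||D [D0 dD]] := @lin_exists R m
    (fun t r => lin (m' (clip 2 t)) (v (clip 2 t)) r) (fun=> 0) (K + Kg).
- move=> t r c; have [h _ _] := HK r c _ 0 (flowM t) (ltac:(by rewrite cn0)).
  by rewrite (le_trans h)// lerDl.
- by move=> t r; rewrite (le_trans (HKg _ _ _)) ?lerDr// clip_le.
- exact: cm.
- by move=> r; exact: (ccont_comp (cl r) cclip).
have cD r : ccont (fun t => D t r) by apply: ccont_cder => t; exact: dD.
have [Kv Kv0 HKv] : exists2 Kv : R, 0 <= Kv & forall t r, `|t| <= 1 ->
    cn (v t r) <= Kv /\ cn (D t r) <= Kv.
  have [k1 k10 h1] := ccont_bounded 1 (vsol_ccont sv true).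
  have [k2 k20 h2] := ccont_bounded 1 (vsol_ccont sv false).
  have [k3 k30 h3] := ccont_bounded 1 (cD true).
  have [k4 k40 h4] := ccont_bounded 1 (cD false).
  exists (k1 + k2 + k3 + k4) => [|t r t1]; first by rewrite !addr_ge0.
  have := h1 t t1; have := h2 t t1; have := h3 t t1; have := h4 t t1.
  by case: r; split; lra.
pose G := 6 * K * Kv.
have G0 : 0 <= G by rewrite !mulr_ge0.
apply: (@derivable_quad _ _ _ (D 1 (i == 0)) (6 * G * expR (2 * (4 * (3 * K) + 1) * 1))).
move=> h ch.
have h20 := sqr_ge0 (cn h).
have hh : cn h ^+ 2 <= cn h by rewrite expr2 ler_piMl ?cn_ge0.
pose mh t := Bcoef p (z + h) (flow p J t).
pose vh t := col2 (Tm p J (z + h) t) j.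
have svh : vsol p J (z + h) vh := Tm_col p J (z + h) j.
pose e t r := vh t r - v t r - h * D t r.
pose g t r := lin (fun r c => mh t r c - m t r c - h * m' t r c) (v t) r +
  h * lin (fun r c => mh t r c - m t r c) (D t) r.
have dmh t r c : cn (mh t r c - m t r c) <= 2 * K * cn h.
  have [_ h2 h3] := HK r c _ h (flowM t) ch.
  rewrite -(subrK (h * m' t r c) (_ - _)) (le_trans (cnD _ _))//.
  have h4 : cn (h * m' t r c) <= cn h * K.
    by rewrite (le_trans (cnM _ _))// ler_wpM2l ?cn_ge0.
  have := lerD h3 h4; have := ler_wpM2l K0 hh; rewrite -/(mh t) -/(m t); lra.
have mh3 t r c : `|t| <= 1 -> cn (mh t r c) <= 3 * K.
  move=> _; have [h1 _ _] := HK r c _ h (flowM t) ch.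
  rewrite -(subrK (m t r c) (mh t r c)) (le_trans (cnD _ _))//.
  have := dmh t r c; have := ler_wpM2l K0 ch; rewrite -/(m t) in h1; lra.
have de (t : R) r : `|t| <= 1 -> cder (fun s => e s r) t (lin (mh t) (e t) r + g t r).
  move=> t1; have t2 : `|t| <= 2 by rewrite (le_trans t1)// ler1n.
  have := cderB (cderB (svh t r) (sv t r)) (cderZ h (dD t r)).
  by move/cder_eq; apply; rewrite clip_id// /e /g /lin -/(mh t) -/(m t); ring.
have e0 r : cn (e 0 r) <= G * cn h ^+ 2.
  rewrite /e D0 mulr0 subr0 /vh /v !Tm0 subrr cn0.
  exact: mulr_ge0.
have gb t r : `|t| <= 1 -> cn (g t r) <= G * cn h ^+ 2.
  move=> t1; rewrite /g (le_trans (cnD _ _))//.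
  have b1 : cn (lin (fun r c => mh t r c - m t r c - h * m' t r c) (v t) r) <=
      2 * (K * cn h ^+ 2) * Kv.
    apply: cn_lin => [r' c|c]; last exact: (HKv t c t1).1.
    by have [_ _ h3] := HK r' c _ h (flowM t) ch.
  have b2 : cn (lin (fun r c => mh t r c - m t r c) (D t) r) <=
      2 * (2 * K * cn h) * Kv.
    by apply: cn_lin => [r' c|c]; [exact: dmh|exact: (HKv t c t1).2].
  have b3 := le_trans (cnM h _) (ler_wpM2l (cn_ge0 h) b2).
  rewrite (le_trans (lerD b1 b3))// /G expr2.
  by apply: le_of_eq; ring.
have ce r : ccont (fun t => e t r).
  have ch' : ccont (fun t => - h * D t r).
    by apply: ccontM => //; split=> t; exact: cvg_cst.
  have cv' : ccont (fun t => - 1 * v t r).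
    by apply: ccontM; [split=> t; exact: cvg_cst|exact: vsol_ccont sv _].
  have := ccontD (ccontD (vsol_ccont svh r) cv') ch'.
  by congr ccont; apply/funext => t; rewrite /e mulN1r mulNr.
have K30 : 0 <= 3 * K by rewrite mulr_ge0.
have d0 : 0 <= G * cn h ^+ 2 by exact: mulr_ge0.
have := @lin_gronwall R mh e g (3 * K) (G * cn h ^+ 2) 1 K30 d0
  (fun t r c t1 => mh3 t r c t1) de e0 gb ce 1 (i == 0).
rewrite normr1 => /(_ (lexx _)).
rewrite /e /vh /v /col2 -ord2P => /le_trans; apply.
by apply: le_of_eq; ring.
Qed.

End TodaEntire.

(** * Eigensolutions along the flows *)

Section Eigensolutions.
Variable R : realType.
Local Notation C := R[i].
Local Notation E := (int + int -> R).
Implicit Types (p q : {poly R}) (z : C) (x : E) (u : int -> C).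

Definition cast (X : int -> int -> R) (i j : int) : C := (X i j)%:C.

Lemma banded_cast N X : banded N X -> banded N (cast X).
Proof. by move=> bX i j ij; rewrite /cast bX. Qed.

Lemma cast_bmul N X Y : banded N X -> bmul (cast X) (cast Y) =2 cast (bmul X Y).
Proof.
move=> bX i j; rewrite (bmul_win _ _ _ (banded_cast bX)) /cast (bmul_win _ _ _ bX).
by rewrite rmorph_sum; apply: eq_bigr => l _; rewrite rmorphM.
Qed.

Lemma cast_tri (a b : int -> R) :
  tri (fun n => (a n)%:C) (fun n => (b n)%:C) =2 cast (tri a b).
Proof. by move=> i j; exact: (jacpC a b 1). Qed.

Lemma cast_anti X : anti (cast X) =2 cast (anti X).
Proof.
by move=> i j; rewrite /anti /cast; case: ifP => // _; case: ifP => // _; rewrite rmorphN.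
Qed.

(** A real banded matrix acting on complex sequences; these may grow
    arbitrarily, as eigensolutions do. *)
Definition act X u n : C := bvec (cast X) u n.

Lemma eq_act X Y u n : X =2 Y -> act X u n = act Y u n.
Proof. by move=> XY; apply: eq_bmul => // i j; rewrite /cast XY. Qed.

Lemma actA N M X Y u : banded N X -> banded M Y ->
  act X (act Y u) =1 act (bmul X Y) u.
Proof.
move=> bX bY n; rewrite /act (bvecA _ (banded_cast bX) (banded_cast bY)).
by apply: eq_bmul => // i j; rewrite (cast_bmul _ bX).
Qed.

Lemma act_win N X u n : banded N X ->
  act X u n = \sum_(l <- win N n) (X n l)%:C * u l.
Proof. by move=> bX; rewrite /act /bvec (bmul_win _ _ _ (banded_cast bX)). Qed.

Lemma actB N M X Y u n : banded N X -> banded M Y ->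
  act (fun i j => X i j - Y i j) u n = act X u n - act Y u n.
Proof.
move=> bX bY; rewrite -(bmulBl _ (banded_cast bX) (banded_cast bY)).
by apply: eq_bmul => // i j; rewrite /cast rmorphB.
Qed.

Lemma actZr N X u n (c : C) : banded N X ->
  act X (fun l => c * u l) n = c * act X u n.
Proof. by move=> bX; rewrite /act /bvec -(bmulZr _ _ (banded_cast bX)). Qed.

Lemma act_tri x u n : act (tri (coef_a x) (coef_b x)) u n = jop (coef_aC x) (coef_bC x) u n.
Proof.
rewrite -(bvec_tri (coef_aC x) (coef_bC x) u n).
by apply: eq_bmul => // i j; rewrite -cast_tri.
Qed.

Local Notation gen p x := (toda_gen p (coef_a x) (coef_b x)).
Local Notation pol p x := (polym p (coef_a x) (coef_b x)).

Definition eigen z x u := forall n, jop (coef_aC x) (coef_bC x) u n = z * u n.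

(** On the eigensolutions of J, the operator p(J)_a acts as a first-order
    difference operator, and this is where G_p and H_p come from. *)
Lemma act_gen p z x u n : eigen z x u ->
  act (gen p x) u n = 2 * coef_aC x n * Gs p z x n * u (n + 1) - Hs p z x n * u n.
Proof.
move=> Ju; rewrite (act_win _ _ (@banded_gen _ _ _ _)).
transitivity (\sum_(k < size p) (p`_k)%:C * bvec (anti (jacp (coef_aC x) (coef_bC x) k)) u n).
  transitivity (\sum_(l <- win (size p) n) \sum_(k < size p)
      (p`_k)%:C * (anti (jacp (coef_aC x) (coef_bC x) k) n l * u l)).
    apply: eq_bigr => l _.
    have -> : (gen p x n l)%:C =
        \sum_(k < size p) (p`_k)%:C * anti (jacp (coef_aC x) (coef_bC x) k) n l.
      rewrite -[LHS]/(cast (anti (pol p x)) n l) -cast_anti /anti /cast.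
      case: ifP => _; last case: ifP => _.
      - by rewrite rmorph_sum; apply: eq_bigr => k _; rewrite rmorphM jacpC.
      - rewrite rmorph_sum -sumrN; apply: eq_bigr => k _.
        by rewrite rmorphM jacpC mulrN.
      - by rewrite big1// => k _; rewrite mulr0.
    by rewrite mulr_suml; apply: eq_bigr => k _; rewrite mulrA.
  rewrite exchange_big; apply: eq_bigr => k _; rewrite -mulr_sumr; congr (_ * _).
  rewrite /bvec (@bmul_win _ (size p))//.
  apply: banded_le (banded_anti (@banded_jacp _ _ _ _)); exact: ltnW.
rewrite /Gs /Hs mulr_sumr !mulr_suml -sumrB; apply: eq_bigr => k _.
by rewrite (bvec_anti_jacp _ Ju); ring.
Qed.

Lemma Gs_Hs p z x n : 2 * (z - coef_bC x n) * Gs p z x n =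
  Hs p z x n + Hs p z x (n - 1) - (pol p x n n)%:C + (pol p x (n - 1) (n - 1))%:C.
Proof.
rewrite /polym /pmx !rmorph_sum -sumrN -!big_split mulr_sumr; apply: eq_bigr => k _.
by rewrite /= mulrCA gsum_hsum !rmorphM /= -!jacpC; ring.
Qed.

(** The coordinates on the two-dimensional space of eigensolutions in which
    q(J)_a becomes B_q. *)
Definition eigen_data x u (r : bool) : C := if r then u 1 else - (coef_aC x 0 * u 0).

Lemma field_true p z x u : eigen z x u ->
  lin (Bcoef p z x) (eigen_data x u) true = act (gen p x) u 1.
Proof.
move=> Ju; rewrite (act_gen _ _ Ju) /lin /eigen_data /Bcoef /Bdiag.
have := Ju 1; rewrite /jop => /eqP; rewrite -subr_eq0 => /eqP e.
have := congr1 (fun w => 2 * Gs p z x 1 * w) e; rewrite mulr0 (_ : (1 : int) - 1 = 0)// => {}e.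
by apply/eqP; rewrite -subr_eq0; apply/eqP; rewrite -[RHS]oppr0 -[in RHS]e; ring.
Qed.

Lemma field_false p z x u : eigen z x u ->
  lin (Bcoef p z x) (eigen_data x u) false =
  - ((toda_field p x (inl 0))%:C * u 0 + coef_aC x 0 * act (gen p x) u 0).
Proof.
move=> Ju; rewrite (act_gen _ _ Ju) /lin /eigen_data /Bcoef /Bdiag toda_fieldE.
have := Gs_Hs p z x 1; rewrite (_ : (1 : int) - 1 = 0)// => ->.
by rewrite (_ : (0 : int) + 1 = 1)// rmorphM rmorphB -/(coef_aC x 0); ring.
Qed.

Section Extension.
Variables (z : C) (x : E) (u0 u1 : C).

Fixpoint ext_fw (k : nat) : C * C :=
  if k is l.+1 then
    let: (s, t) := ext_fw l in
    (t, ((z - coef_bC x (l%:Z + 1)) * t - coef_aC x l * s) / coef_aC x (l%:Z + 1))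
  else (u0, u1).

Fixpoint ext_bw (k : nat) : C * C :=
  if k is l.+1 then
    let: (s, t) := ext_bw l in
    (((z - coef_bC x (- l%:Z)) * s - coef_aC x (- l%:Z) * t) / coef_aC x (- l%:Z - 1), s)
  else (u0, u1).

(** The eigensolution with values u0 at 0 and u1 at 1, by the three-term
    recursion in both directions. *)
Definition ext (n : int) : C :=
  match n with Posz k => (ext_fw k).1 | Negz k => (ext_bw k.+1).1 end.

Lemma ext_eigen : (forall n, coef_aC x n != 0) -> eigen z x ext.
Proof.
move=> a0.
have fw k : (ext_fw k).2 = (ext_fw k.+1).1 by rewrite /=; case: (ext_fw k).
have bw k : (ext_bw k).1 = (ext_bw k.+1).2 by rewrite /=; case: (ext_bw k).
have bwE k : ext (- k%:Z) = (ext_bw k).1 by case: k.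
have fwE k : ext k%:Z = (ext_fw k).1 by [].
move=> n; rewrite /jop; have [|n0] := leP 1 n.
  case: n => // -[//|k] _; rewrite (_ : Posz k.+1 + 1 = k.+2%:Z); last by lia.
  rewrite (_ : Posz k.+1 - 1 = k%:Z); last by lia.
  rewrite !fwE -fw /=; have : (ext_fw k).1 = (ext_fw k).1 by [].
  rewrite (_ : k.+1%:Z = k%:Z + 1); last by lia.
  by case: (ext_fw k) => s t /= _; field; exact: a0.
have [k ->] : exists k : nat, n = - k%:Z by exists (absz n); lia.
rewrite (_ : - k%:Z - 1 = - k.+1%:Z); last by lia.
rewrite !bwE (_ : ext (- k%:Z + 1) = (ext_bw k).2); last first.
  case: k => [|k]; first by [].
  by rewrite -bw -bwE; congr ext; lia.
rewrite /= (_ : - k.+1%:Z = - k%:Z - 1); last by lia.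
by case: (ext_bw k) => s t /=; field; exact: a0.
Qed.

End Extension.

Section Evolution.
Variables (q : {poly R}) (z : C) (x : R -> E) (u : R -> int -> C).
Hypothesis sx : is_sol (toda_field q) x.
Hypothesis xpos : forall s n, 0 < coef_a (x s) n.
Hypothesis Ju : forall s, eigen z (x s) (u s).
Hypothesis dv : forall (t : R) r, cder (fun s => eigen_data (x s) (u s) r) t
  (lin (Bcoef q z (x t)) (eigen_data (x t) (u t)) r).

Let Q t := gen q (x t).
Let bQ t : banded (size q) (Q t) := @banded_gen _ _ _ _.

Let ca_neq0 s n : coef_aC (x s) n != 0.
Proof. by rewrite fmorph_eq0 gt_eqF. Qed.

Let dca (t : R) n : cder (fun s => coef_aC (x s) n) t (toda_field q (x t) (inl n))%:C.
Proof. exact: cder_real (sx t (inl n)). Qed.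

Let dcb (t : R) n : cder (fun s => coef_bC (x s) n) t (toda_field q (x t) (inr n))%:C.
Proof. exact: cder_real (sx t (inr n)). Qed.

Let dcaV (t : R) n : cder (fun s => (coef_aC (x s) n)^-1) t
  (- (toda_field q (x t) (inl n))%:C / coef_aC (x t) n ^+ 2).
Proof.
have := cder_real (is_deriveV (f := fun s => coef_a (x s) n) (lt0r_neq0 (xpos t n))
  (sx t (inl n))).
move=> H; apply: (@cder_ext _ _ (fun s => ((coef_a (x s) n)^-1)%:C)).
  by move=> s; rewrite fmorphV.
apply: cder_eq H _; rewrite /GRing.scale/= rmorphM rmorphN fmorphV rmorphXn /=.
by rewrite -/(coef_aC (x t) n) mulNr [in RHS]mulNr mulrC.
Qed.

Let lin_eigen (t : R) n :
  jop (coef_aC (toda_field q (x t))) (coef_bC (toda_field q (x t))) (u t) n +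
  jop (coef_aC (x t)) (coef_bC (x t)) (act (Q t) (u t)) n = z * act (Q t) (u t) n.
Proof.
have bT := @banded_tri R (coef_a (x t)) (coef_b (x t)).
rewrite -!act_tri -(eq_act _ _ (@lax_tri _ q (x t))).
rewrite /lax /comm (actB _ _ (banded_mul (bQ t) bT) (banded_mul bT (bQ t))).
rewrite -(actA _ (bQ t) bT) -(actA _ bT (bQ t)) subrK -(actZr _ _ _ (bQ t)).
have -> // : act (tri (coef_a (x t)) (coef_b (x t))) (u t) = fun l => z * u t l.
by apply/funext => l; rewrite act_tri Ju.
Qed.

Let djop (t : R) n (d d' d'' : C) : cder (fun s => u s (n + 1)) t d ->
  cder (fun s => u s (n - 1)) t d' -> cder (fun s => u s n) t d'' ->
  coef_aC (toda_field q (x t)) n * u t (n + 1) + coef_aC (x t) n * d +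
  (coef_aC (toda_field q (x t)) (n - 1) * u t (n - 1) + coef_aC (x t) (n - 1) * d') +
  (coef_bC (toda_field q (x t)) n * u t n + coef_bC (x t) n * d'') = z * d''.
Proof.
move=> h h' h''.
have H := cderD (cderD (cderM (dca t n) h) (cderM (dca t (n - 1)) h'))
  (cderM (dcb t n) h'').
apply: (@cder_unique _ (fun s => z * u s n) t); last exact: cderZ.
apply: (@cder_ext _ _ (fun s => coef_aC (x s) n * u s (n + 1) +
  coef_aC (x s) (n - 1) * u s (n - 1) + coef_bC (x s) n * u s n)).
  by move=> s; rewrite -[LHS]Ju.
by apply: cder_eq H _; rewrite /coef_aC /coef_bC /coef_a /coef_b; ring.
Qed.

Let P n := forall t : R, cder (fun s => u s n) t (act (Q t) (u t) n).

Let step_up n : P (n - 1) -> P n -> P (n + 1).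
Proof.
move=> h' h'' t.
have [d hd] : exists d, cder (fun s => u s (n + 1)) t d.
  have := cderM (cderB (cderB (cderZ z (h'' t)) (cderM (dca t (n - 1)) (h' t)))
    (cderM (dcb t n) (h'' t))) (dcaV t n).
  set d := (X in cder _ _ X); move=> H; exists d; apply: cder_ext H => s.
  by have := Ju s n; rewrite /jop => <-; field; exact: ca_neq0.
apply: (cder_eq hd).
have := djop hd (h' t) (h'' t); rewrite -(lin_eigen t n) /jop => /eqP.
rewrite -subr_eq0 (_ : _ - _ = coef_aC (x t) n * (d - act (Q t) (u t) (n + 1))); last by ring.
by rewrite mulf_eq0 (negbTE (ca_neq0 _ _)) /= subr_eq0 => /eqP.
Qed.

Let step_dn n : P (n + 1) -> P n -> P (n - 1).
Proof.
move=> h' h'' t.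
have [d hd] : exists d, cder (fun s => u s (n - 1)) t d.
  have := cderM (cderB (cderB (cderZ z (h'' t)) (cderM (dca t n) (h' t)))
    (cderM (dcb t n) (h'' t))) (dcaV t (n - 1)).
  set d := (X in cder _ _ X); move=> H; exists d; apply: cder_ext H => s.
  by have := Ju s n; rewrite /jop => <-; field; exact: ca_neq0.
apply: (cder_eq hd).
have := djop (h' t) hd (h'' t); rewrite -(lin_eigen t n) /jop => /eqP.
rewrite -subr_eq0 (_ : _ - _ = coef_aC (x t) (n - 1) * (d - act (Q t) (u t) (n - 1))); last by ring.
by rewrite mulf_eq0 (negbTE (ca_neq0 _ _)) /= subr_eq0 => /eqP.
Qed.

(** Differentiating J u = z u and inserting the Lax equation shows that
    u' - q(J)_a u is again an eigensolution; it vanishes at 0 and 1 by hypothesis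
    and therefore everywhere. So B_q is q(J)_a on eigensolutions. *)
Lemma eigen_evolution n (t : R) : cder (fun s => u s n) t (act (Q t) (u t) n).
Proof.
have P1 : P 1 by move=> s; rewrite -(field_true q (Ju s)); exact: (dv s true).
have P0 : P 0.
  move=> s; have := cderN (cderM (dcaV s 0) (dv s false)).
  move=> H; apply: (@cder_ext _ _ (fun w => - ((coef_aC (x w) 0)^-1 * eigen_data (x w) (u w) false))).
    by move=> w; rewrite /eigen_data; field; exact: ca_neq0.
  apply: cder_eq H _; rewrite (field_false q (Ju s)) /eigen_data.
  by field; exact: ca_neq0.
have up k : P k%:Z /\ P (k%:Z + 1).
  elim: k => [|k [h h']]; first by rewrite add0r.
  rewrite (_ : k.+1%:Z = k%:Z + 1); last by lia.
  by split=> //; apply: step_up => //; rewrite addrK.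
have dn k : P (- k%:Z) /\ P (- k%:Z + 1).
  elim: k => [|k [h h']]; first by rewrite oppr0 add0r.
  rewrite (_ : - k.+1%:Z = - k%:Z - 1); last by lia.
  by split; [exact: step_dn|rewrite subrK].
have [k [->|->]] : exists k : nat, n = k%:Z \/ n = - k%:Z by exists (absz n); lia.
  exact: (up k).1.
exact: (dn k).1.
Qed.

End Evolution.

Section Variation.
Variables (p q : {poly R}).

(** Derivatives along the flow of q of p(J)_a, of [p(J)_a, J], and of p(J)_a u
    for an eigensolution u. *)
Definition dgen x := anti (comm (gen q x) (pol p x)).

Definition dlax x (i j : int) : R :=
  comm (dgen x) (tri (coef_a x) (coef_b x)) i j + comm (gen p x) (lax q (coef_a x) (coef_b x)) i j.

Definition dact x u n : C := act (dgen x) u n + act (gen p x) (act (gen q x) u) n.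

Lemma banded_dgen x : banded (size p + size q) (dgen x).
Proof.
rewrite addnC; apply: banded_anti; apply: banded_comm; first exact: banded_gen.
exact: banded_pmx.
Qed.

Lemma deriv_pol (x : R -> E) (t : R) i j : is_sol (toda_field q) x ->
  is_derive t 1 (fun s => pol p (x s) i j) (comm (gen q (x t)) (pol p (x t)) i j).
Proof.
move=> sx; rewrite /polym (comm_pmx _ _ _ _ _ _ (@banded_gen _ _ _ _)) /pmx.
apply: drv_sum => k; apply: drvZ.
apply: (deriv_jacp (@banded_gen _ q _ _)) (@lax_tri _ q (x t)) _ _ _.
  by move=> m; exact: sx.
by move=> m; exact: sx.
Qed.

Lemma deriv_gen (x : R -> E) (t : R) i j : is_sol (toda_field q) x ->
  is_derive t 1 (fun s => gen p (x s) i j) (dgen (x t) i j).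
Proof.
move=> sx; rewrite /toda_gen /dgen /anti; case: ifP => _; first exact: deriv_pol.
by case: ifP => _; [apply: drvN; exact: deriv_pol|exact: drv_cst].
Qed.

Lemma deriv_lax (x : R -> E) (t : R) i j : is_sol (toda_field q) x ->
  is_derive t 1 (fun s => lax p (coef_a (x s)) (coef_b (x s)) i j) (dlax (x t) i j).
Proof.
move=> sx; pose N := (size p + size q)%N.
have bP y : banded N (gen p y) by apply: banded_le (@banded_gen _ _ _ _); exact: leq_addr.
have bD y : banded N (dgen y) by exact: banded_dgen.
have dJ l m : is_derive t 1 (fun s => tri (coef_a (x s)) (coef_b (x s)) l m)
    (lax q (coef_a (x t)) (coef_b (x t)) l m).
  have H := @deriv_jacp _ _ _ (fun s => coef_a (x s)) (fun s => coef_b (x s))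
    _ _ t (@banded_gen _ q _ _) (fun m => sx t (inl m)) (fun m => sx t (inr m))
    (@lax_tri _ q (x t)) 1 l m.
  by apply: is_derive_eq H _; rewrite /lax /comm; congr (_ - _); apply: eq_bmul.
have HE : (fun s => lax p (coef_a (x s)) (coef_b (x s)) i j) = fun s =>
    \sum_(l <- win N i) gen p (x s) i l * tri (coef_a (x s)) (coef_b (x s)) l j -
    \sum_(l <- win N j) tri (coef_a (x s)) (coef_b (x s)) i l * gen p (x s) l j.
  by apply/funext => s; rewrite /lax /comm (bmul_win _ _ _ (bP _)) (bmul_winr _ _ _ (bP _)).
rewrite HE.
have := drvB
  (drv_sum (win N i) xpredT (fun l => drvM (deriv_gen t i l sx) (dJ l j)))
  (drv_sum (win N j) xpredT (fun l => drvM (dJ i l) (deriv_gen t l j sx))).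
move/is_derive_eq; apply; rewrite /dlax /comm.
rewrite !(bmul_win _ _ _ (bP _)) !(bmul_winr _ _ _ (bP _)).
rewrite !(bmul_win _ _ _ (bD _)) !(bmul_winr _ _ _ (bD _)).
rewrite !big_split/=.
under [X in _ + X - _ = _]eq_bigr do rewrite mulrC.
under [X in _ - (_ + X) = _]eq_bigr do rewrite mulrC.
ring.
Qed.

Lemma deriv_act (x : R -> E) (u : R -> int -> C) (t : R) n :
  is_sol (toda_field q) x ->
  (forall m, cder (fun s => u s m) t (act (gen q (x t)) (u t) m)) ->
  cder (fun s => act (gen p (x s)) (u s) n) t (dact (x t) (u t) n).
Proof.
move=> sx du; pose N := (size p + size q)%N.
have bP y : banded N (gen p y) by apply: banded_le (@banded_gen _ _ _ _); exact: leq_addr.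
apply: (@cder_ext _ _ (fun s => \sum_(l <- win N n) (gen p (x s) n l)%:C * u s l)).
  by move=> s; rewrite (act_win _ _ (bP _)).
have H := cder_sum (win N n) (fun l => cderM (cder_real (deriv_gen t n l sx)) (du l)).
apply: cder_eq H _; rewrite /dact (act_win _ _ (bP _)) (act_win _ _ (@banded_dgen _)).
by rewrite -big_split/=; apply: eq_bigr => l _; rewrite addrC.
Qed.

End Variation.

Lemma dgen_sym p q x i j :
  dgen p q x i j - dgen q p x i j = comm (gen q x) (gen p x) i j.
Proof.
pose N := maxn (size p) (size q).
apply: (@zero_curvature _ N).
- by apply: banded_le (@banded_pmx _ _ _ _ _); exact: leq_maxr.
- by apply: banded_le (@banded_pmx _ _ _ _ _); exact: leq_maxl.
- exact: pmx_sym.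
- exact: pmx_sym.
- exact: pmx_comm.
Qed.

(** With the zero curvature equation, the difference of both sides is
    [Q, P] u + P Q u - Q P u, where P = p(J)_a and Q = q(J)_a. *)
Lemma dact_sym p q x u n : dact p q x u n = dact q p x u n.
Proof.
have bP := @banded_gen R p (coef_a x) (coef_b x); have bQ := @banded_gen R q (coef_a x) (coef_b x).
apply/eqP; rewrite -subr_eq0 /dact; apply/eqP.
rewrite (_ : _ - _ = (act (dgen p q x) u n - act (dgen q p x) u n) +
  (act (gen p x) (act (gen q x) u) n - act (gen q x) (act (gen p x) u) n)); last by ring.
rewrite -(actB _ _ (@banded_dgen _ _ _) (@banded_dgen _ _ _)).
rewrite (eq_act _ _ (@dgen_sym p q x)) /comm.
rewrite (actB _ _ (banded_mul bQ bP) (banded_mul bP bQ)).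
by rewrite -(actA _ bQ bP) -(actA _ bP bQ) subrKA subrr.
Qed.

(** Zero curvature reduces the claim to the Jacobi identity for q(J)_a, p(J)_a
    and J. *)
Lemma dlax_sym p q x i j : dlax p q x i j = dlax q p x i j.
Proof.
pose P := gen p x; pose Q := gen q x; pose J := tri (coef_a x) (coef_b x).
have bP : banded _ P := @banded_gen R p (coef_a x) (coef_b x).
have bQ : banded _ Q := @banded_gen R q (coef_a x) (coef_b x).
have bJ : banded _ J := @banded_tri R (coef_a x) (coef_b x).
have bD := @banded_dgen p q x; have bD' := @banded_dgen q p x.
have H : comm (dgen p q x) J i j - comm (dgen q p x) J i j =
    comm (comm Q P) J i j.
  rewrite /comm -/Q -/P.
  have e1 : bmul (dgen p q x) J i j - bmul (dgen q p x) J i j = bmul (comm Q P) J i j.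
    by rewrite -(bmulBl _ bD bD'); apply: eq_bmul => // k l; exact: dgen_sym.
  have e2 : bmul J (dgen p q x) i j - bmul J (dgen q p x) i j = bmul J (comm Q P) i j.
    by rewrite -(bmulBr _ _ bJ); apply: eq_bmul => // k l; exact: dgen_sym.
  rewrite /comm in e1 e2; rewrite -e1 -e2; ring.
apply/eqP; rewrite -subr_eq0 /dlax -/P -/Q -/J; apply/eqP.
rewrite (_ : _ - _ = (comm (dgen p q x) J i j - comm (dgen q p x) J i j) +
  (comm P (comm Q J) i j - comm Q (comm P J) i j)); last by rewrite /lax -/J -/P -/Q; ring.
rewrite H /comm.
rewrite (bmulBl _ (banded_mul bQ bP) (banded_mul bP bQ)) (bmulBr _ _ bJ).
rewrite (bmulBr _ _ bP) (bmulBr _ _ bQ).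
rewrite (bmulBl _ (banded_mul bQ bJ) (banded_mul bJ bQ)).
rewrite (bmulBl _ (banded_mul bP bJ) (banded_mul bJ bP)).
rewrite !(bmulA _ bP bQ) !(bmulA _ bQ bP) !(bmulA _ bP bJ) !(bmulA _ bQ bJ).
rewrite !(bmulA _ bJ bP) !(bmulA _ bJ bQ).
rewrite -!(bmulA _ bP bJ) -!(bmulA _ bQ bJ) -!(bmulA _ bJ bP) -!(bmulA _ bJ bQ).
ring.
Qed.

End Eigensolutions.

(** * Additivity of the Toda cocycle *)

Section SumFamilies.
Variables (R : realType) (I : Type) (Sol : (R -> I -> R) -> Prop).
Local Notation calc := (diff_along Sol).

Lemma lip_sumtype A B (F : A + B -> (I -> R) -> R) :
  lipf (fun a => F (inl a)) -> lipf (fun b => F (inr b)) -> lipf F.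
Proof.
move=> HA HB M; have [C C0 HC] := HA M; have [D D0 HD] := HB M.
exists (C + D); first by rewrite addr_ge0.
move=> [a|b] x y d bx by_ d0 xy.
  have [h1 h2] := HC a x y d bx by_ d0 xy; split; rewrite ?mulrDl.
    by rewrite (le_trans h1)// lerDl.
  by rewrite (le_trans h2)// lerDl mulr_ge0.
have [h1 h2] := HD b x y d bx by_ d0 xy; split; rewrite ?mulrDl.
  by rewrite (le_trans h1)// lerDr.
by rewrite (le_trans h2)// lerDr mulr_ge0.
Qed.

Lemma calc_sumtype A B (F : A + B -> (I -> R) -> R) :
  calc (fun a => F (inl a)) -> calc (fun b => F (inr b)) -> calc F.
Proof.
move=> [LA [D1 L1 H1]] [LB [D2 L2 H2]]; split; first exact: lip_sumtype.
exists (fun ab => match ab with inl a => D1 a | inr b => D2 b end).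
  exact: lip_sumtype.
by move=> y sy t [a|b]; [exact: H1|exact: H2].
Qed.

Lemma calc_bool2 (F : bool * bool -> (I -> R) -> R) :
  (forall r b, calc (fun _ : unit => F (r, b))) -> calc F.
Proof.
move=> H; apply: (@diff_along_ext _ _ _ _ _ (fun rb x =>
  if rb.1 then if rb.2 then F (true, true) x else F (true, false) x
  else if rb.2 then F (false, true) x else F (false, false) x)).
  by move=> [[] []].
have G r b : calc (fun _ : bool * bool => F (r, b)).
  exact: (calc_reindex (fun _ => tt) (H r b)).
by apply: calc_if; apply: calc_if.
Qed.

End SumFamilies.

Section Augmented.
Variable R : realType.
Local Notation C := R[i].
Local Notation E := (int + int -> R).
Local Notation V := (bool -> C).
Local Notation A := (int + int + bool * bool)%type.
Implicit Types (p q : {poly R}) (z : C) (e : A -> R) (J : jacobi R) (v : V).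

Definition jac_part e : E := fun i => e (inl i).
Definition vec_part e : V := fun r => (e (inr (r, true))) +i* (e (inr (r, false))).
Definition join (x : E) v : A -> R :=
  fun i => match i with inl j => x j | inr rb => part rb.2 (v rb.1) end.

Lemma vec_join x v : vec_part (join x v) = v.
Proof. by apply/funext => r; exact: complexP. Qed.

Lemma join_parts e : join (jac_part e) (vec_part e) = e.
Proof. by apply/funext => -[i|[r []]]. Qed.

(** The vector field of p on pairs (J, v) with v a vector of C^2 moved by B_p. The
    cocycle property for sums of polynomials says that the flows of these fields
    commute. *)
Definition aug_field p z e : A -> R := join (toda_field p (jac_part e)) (lin (Bcoef p z (jac_part e)) (vec_part e)).

Lemma calc_aug Sol p z : diff_along Sol (fun (i : A) e => e i) ->
  diff_along Sol (fun i e => aug_field p z e i).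
Proof.
move=> coord; apply: calc_sumtype.
  apply: (diff_along_ext (G := fun i (e : A -> R) => toda_field p
    (fun j => match j with inl n => e (inl (inl n)) | inr n => e (inl (inr n)) end) i)).
    by move=> i e; rewrite /aug_field /join; congr toda_field; apply/funext => -[].
  exact: (calc_toda_field (fun n => inl (inl n)) (fun n => inl (inr n)) p coord).
apply: calc_bool2 => r b.
have HB c : cdiff_along Sol (fun (_ : unit) (e : A -> R) => Bcoef p z (jac_part e) r c).
  have := ccalc_Bcoef (fun n => inl (inl n)) (fun n => inl (inr n)) coord p z r c.
  apply: ccalc_ext => _ e; congr Bcoef; apply/funext => -[]//.
have Hv c : cdiff_along Sol (fun (_ : unit) (e : A -> R) => vec_part e c).
  by split; exact: (calc_coord coord (fun=> inr (c, _))).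
have [H1 H2] : cdiff_along Sol
    (fun (_ : unit) (e : A -> R) => lin (Bcoef p z (jac_part e)) (vec_part e) r).
  by apply: ccalcD; exact: ccalcM.
by case: b.
Qed.

Lemma lip_aug p z : vfield_lip (aug_field p z).
Proof. by have [L _] := calc_aug p z (lip_state R A). Qed.

Lemma aug_solP p z (y : R -> A -> R) : is_sol (aug_field p z) y <->
  is_sol (toda_field p) (fun t => jac_part (y t)) /\
  forall (t : R) r, cder (fun s => vec_part (y s) r) t (lin (Bcoef p z (jac_part (y t))) (vec_part (y t)) r).
Proof.
split=> [sy|[sx sv] t [i|[r b]]].
- split=> [t i|t r]; first exact: (sy t (inl i)).
  by split; [exact: (sy t (inr (r, true)))|exact: (sy t (inr (r, false)))].
- exact: sx.
- by have [h1 h2] := sv t r; case: b.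
Qed.

(** Identities that divide by the a's, or that use an actual flow, are only
    available at states of this form. *)
Definition from_jacobi e := exists J, jac_part e = raw J.

Definition init_ext z e : int -> C :=
  ext z (jac_part e) (- vec_part e false / coef_aC (jac_part e) 0) (vec_part e true).

Lemma from_jacobi_pos e n : from_jacobi e -> 0 < coef_a (jac_part e) n.
Proof. by move=> [J ->]; exact: ja_gt0. Qed.

Lemma from_jacobi_neq0 e n : from_jacobi e -> coef_aC (jac_part e) n != 0.
Proof. by move=> ge; rewrite fmorph_eq0 gt_eqF// from_jacobi_pos. Qed.

Lemma init_eigen z e : from_jacobi e -> eigen z (jac_part e) (init_ext z e).
Proof. by move=> ge; apply: ext_eigen => n; exact: from_jacobi_neq0. Qed.

Lemma init_data z e r : from_jacobi e -> eigen_data (jac_part e) (init_ext z e) r = vec_part e r.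
Proof.
by move=> ge; case: r => //; rewrite /eigen_data /=; field; exact: from_jacobi_neq0.
Qed.

(** The derivative of the p-field along the q-flow, expressed through the
    eigensolution with data e, where its symmetry in p and q is visible. *)
Definition second p q z e : A -> R :=
  let x := jac_part e in let u := init_ext z e in
  join (fun i => match i with
          | inl n => dlax p q x n (n + 1) | inr n => dlax p q x n n end)
       (fun r => if r then dact p q x u 1 else
          - ((dlax p q x 0 1)%:C * u 0 +
             ((toda_field p x (inl 0))%:C * act (toda_gen q (coef_a x) (coef_b x)) u 0 +
              (toda_field q x (inl 0))%:C * act (toda_gen p (coef_a x) (coef_b x)) u 0) +
             coef_aC x 0 * dact p q x u 0)).

Lemma second_sym p q z e : second p q z e = second q p z e.
Proof.
rewrite /second; congr join.
  by apply/funext => -[n|n]; exact: dlax_sym.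
apply/funext => -[]; first exact: dact_sym.
by rewrite dlax_sym dact_sym [X in _ + X + _]addrC.
Qed.

(** The data of the eigensolution move by B_q, so the eigensolution itself moves
    by q(J)_a; in terms of it, B_p v is p(J)_a u, whose derivative is known. *)
Lemma aug_deriv p q z (y : R -> A -> R) : is_sol (aug_field q z) y ->
  (forall s, from_jacobi (y s)) -> forall (t : R) i,
  is_derive t 1 (fun s => aug_field p z (y s) i) (second p q z (y t) i).
Proof.
move=> /aug_solP[sx sv] gy t.
pose x s := jac_part (y s); pose u s := init_ext z (y s).
have Ju s : eigen z (x s) (u s) by exact: init_eigen.
have du : forall n (t : R), cder (fun s => u s n) t
    (act (toda_gen q (coef_a (x t)) (coef_b (x t))) (u t) n).
  move=> n s; apply: (@eigen_evolution _ q z x u) => //.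
    by move=> w m; exact: from_jacobi_pos.
  move=> w r; apply: (@cder_ext _ _ (fun s => vec_part (y s) r)).
    by move=> w'; exact: init_data.
  have := sv w r; congr cder; congr lin.
  by apply/funext => c; rewrite init_data.
have vE s : vec_part (y s) = eigen_data (x s) (u s).
  by apply/funext => r; rewrite init_data.
have dact' n := deriv_act p n sx (fun m => du m t).
move=> [[n|n]|[r b]].
- exact: deriv_lax.
- exact: deriv_lax.
have H r' : cder (fun s => lin (Bcoef p z (x s)) (vec_part (y s)) r') t
    (if r' then dact p q (x t) (u t) 1 else
          - ((dlax p q (x t) 0 1)%:C * u t 0 +
             ((toda_field p (x t) (inl 0))%:C * act (toda_gen q (coef_a (x t)) (coef_b (x t))) (u t) 0 +
              (toda_field q (x t) (inl 0))%:C * act (toda_gen p (coef_a (x t)) (coef_b (x t))) (u t) 0) +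
             coef_aC (x t) 0 * dact p q (x t) (u t) 0)).
  case: r'.
    by apply: cder_ext (dact' 1) => s; rewrite vE field_true.
  apply: (@cder_ext _ _ (fun s => - ((toda_field p (x s) (inl 0))%:C * u s 0 +
      coef_aC (x s) 0 * act (toda_gen p (coef_a (x s)) (coef_b (x s))) (u s) 0))).
    by move=> s; rewrite vE field_false.
  have h1 : cder (fun s => (toda_field p (x s) (inl 0))%:C) t
      (dlax p q (x t) 0 (0 + 1))%:C.
    by apply: cder_real; exact: deriv_lax.
  have h2 : cder (fun s => coef_aC (x s) 0) t (toda_field q (x t) (inl 0))%:C.
    by apply: cder_real; exact: (sx t (inl 0)).
  have := cderN (cderD (cderM h1 (du 0 t)) (cderM h2 (dact' 0))).
  by move/cder_eq; apply; ring.
by have [h1 h2] := H r; case: b.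
Qed.

Lemma augD p q z e i : aug_field (p + q) z e i = aug_field p z e i + aug_field q z e i.
Proof.
case: i => [i|[r b]]; rewrite /aug_field /join; first exact: toda_fieldD.
rewrite -partD; congr part; rewrite /lin !BcoefD; ring.
Qed.

Definition row_ix (r : bool) : 'I_2 := if r then 0 else 1.
Definition mulv (T : 'M[C]_2) v : V := lin (fun r c => T (row_ix r) (row_ix c)) v.

Local Notation Tm := toda_cocycle_sol.

Lemma mulv_mul (S T : 'M[C]_2) v : mulv (S *m T) v = mulv S (mulv T v).
Proof.
apply/funext => r; rewrite /mulv /lin !mxE !big_ord_recl !big_ord0.
rewrite (_ : lift ord0 ord0 = 1 :> 'I_2); last exact: val_inj.
by rewrite /=; ring.
Qed.

Lemma mulv_inj (S T : 'M[C]_2) : (forall v, mulv S v = mulv T v) -> S = T.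
Proof.
move=> ST; apply/matrixP => i j; rewrite (ord2P i) (ord2P j).
have := congr1 (@^~ (i == 0)) (ST (fun c => (c == (j == 0))%:R)).
by rewrite /mulv /lin /row_ix; case: (j == 0); rewrite /= !mulr1 !mulr0 ?addr0 ?add0r.
Qed.

Lemma mulv1 v : mulv 1%:M v = v.
Proof. by apply/funext => -[]; rewrite /mulv /lin !mxE/=; ring. Qed.

Lemma vsol_mulv p J z v : vsol p J z (fun t => mulv (Tm p J z t) v).
Proof.
move=> t r; have := cderD (cderM (Tm_col p J z 0 t r) (cder_cst (v true) t))
  (cderM (Tm_col p J z 1 t r) (cder_cst (v false) t)).
by move/cder_eq; apply; rewrite /lin /mulv /lin /col2 /=; ring.
Qed.

Lemma vsol_growth p z M : exists2 K : R, 0 <= K & forall J,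
  (forall t, bounded_by M (flow p J t)) -> forall (v : R -> V) (N T : R), vsol p J z v -> 0 <= N ->
  (forall r, cn (v 0 r) <= N) -> forall t r, `|t| <= T ->
  cn (v t r) <= 6 * N * expR (2 * (4 * K + 1) * T).
Proof.
have H r c : exists2 K : R, 0 <= K & forall x : E, bounded_by M x -> cn (Bcoef p z x r c) <= K.
  exact: ccalc_bound (zdiff_Bcoef z (coord_flow p) p r c).1.
have [K1 K10 H1] := H true true; have [K2 K20 H2] := H true false.
have [K3 K30 H3] := H false true; have [K4 K40 H4] := H false false.
pose K := K1 + K2 + K3 + K4; have K0 : 0 <= K by rewrite !addr_ge0.
exists K => // J bJ v N T sv N0 vN t r tT.
have HK (s : R) r' c : `|s| <= T -> cn (Bcoef p z (flow p J s) r' c) <= K.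
  move=> _; have := H1 _ (bJ s); have := H2 _ (bJ s); have := H3 _ (bJ s);
  have := H4 _ (bJ s); rewrite /K; case: r'; case: c; lra.
have dv (s : R) c : `|s| <= T -> cder (fun s => v s c) s
    (lin (Bcoef p z (flow p J s)) (v s) c + 0).
  by move=> _; rewrite addr0; exact: sv.
have := @lin_gronwall R (fun t => Bcoef p z (flow p J t)) v (fun _ _ => 0) K N T
  K0 N0 HK dv vN (fun _ _ _ => ltac:(by rewrite cn0)) (vsol_ccont sv) t r tT.
move/le_trans; apply; rewrite ler_wpM2l ?mulr_ge0// ler_expR ler_wpM2l//.
by rewrite mulr_ge0// addr_ge0// mulr_ge0.
Qed.

Definition joint_orbit p J z v t : A -> R := join (flow p J t) (mulv (Tm p J z t) v).

Lemma joint_orbit_sol p J z v : is_sol (aug_field p z) (joint_orbit p J z v).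
Proof.
apply/aug_solP; split; first exact: toda_flow_is_sol.
move=> t r; rewrite vec_join; apply: (cder_ext (g := fun s => mulv (Tm p J z s) v r)).
  by move=> s; rewrite vec_join.
exact: vsol_mulv.
Qed.

Lemma joint_orbit_from_jacobi p J z v t : from_jacobi (joint_orbit p J z v t).
Proof. by exists (toda_flow p J t). Qed.

Lemma joint_orbit0 p J z v : joint_orbit p J z v 0 = join (raw J) v.
Proof. by rewrite /joint_orbit Tm0 mulv1 /flow toda_flow0. Qed.

Lemma bnd_join (x : E) v (M N : R) : bounded_by M x -> (forall r, cn (v r) <= N) ->
  0 <= M -> 0 <= N -> bounded_by (M + N) (join x v).
Proof.
move=> bx bv M0 N0 [i|[r b]]; rewrite /join/=.
  by rewrite (le_trans (bx i))// lerDl.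
by rewrite (le_trans (part_cn _ _))// (le_trans (bv r))// lerDr.
Qed.

(** Two-parameter family x s u: first the q-flow for time u, then the p-flow for
    time s. Its diagonal is an orbit of p + q because the fields commute
    infinitesimally at actual Jacobi matrices. *)
Lemma cocycle_vector p q J z v t :
  mulv (Tm (p + q) J z t) v = mulv (Tm p (toda_flow q J t) z t) (mulv (Tm q J z t) v).
Proof.
pose x s u := joint_orbit p (toda_flow q J u) z (mulv (Tm q J z u) v) s.
have [M0 M00 bJ] := raw_bounded J.
have M1_0 : 0 < 3 * M0 by rewrite mulr_gt0.
have M2_0 : 0 < 3 * (3 * M0) by rewrite mulr_gt0.
have bq u : bounded_by (3 * M0) (flow q J u) by exact: toda_flow_bnd.
have bpq u s : bounded_by (3 * (3 * M0)) (flow p (toda_flow q J u) s).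
  by apply: toda_flow_bnd => //; exact: bq.
pose N0 := cn (v true) + cn (v false).
have N00 : 0 <= N0 by rewrite addr_ge0 ?cn_ge0.
have vN r : cn (mulv (Tm q J z 0) v r) <= N0.
  by rewrite Tm0 mulv1 /N0; case: r; rewrite ?lerDl ?lerDr cn_ge0.
have [Kq Kq0 HKq] := vsol_growth q z (3 * M0).
have [Kp Kp0 HKp] := vsol_growth p z (3 * (3 * M0)).
have [Kr Kr0 HKr] := vsol_growth q z (3 * (3 * (3 * M0))).
pose N1 T := 6 * N0 * expR (2 * (4 * Kq + 1) * T).
pose N2 T := 6 * N1 T * expR (2 * (4 * Kp + 1) * T).
have N10 T : 0 <= N1 T by rewrite !mulr_ge0 ?expR_ge0.
have N20 T : 0 <= N2 T by rewrite mulr_ge0 ?expR_ge0// mulr_ge0.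
have vN1 T u r : `|u| <= T -> cn (mulv (Tm q J z u) v r) <= N1 T.
  by move=> uT; exact: (HKq J bq _ N0 T (vsol_mulv q J z v) N00 vN u r uT).
have vN2 T s u r : `|s| <= T -> `|u| <= T ->
    cn (mulv (Tm p (toda_flow q J u) z s) (mulv (Tm q J z u) v) r) <= N2 T.
  move=> sT uT; apply: (HKp _ (bpq u) _ (N1 T) T (vsol_mulv p _ z _) (N10 T) _ s r sT).
  by move=> r'; rewrite Tm0 mulv1; exact: vN1.
have coord w : diff_along (is_sol (aug_field w z)) (fun (i : A) e => e i).
  split; first exact: lip_coord.
  by exists (fun i e => aug_field w z e i); [exact: lip_aug|move=> y sy s i; exact: sy].
have [_ [D1 L1 H1]] := calc_aug p z (coord q).
have [_ [D2 L2 H2]] := calc_aug q z (coord p).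
have orb w e : from_jacobi e -> exists y, [/\ is_sol (aug_field w z) y, forall s, from_jacobi (y s) & y 0 = e].
  move=> [J' eJ]; exists (joint_orbit w J' z (vec_part e)); split.
  - exact: joint_orbit_sol.
  - by move=> s; exact: joint_orbit_from_jacobi.
  - by rewrite joint_orbit0 -eJ join_parts.
(* the derivatives supplied by the calculus are identified by following an orbit through e *)
have Weq e : from_jacobi e -> (fun i => D1 i e) =1 (fun i => D2 i e).
  move=> ge i.
  have [y [sy gy y0]] := orb q e ge; have [y' [sy' gy' y'0]] := orb p e ge.
  have d1 := drv_unique (H1 y sy 0 i) (aug_deriv p sy gy 0 i).
  have d2 := drv_unique (H2 y' sy' 0 i) (aug_deriv q sy' gy' 0 i).
  by rewrite -y0 d1 y0 second_sym -y'0 -d2.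
have diag := @commuting_diagonal R A (aug_field p z) (aug_field q z) (fun e i => D1 i e)
  (fun e i => D2 i e) from_jacobi (lip_aug p z) (lip_aug q z) L1
  (fun y sy _ t i => H1 y sy t i) (fun y sy _ t i => H2 y sy t i) Weq x.
have {diag} sx : is_sol (aug_field (p + q) z) (fun t => x t t).
  move=> s i; rewrite augD; apply: diag.
  - by move=> s' u; exact: joint_orbit_from_jacobi.
  - by move=> u; exact: joint_orbit_sol.
  - rewrite (_ : x 0 = joint_orbit q J z v); first exact: joint_orbit_sol.
    by apply/funext => u; rewrite /x joint_orbit0.
  - move=> T; exists (3 * (3 * M0) + N2 T) => s' u sT uT.
    apply: bnd_join => //; [by move=> r; exact: vN2|exact: ltW].
  - move=> T; exists (3 * (3 * (3 * M0)) + 6 * N2 T * expR (2 * (4 * Kr + 1) * 1)).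
    move=> s' u sT uT.
    pose J' := toda_flow p (toda_flow q J u) s'.
    pose v' := mulv (Tm p (toda_flow q J u) z s') (mulv (Tm q J z u) v).
    have bJ' w : bounded_by (3 * (3 * (3 * M0))) (flow q J' w).
      by apply: toda_flow_bnd => //; exact: bpq.
    exists (joint_orbit q J' z v'); split.
    + exact: joint_orbit_sol.
    + by move=> h; exact: joint_orbit_from_jacobi.
    + by rewrite joint_orbit0.
    + move=> h h1; apply: bnd_join => //.
      * move=> r; apply: (HKr J' bJ' _ (N2 T) 1 (vsol_mulv q J' z v') (N20 T) _ h r h1).
        by move=> r'; rewrite Tm0 mulv1; exact: vN2.
      * by rewrite mulr_ge0// ltW.
      * by rewrite !mulr_ge0 ?expR_ge0.
have /aug_solP[sf sv] := sx.
have ef : flow (p + q) J = fun t => jac_part (x t t).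
  apply: toda_flow_unique => //.
    by rewrite /x joint_orbit0 /jac_part /join toda_flow0.
  by move=> T; exists (3 * (3 * M0)) => s _; exact: bpq.
have vs : vsol (p + q) J z (fun t => vec_part (x t t)).
  by move=> s r; rewrite ef; exact: sv.
have := vsol_unique (vsol_mulv (p + q) J z v) vs _.
rewrite /x joint_orbit0 !Tm0 !mulv1 vec_join => /(_ erefl)/(congr1 (@^~ t))/= ->.
by rewrite vec_join.
Qed.

Lemma T_todaD p q J z : T_toda (p + q) J z = T_toda p (toda q J) z *m T_toda q J z.
Proof. by apply: mulv_inj => v; rewrite mulv_mul; exact: cocycle_vector. Qed.

End Augmented.

(** * The shift cocycle and the joint cocycle *)

Section ShiftIntertwining.
Variable R : realType.
Local Notation C := R[i].
Local Notation E := (int + int -> R).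
Implicit Types (p q : {poly R}) (z : C) (J : jacobi R) (x : E) (u : int -> C).
Local Notation Tm := toda_cocycle_sol.

Lemma gen_shift p x (n i j : int) :
  toda_gen p (coef_a (shift_state n x)) (coef_b (shift_state n x)) i j =
  toda_gen p (coef_a x) (coef_b x) (i + n) (j + n).
Proof.
rewrite /toda_gen /anti !ltrD2r.
rewrite -[coef_a (shift_state n x)]/(fun m => coef_a x (m + n)).
rewrite -[coef_b (shift_state n x)]/(fun m => coef_b x (m + n)).
by rewrite !polym_shift.
Qed.

Lemma act_shift p x u (n m : int) :
  act (toda_gen p (coef_a (shift_state n x)) (coef_b (shift_state n x)))
    (fun l => u (l + n)) m = act (toda_gen p (coef_a x) (coef_b x)) u (m + n).
Proof.
rewrite !(act_win _ _ (@banded_gen _ p _ _)) !sum_win.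
apply: eq_bigr => i _; rewrite gen_shift.
by rewrite (_ : m - _ + _ + n = m + n - (size p)%:Z + i%:Z)//; lia.
Qed.

Lemma eigen_shift z x u n : eigen z x u ->
  eigen z (shift_state n x) (fun l => u (l + n)).
Proof.
move=> Ju m; rewrite -Ju /jop /coef_aC /coef_bC /coef_a /coef_b /shift_state.
by rewrite [m + 1 + n]addrAC [m - 1 + n]addrAC.
Qed.

Lemma mulv_shift z J u : eigen z (raw J) u ->
  mulv (shift_mx J z) (eigen_data (raw J) u) =
  eigen_data (shift_state 1 (raw J)) (fun l => u (l + 1)).
Proof.
move=> Ju; have a1 : (ja J 1)%:C != 0 :> C by rewrite fmorph_eq0 gt_eqF// ja_gt0.
apply/funext => -[]; rewrite /mulv /lin /eigen_data /shift_mx /mx2 !mxE /=.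
  have := Ju 1; rewrite /jop /coef_aC /coef_bC /coef_a /coef_b /raw (_ : (1 : int) - 1 = 0)//.
  move=> /(congr1 (fun w => w / (ja J 1)%:C)).
  rewrite (_ : _ / _ = u (1 + 1) + ((ja J 0)%:C * u 0 + (jb J 1)%:C * u 1) / (ja J 1)%:C).
    by move/(canRL (addrK _)) => ->; field.
  by field.
by rewrite /coef_aC /coef_a /shift_state /raw add0r; ring.
Qed.

(** The shift matrix takes the data (u_1, -a_0 u_0) of an eigensolution to the
    data (u_2, -a_1 u_1) of the shifted one. As the whole eigensolution moves by
    p(J)_a, the shifted data solve the cocycle equation of the shifted matrix. *)
Lemma shift_vector p z J v t :
  mulv (Tm p (jshift 1 J) z t) (mulv (shift_mx J z) v) =
  mulv (shift_mx (toda_flow p J t) z) (mulv (Tm p J z t) v).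
Proof.
pose y := joint_orbit p J z v.
have sy : is_sol (aug_field p z) y by exact: joint_orbit_sol.
have gy s : from_jacobi (y s) by exact: joint_orbit_from_jacobi.
have [sx sv] := (aug_solP _ _ _).1 sy.
pose x s := flow p J s; pose u s := init_ext z (y s).
have Ju s : eigen z (x s) (u s) by exact: (init_eigen z (gy s)).
have vE s : mulv (Tm p J z s) v = eigen_data (x s) (u s).
  apply/funext => r; rewrite -[RHS]/(eigen_data (jac_part (y s)) (u s) r).
  by rewrite (init_data _ _ (gy s)) vec_join.
have du n (s : R) : cder (fun s => u s n) s
    (act (toda_gen p (coef_a (x s)) (coef_b (x s))) (u s) n).
  apply: (@eigen_evolution _ p z x u) => //.
    by move=> w m; exact: (from_jacobi_pos m (gy w)).
  move=> w r; rewrite -vE; apply: (@cder_ext _ _ (fun s => mulv (Tm p J z s) v r)).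
    by move=> w'; rewrite -vE.
  exact: vsol_mulv.
pose w s := mulv (shift_mx (toda_flow p J s) z) (mulv (Tm p J z s) v).
have wE s : w s = eigen_data (shift_state 1 (x s)) (fun l => u s (l + 1)).
  by rewrite /w vE; exact: (mulv_shift (Ju s)).
have sw : vsol p (jshift 1 J) z w.
  move=> s r; rewrite /flow toda_flow_shift raw_shift -/(flow p J s) -/(x s).
  apply: (@cder_ext _ _ (fun s => eigen_data (shift_state 1 (x s)) (fun l => u s (l + 1)) r)).
    by move=> s'; rewrite wE.
  rewrite wE; have Js := eigen_shift 1 (Ju s); case: r.
    by rewrite (field_true p Js) act_shift; exact: du.
  rewrite (field_false p Js) act_shift toda_field_shift.
  have da : cder (fun s => coef_aC (x s) (0 + 1)) s (toda_field p (x s) (inl (0 + 1)))%:C.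
    by apply: cder_real; exact: (toda_flow_is_sol p J s (inl _)).
  have := cderN (cderM da (du (0 + 1) s)).
  by move/cder_eq; apply; congr (- _); rewrite addrC.
have := vsol_unique (vsol_mulv p (jshift 1 J) z (mulv (shift_mx J z) v)) sw.
rewrite /w !Tm0 !mulv1 toda_flow0 => /(_ erefl).
exact: (congr1 (@^~ t)).
Qed.

Lemma shift_toda p z J : T_toda p (jshift 1 J) z *m shift_mx J z =
  shift_mx (toda p J) z *m T_toda p J z.
Proof. by apply: mulv_inj => v; rewrite !mulv_mul; exact: shift_vector. Qed.

End ShiftIntertwining.

Section ShiftCocycle.
Variable R : realType.
Local Notation C := R[i].
Implicit Types (p q : {poly R}) (z : C) (J : jacobi R) (n m : int).

Lemma jshiftD n m J : jshift n (jshift m J) = jshift (n + m) J.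
Proof.
apply: raw_inj; rewrite !raw_shift; apply/funext => -[k|k];
  by rewrite /shift_state addrA.
Qed.

Lemma jshift0 J : jshift 0 J = J.
Proof.
by apply: raw_inj; rewrite raw_shift; apply/funext => -[k|k]; rewrite /shift_state addr0.
Qed.

Lemma toda_shift p n J : toda p (jshift n J) = jshift n (toda p J).
Proof. exact: toda_flow_shift. Qed.

Lemma det_shift_mx z J : \det (shift_mx J z) = 1.
Proof.
have a1 : (ja J 1)%:C != 0 :> C by rewrite fmorph_eq0 gt_eqF// ja_gt0.
by rewrite det2 /shift_mx /mx2 !mxE /=; field.
Qed.

Lemma shift_mx_unit z J : shift_mx J z \in unitmx.
Proof. by rewrite unitmxE det_shift_mx unitr1. Qed.

Lemma det_T_shift_nat k z J : \det (T_shift_nat k J z) = 1.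
Proof.
elim: k => [|k IH] /=; first exact: det1.
by rewrite det_mulmx det_shift_mx IH mulr1.
Qed.

Lemma T_shift_nat_unit k z J : T_shift_nat k J z \in unitmx.
Proof. by rewrite unitmxE det_T_shift_nat unitr1. Qed.

Lemma T_shift_natS k z J :
  T_shift_nat k.+1 J z = T_shift_nat k (jshift 1 J) z *m shift_mx J z.
Proof.
elim: k J => [|k IH] J; first by rewrite /= jshift0 mulmx1 mul1mx.
rewrite -[LHS]/(shift_mx (jshift k.+1 J) z *m T_shift_nat k.+1 J z) IH mulmxA.
by rewrite -[T_shift_nat k.+1 _ _]/(shift_mx (jshift k (jshift 1 J)) z *m _)
  jshiftD (_ : k%:Z + 1 = k.+1)//; lia.
Qed.

(** The definition of T_shift is by cases on the sign; this one-step relation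
    holds throughout, and characterizes T_shift as shift matrices are
    invertible. *)
Lemma T_shiftS n z J : T_shift (n + 1) J z = shift_mx (jshift n J) z *m T_shift n J z.
Proof.
case: n => k; first by rewrite (_ : Posz k + 1 = k.+1)//; lia.
rewrite -[T_shift (Negz k) J z]/(invmx (T_shift_nat k.+1 (jshift (- k.+1%:Z) J) z)).
rewrite T_shift_natS jshiftD.
set A := shift_mx _ z; set B := T_shift_nat k _ z.
have e : invmx (B *m A) = invmx A *m invmx B.
  have uA : A \in unitmx := shift_mx_unit z _.
  have uB : B \in unitmx := T_shift_nat_unit k z _.
  have uBA : B *m A \in unitmx by rewrite unitmx_mul uB.
  rewrite -[RHS](mulKmx uBA) (_ : B *m A *m _ = 1%:M) ?mulmx1//.
  by rewrite mulmxA -(mulmxA B) mulmxV// mulmx1 mulmxV.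
rewrite e mulmxA /A NegzE mulmxV ?shift_mx_unit// mul1mx /B.
case: k {A B e} => [|k]; first by rewrite /= invmx1.
rewrite (_ : - k.+2%:Z + 1 = Negz k); last by lia.
by rewrite /T_shift (_ : 1 - k.+2%:Z = - k.+1%:Z)//; lia.
Qed.

Lemma T_shift0 z J : T_shift 0 J z = 1%:M. Proof. by []. Qed.

Lemma int_two_sided (P : int -> Prop) : P 0 -> (forall n, P n <-> P (n + 1)) ->
  forall n, P n.
Proof.
move=> P0 PS n.
have up (k : nat) : P k by elim: k => // k /PS; rewrite (_ : k%:Z + 1 = k.+1)//; lia.
have dn (k : nat) : P (- k%:Z).
  elim: k => [|k IH]; first by rewrite oppr0.
  by apply/PS; rewrite (_ : - k.+1%:Z + 1 = - k%:Z)//; lia.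
have [k [->|->]] : exists k : nat, n = k%:Z \/ n = - k%:Z by exists (absz n); lia.
  exact: up.
exact: dn.
Qed.

Lemma mulmx_shift_inj z J (S T : 'M[C]_2) :
  S = T <-> shift_mx J z *m S = shift_mx J z *m T.
Proof.
split=> [->//|/(congr1 (mulmx (invmx (shift_mx J z))))].
by rewrite !mulKmx// shift_mx_unit.
Qed.

Lemma T_shiftD n m z J :
  T_shift (n + m) J z = T_shift n (jshift m J) z *m T_shift m J z.
Proof.
elim/int_two_sided: n => [|n]; first by rewrite add0r T_shift0 mul1mx.
rewrite (mulmx_shift_inj z (jshift (n + m) J)) addrAC !T_shiftS.
by rewrite -mulmxA jshiftD.
Qed.

Lemma T_shift_toda n p z J :
  T_toda p (jshift n J) z *m T_shift n J z = T_shift n (toda p J) z *m T_toda p J z.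
Proof.
elim/int_two_sided: n => [|n]; first by rewrite !T_shift0 mulmx1 mul1mx jshift0.
rewrite (mulmx_shift_inj z (jshift n (toda p J))) !T_shiftS !mulmxA.
by rewrite -toda_shift -shift_toda jshiftD [1 + n]addrC.
Qed.

End ShiftCocycle.

Section SLGroup.
Variable R : realType.
Local Notation C := R[i].
Implicit Types (p q : {poly R}) (z : C) (J : jacobi R) (n m : int)
  (T S : C -> 'M[C]_2).

Lemma SL_mul T S : SL T -> SL S -> SL (fun z => T z *m S z).
Proof.
move=> [eT dT rT] [eS dS rS]; split.
- move=> i j; rewrite (_ : (fun z => _) = fun z => T z i 0 * S z 0 j + T z i 1 * S z 1 j).
    by apply: entireD; exact: entireM.
  apply/funext => z; rewrite mxE !big_ord_recl big_ord0 addr0.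
  by rewrite (_ : lift ord0 ord0 = 1 :> 'I_2)//; exact: val_inj.
- by move=> z; rewrite det_mulmx dT dS mulr1.
- move=> x; have [M dM eM] := rT x; have [N dN eN] := rS x.
  by exists (M *m N); rewrite ?det_mulmx ?dM ?dN ?mulr1// map_mxM eM eN.
Qed.

Lemma SL_one : SL (fun _ : C => 1%:M : 'M[C]_2).
Proof.
split=> [i j|z|x]; first exact: entire_cst.
  exact: det1.
by exists 1%:M; rewrite ?det1// map_mx1.
Qed.

Lemma inv2 (T : 'M[C]_2) : \det T = 1 ->
  invmx T = mx2 (T 1 1) (- T 0 1) (- T 1 0) (T 0 0).
Proof.
move=> dT; have uT : T \in unitmx by rewrite unitmxE dT unitr1.
rewrite -[RHS](mulKmx uT) (_ : T *m _ = 1%:M) ?mulmx1//.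
move: dT; rewrite det2 => dT.
apply/matrixP => i j; rewrite mxE !big_ord_recl big_ord0 addr0.
rewrite (_ : lift ord0 ord0 = 1 :> 'I_2); last exact: val_inj.
rewrite /mx2 !mxE (ord2P i) (ord2P j).
by case: (i == 0); case: (j == 0); rewrite /= ?eqxx -?dT /=; ring.
Qed.

Lemma SL_inv T : SL T -> SL (fun z => invmx (T z)).
Proof.
move=> [eT dT rT]; split.
- move=> i j; rewrite (_ : (fun z => _) = fun z =>
      if i == 0 then (if j == 0 then T z 1 1 else - T z 0 1)
      else (if j == 0 then - T z 1 0 else T z 0 0)).
    by case: (i == 0); case: (j == 0) => //; exact: entireN.
  by apply/funext => z; rewrite inv2// /mx2 mxE.
- by move=> z; rewrite det_inv dT invr1.
- move=> x; have [M dM eM] := rT x.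
  by exists (invmx M); rewrite ?det_inv ?dM ?invr1// map_invmx eM.
Qed.

Lemma SL_shift_mx J : SL (shift_mx J).
Proof.
split=> [i j|z|x]; last 2 first.
- exact: det_shift_mx.
- pose M : 'M[R]_2 := \matrix_(i, j) complex.Re (shift_mx J x%:C i j).
  have eM : shift_mx J x%:C = map_mx (real_complex R) M.
    apply/matrixP => i j; rewrite !mxE.
    have im0 (w : C) : complex.Im w = 0 -> w = (complex.Re w)%:C.
      by move=> h; apply: complexP.
    apply: im0.
    rewrite -fmorphV -rmorphB -rmorphM -rmorphN.
    by case: (i == 0); case: (j == 0).
  exists M => //; apply: (@complexI R).
  by have := det_shift_mx x%:C J; rewrite eM det_map_mx.
rewrite (_ : (fun z => _) = fun z =>
    if i == 0 then (if j == 0 then (z - (jb J 1)%:C) / (ja J 1)%:C else (ja J 1)%:C^-1)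
    else (if j == 0 then - (ja J 1)%:C else 0)); last first.
  by apply/funext => z; rewrite /shift_mx /mx2 mxE.
case: (i == 0); case: (j == 0).
- apply: entireM; last exact: entire_cst.
  by apply: entireD; [exact: entire_id|exact: entire_cst].
- exact: entire_cst.
- exact: entire_cst.
- exact: entire_cst.
Qed.

Lemma SL_T_shift n J : SL (T_shift n J).
Proof.
have H k J' : SL (T_shift_nat k J').
  by elim: k => [|k IH]; [exact: SL_one|apply: SL_mul => //; exact: SL_shift_mx].
by case: n => k; [exact: H|apply: SL_inv; exact: H].
Qed.

Lemma SL_T_toda p J : SL (T_toda p J).
Proof.
split=> [i j|z|x]; first exact: Tm_entire.
  exact: Tm_det.
pose M : 'M[R]_2 := \matrix_(i, j) complex.Re (T_toda p J x%:C i j).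
have eM : T_toda p J x%:C = map_mx (real_complex R) M.
  by apply/matrixP => i j; rewrite !mxE; apply: complexP => //=; exact: Tm_real.
exists M => //; apply: (@complexI R).
by have := Tm_det p J x%:C 1; rewrite -/(T_toda p J x%:C) eM det_map_mx.
Qed.

End SLGroup.

Theorem theorem2p2 (R : realType) :
  SL_cocycle (@todashift R) (@T_todashift R).
Proof.
split=> [[p n] J|[p n] [q m] J z].
  by apply: SL_mul; [exact: SL_T_toda|exact: SL_T_shift].
rewrite /T_todashift /todashift /=.
rewrite T_todaD T_shiftD -jshiftD -toda_shift.
rewrite -!mulmxA; congr (_ *m _); rewrite !mulmxA; congr (_ *m _).
exact: T_shift_toda.
Qed.
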